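(* Let $\Phi$, $\Phi'$ be Leonard systems over a field $\mathbb{K}$ with diameters $d$ and $d'$ respectively, where $1\leqslant d'\leqslant d$, and let $\rho$ be an integer with $0\leqslant\rho\leqslant d-d'$. Let the parameter array $p(\Phi)$ of $\Phi$ be given as in (one of) the Cases I, IA, II, IIA, IIB, IIC, III, IV listed in the context, with the parameters $q,h,h^*,r,r_1,r_2,s,s^*,\theta_0,\theta_0^*$ (as applicable) named there. Then $\Phi'$ is a $\rho$-descendent of $\Phi$ precisely when the parameter array $p(\Phi')$ takes the following form (for some values of those among the primed scalars $h',h^{*\prime},r',s',s^{*\prime},\theta_0',\theta_0^{*\prime}$ that occur in it): Case I: $p(\Phi')=p(\mathrm{I};q,h',h^{*\prime},r_1q^{\rho},r_2q^{\rho},sq^{d-d'},s^*q^{2\rho},\theta_0',\theta_0^{*\prime},d')$. Case IA: $p(\Phi')=p(\mathrm{IA};q,h^{*\prime},r',s',\theta_0',\theta_0^{*\prime},d')$ where $s'/r'=q^{d-d'-\rho}s/r$. Case II: $p(\Phi')=p(\mathrm{II};h',h^{*\prime},r_1+\rho,r_2+\rho,s+d-d',s^*+2\rho,\theta_0',\theta_0^{*\prime},d')$. Case IIA: $p(\Phi')=p(\mathrm{IIA};h',r+\rho,s+d-d',s^{*\prime},\theta_0',\theta_0^{*\prime},d')$. Case IIB: $p(\Phi')=p(\mathrm{IIB};h^{*\prime},r+\rho,s',s^*+2\rho,\theta_0',\theta_0^{*\prime},d')$. Case IIC: $p(\Phi')=p(\mathrm{IIC};r',s',s^{*\prime},\theta_0',\theta_0^{*\prime},d')$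 where $s's^{*\prime}/r'=ss^*/r$. Case III, $d$ even, $d'$ even, $\rho$ even; or Case III, $d$ odd, $d'$ odd, $\rho$ even: $p(\Phi')=p(\mathrm{III};h',h^{*\prime},r_1+\rho,r_2+\rho,s-d+d',s^*-2\rho,\theta_0',\theta_0^{*\prime},d')$. Case III, $d$ even, $d'$ even, $\rho$ odd: $p(\Phi')=p(\mathrm{III};h',h^{*\prime},r_2+\rho,r_1+\rho,s-d+d',s^*-2\rho,\theta_0',\theta_0^{*\prime},d')$. Case III, $d$ even, $d'=1$; or Case IV, $(d',\rho)\in\{(1,0),(1,2)\}$: $p(\Phi')=p(\mathrm{IIC};r',s',s^{*\prime},\theta_0',\theta_0^{*\prime},1)$ where $s's^{*\prime}/r'=1-\phi_{\rho+1}/\varphi_{\rho+1}$. Case IV, $(d',\rho)=(3,0)$: $p(\Phi')=p(\mathrm{IV};h',h^{*\prime},r,s,s^*,\theta_0',\theta_0^{*\prime})$. Case III, $d$ even, $d'$ odd $\geqslant 3$; or Case III, $d$ odd, either $d'$ even or $\rho$ odd; or Case IV, $(d',\rho)\in\{(1,1),(2,0),(2,1)\}$: does not occur (i.e., $\Phi'$ is not a $\rho$-descendent of $\Phi$).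
   Context: Leonard systems. Let $\mathbb{K}$ be a field, $d$ a positive integer, $\mathcal{A}$ a $\mathbb{K}$-algebra isomorphic to $\mathrm{Mat}_{d+1}(\mathbb{K})$, and $V$ an irreducible left $\mathcal{A}$-module (so $\dim V=d+1$). An element of $\mathcal{A}$ is multiplicity-free if it has $d+1$ mutually distinct eigenvalues in $\mathbb{K}$; the primitive idempotent associated with an eigenvalue is the projection (element of $\mathcal{A}$) onto the corresponding eigenspace along the other eigenspaces. A Leonard system in $\mathcal{A}$ (over $\mathbb{K}$, of diameter $d$, with underlying vector space $V$) is a sequence $\Phi=(A;A^*;\{E_i\}_{i=0}^d;\{E_i^*\}_{i=0}^d)$ such that: $A,A^*\in\mathcal{A}$ are multiplicity-free; $\{E_i\}_{i=0}^d$ is an ordering of the primitive idempotents of $A$; $\{E_i^*\}_{i=0}^d$ is an ordering of the primitive idempotents of $A^*$; for $0\leqslant i,j\leqslant d$, $E_i^*AE_j^*=0$ if $|i-j|>1$ and $\ne 0$ if $|i-j|=1$; and $E_iA^*E_j=0$ if $|i-j|>1$ and $\ne0$ if $|i-j|=1$. Parameter array. Let $\theta_i$ (resp. $\theta_i^*$) be the eigenvalue of $A$ (resp. $A^*$) associated with $E_i$ (resp. $E_i^*$). It is known that there are scalars $\varphi_1,\dots,\varphi_d\in\mathbb{K}$ (uniquely determined by $\Phi$, and all nonzero) and a $\mathbb{K}$-algebra isomorphism $\mathcal{A}\to\mathrm{Mat}_{d+1}(\mathbb{K})$ sending $A$ to the lower bidiagonal matrix with diagonal $\theta_0,\theta_1,\dots,\theta_d$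 and all subdiagonal entries $1$, and $A^*$ to the upper bidiagonal matrix with diagonal $\theta_0^*,\theta_1^*,\dots,\theta_d^*$ and superdiagonal entries $\varphi_1,\dots,\varphi_d$. Let $\phi_1,\dots,\phi_d$ be the scalars obtained in the same way (in the role of the $\varphi_i$) from the Leonard system $\Phi^{\Downarrow}=(A;A^*;\{E_{d-i}\}_{i=0}^d;\{E_i^*\}_{i=0}^d)$; these are also all nonzero. The parameter array of $\Phi$ is $p(\Phi)=(\{\theta_i\}_{i=0}^d;\{\theta_i^*\}_{i=0}^d;\{\varphi_i\}_{i=1}^d;\{\phi_i\}_{i=1}^d)$. Objects associated with $\Phi'$ carry a prime. Balanced bilinear forms. A nonzero bilinear form $(\cdot|\cdot):V\times V'\to\mathbb{K}$ is balanced with respect to $\Phi,\Phi'$ if: (B1) there is an integer $\rho$ ($0\leqslant\rho\leqslant d-d'$) such that $(E_i^*V|E_j^{*\prime}V')=0$ whenever $i-\rho\ne j$ ($0\leqslant i\leqslant d$, $0\leqslant j\leqslant d'$); (B2) $(E_iV|E_j'V')=0$ whenever $i<j$ or $i>j+d-d'$ ($0\leqslant i\leqslant d$, $0\leqslant j\leqslant d'$). With this $\rho$ (the endpoint) the form is called $\rho$-balanced. $\Phi'$ is called a $\rho$-descendent of $\Phi$ if a $\rho$-balanced bilinear form with respect to $\Phi,\Phi'$ exists. List of parameter arrays. It is known that the parameter array of every Leonard system over $\mathbb{K}$ of diameter $d$ has at least one of the following forms, where $\theta_i,\theta_i^*,\varphi_i,\phi_i\in\mathbb{K}$ and the scalars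 $q,h,h^*,r,r_1,r_2,s,s^*$ lie in the algebraic closure of $\mathbb{K}$. The formulas for $\theta_i,\theta_i^*$ are for $0\leqslant i\leqslant d$ and those for $\varphi_i,\phi_i$ are for $1\leqslant i\leqslant d$. (I) $p(\mathrm{I};q,h,h^*,r_1,r_2,s,s^*,\theta_0,\theta_0^*,d)$, where $r_1r_2=ss^*q^{d+1}$: $\theta_i=\theta_0+h(1-q^i)(1-sq^{i+1})q^{-i}$, $\theta_i^*=\theta_0^*+h^*(1-q^i)(1-s^*q^{i+1})q^{-i}$, $\varphi_i=hh^*q^{1-2i}(1-q^i)(1-q^{i-d-1})(1-r_1q^i)(1-r_2q^i)$, $\phi_i=hh^*q^{1-2i}(1-q^i)(1-q^{i-d-1})(r_1-s^*q^i)(r_2-s^*q^i)/s^*$ if $s^*\ne0$, and $\phi_i=hh^*q^{d+2-2i}(1-q^i)(1-q^{i-d-1})(s-r_1q^{i-d-1}-r_2q^{i-d-1})$ if $s^*=0$. (IA) $p(\mathrm{IA};q,h^*,r,s,\theta_0,\theta_0^*,d)$: $\theta_i=\theta_0-sq(1-q^i)$, $\theta_i^*=\theta_0^*+h^*(1-q^i)q^{-i}$, $\varphi_i=-rh^*q^{1-i}(1-q^i)(1-q^{i-d-1})$, $\phi_i=h^*q^{d+2-2i}(1-q^i)(1-q^{i-d-1})(s-rq^{i-d-1})$. (II) $p(\mathrm{II};h,h^*,r_1,r_2,s,s^*,\theta_0,\theta_0^*,d)$, where $r_1+r_2=s+s^*+d+1$: $\theta_i=\theta_0+hi(i+1+s)$,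 $\theta_i^*=\theta_0^*+h^*i(i+1+s^* )$, $\varphi_i=hh^*i(i-d-1)(i+r_1)(i+r_2)$, $\phi_i=hh^*i(i-d-1)(i+s^*-r_1)(i+s^*-r_2)$. (IIA) $p(\mathrm{IIA};h,r,s,s^*,\theta_0,\theta_0^*,d)$: $\theta_i=\theta_0+hi(i+1+s)$, $\theta_i^*=\theta_0^*+s^*i$, $\varphi_i=hs^*i(i-d-1)(i+r)$, $\phi_i=hs^*i(i-d-1)(i+r-s-d-1)$. (IIB) $p(\mathrm{IIB};h^*,r,s,s^*,\theta_0,\theta_0^*,d)$: $\theta_i=\theta_0+si$, $\theta_i^*=\theta_0^*+h^*i(i+1+s^* )$, $\varphi_i=h^*si(i-d-1)(i+r)$, $\phi_i=-h^*si(i-d-1)(i+s^*-r)$. (IIC) $p(\mathrm{IIC};r,s,s^*,\theta_0,\theta_0^*,d)$: $\theta_i=\theta_0+si$, $\theta_i^*=\theta_0^*+s^*i$, $\varphi_i=ri(i-d-1)$, $\phi_i=(r-ss^* )i(i-d-1)$. (III) $p(\mathrm{III};h,h^*,r_1,r_2,s,s^*,\theta_0,\theta_0^*,d)$, where $r_1+r_2=-s-s^*+d+1$: $\theta_i=\theta_0+h(s-1+(1-s+2i)(-1)^i)$, $\theta_i^*=\theta_0^*+h^*(s^*-1+(1-s^*+2i)(-1)^i)$; for $d$ even: $\varphi_i=-4hh^*i(i+r_1)$ and $\phi_i=4hh^*i(i-s^*-r_1)$ if $i$ is even, $\varphi_i=-4hh^*(i-d-1)(i+r_2)$ and $\phi_i=4hh^*(i-d-1)(i-s^*-r_2)$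 if $i$ is odd; for $d$ odd: $\varphi_i=\phi_i=-4hh^*i(i-d-1)$ if $i$ is even, $\varphi_i=-4hh^*(i+r_1)(i+r_2)$ and $\phi_i=-4hh^*(i-s^*-r_1)(i-s^*-r_2)$ if $i$ is odd. (IV) $p(\mathrm{IV};h,h^*,r,s,s^*,\theta_0,\theta_0^* )$, where $\mathrm{char}(\mathbb{K})=2$, $d=3$: $\theta_1=\theta_0+h(s+1)$, $\theta_2=\theta_0+h$, $\theta_3=\theta_0+hs$; $\theta_1^*=\theta_0^*+h^*(s^*+1)$, $\theta_2^*=\theta_0^*+h^*$, $\theta_3^*=\theta_0^*+h^*s^*$; $\varphi_1=hh^*r$, $\varphi_2=hh^*$, $\varphi_3=hh^*(r+s+s^* )$; $\phi_1=hh^*(r+s(1+s^* ))$, $\phi_2=hh^*$, $\phi_3=hh^*(r+s^*(1+s))$. *)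

(* Defs.v *)
From HB Require Import structures.
From mathcomp Require Import all_boot all_order all_algebra.

Set Implicit Arguments.
Unset Strict Implicit.
Unset Printing Implicit Defensive.

Import GRing.Theory.
Local Open Scope ring_scope.

Section Leonard.

Variables (K : fieldType) (d : nat) (AA : algType K).

(* The modules V below are left AA-modules; the K-vector space structure of V
   is the one induced by K -> AA, so k in K acts on V as k%:A *: _. *)

Definition algebra_iso (f : {lrmorphism AA -> 'M[K]_d.+1}) : Prop :=
  bijective f.

Definition irreducible_module (V : lmodType AA) : Prop :=
  (exists v : V, v != 0) /\
  forall W : V -> Prop,
    W 0 -> (forall (a : AA) (u v : V), W u -> W v -> W (a *: u + v)) ->
    (forall v, W v -> v = 0) \/ (forall v, W v).

Definition is_eigenvalue (V : lmodType AA) (X : AA) (t : K) : Prop :=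
  exists2 v : V, v != 0 & X *: v = t%:A *: v.

Definition multiplicity_free (V : lmodType AA) (X : AA) : Prop :=
  exists2 t : 'I_d.+1 -> K, injective t & forall i, is_eigenvalue V X (t i).

(* E acts on V as the projection onto the t-eigenspace of X along the sum of
   the other eigenspaces. *)
Definition primitive_idempotent (V : lmodType AA) (X : AA) (t : K) (E : AA) :
    Prop :=
  [/\ is_eigenvalue V X t,
      forall v : V, X *: v = t%:A *: v -> E *: v = v &
      forall (u : K) (v : V), u != t -> X *: v = u%:A *: v -> E *: v = 0].

Definition idempotent_ordering (V : lmodType AA) (X : AA) (E : 'I_d.+1 -> AA) :
    Prop :=
  injective E /\
  forall F : AA, (exists t, primitive_idempotent V X t F) <-> exists i, F = E i.

(* The sequence (A; A^*; {E_i}; {E^*_i}) without its axioms. *)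
Record leonard_data := LeonardData {
  ls_A : AA;
  ls_As : AA;
  ls_E : 'I_d.+1 -> AA;
  ls_Es : 'I_d.+1 -> AA
}.

(* |i - j| *)
Definition gap (i j : 'I_d.+1) : nat := ((i - j) + (j - i))%N.

Definition leonard_system (V : lmodType AA) (Phi : leonard_data) : Prop :=
  let: LeonardData A As E Es := Phi in
  [/\ (0 < d)%N /\ (exists f : {lrmorphism AA -> 'M[K]_d.+1}, algebra_iso f),
      irreducible_module V,
      multiplicity_free V A /\ multiplicity_free V As,
      idempotent_ordering V A E /\ idempotent_ordering V As Es &
      forall i j : 'I_d.+1,
        [/\ (1 < gap i j)%N -> Es i * A * Es j = 0,
            gap i j = 1%N -> Es i * A * Es j <> 0,
            (1 < gap i j)%N -> E i * As * E j = 0 &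
            gap i j = 1%N -> E i * As * E j <> 0]].

(* Phi^Downarrow *)
Definition ls_down (Phi : leonard_data) : leonard_data :=
  LeonardData (ls_A Phi) (ls_As Phi) (fun i => ls_E Phi (rev_ord i))
              (ls_Es Phi).

End Leonard.

(* The scalars are indexed as on paper: only theta i, thetas i for 0 <= i <= d
   and vphi i, phi i for 1 <= i <= d are meaningful. *)
Record parray (K : Type) := PArray {
  theta : nat -> K;
  thetas : nat -> K;
  vphi : nat -> K;
  phi : nat -> K
}.

Section ParameterArray.

Variables (K : fieldType) (d : nat).

Definition lower_bidiag (th : nat -> K) : 'M[K]_d.+1 :=
  \matrix_(i, j) (if i == j then th i
                  else if i == j.+1 :> nat then 1 else 0).

Definition upper_bidiag (ths vph : nat -> K) : 'M[K]_d.+1 :=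
  \matrix_(i, j) (if i == j then ths i
                  else if j == i.+1 :> nat then vph j else 0).

Variables (AA : algType K) (V : lmodType AA).

Definition split_array (Phi : leonard_data d AA) (th ths vph : nat -> K) :
    Prop :=
  [/\ forall i : 'I_d.+1,
        primitive_idempotent V (ls_A Phi) (th i) (ls_E Phi i),
      forall i : 'I_d.+1,
        primitive_idempotent V (ls_As Phi) (ths i) (ls_Es Phi i) &
      exists f : {lrmorphism AA -> 'M[K]_d.+1},
        [/\ algebra_iso f, f (ls_A Phi) = lower_bidiag th &
            f (ls_As Phi) = upper_bidiag ths vph]].

(* p = p(Phi) *)
Definition parameter_array (Phi : leonard_data d AA) (p : parray K) : Prop :=
  split_array Phi (theta p) (thetas p) (vphi p) /\
  split_array (ls_down Phi) (fun i => theta p (d - i)%N) (thetas p) (phi p).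

End ParameterArray.

Section Balanced.

Variables (K : fieldType) (d d' : nat) (AA AA' : algType K).
Variables (V : lmodType AA) (V' : lmodType AA').

Definition bilinear_form (B : V -> V' -> K) : Prop :=
  (forall (k : K) u v w, B (k%:A *: u + v) w = k * B u w + B v w) /\
  (forall (k : K) u v w, B u (k%:A *: v + w) = k * B u v + B u w).

Definition rho_balanced (rho : nat) (Phi : leonard_data d AA)
    (Phi' : leonard_data d' AA') (B : V -> V' -> K) : Prop :=
  [/\ bilinear_form B,
      exists u v, B u v != 0,
      (rho + d' <= d)%N,
      forall (i : 'I_d.+1) (j : 'I_d'.+1), (i : nat) <> (j + rho)%N ->
        forall u v, B (ls_Es Phi i *: u) (ls_Es Phi' j *: v) = 0 &
      forall (i : 'I_d.+1) (j : 'I_d'.+1), (i < j)%N \/ (j + (d - d') < i)%N ->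
        forall u v, B (ls_E Phi i *: u) (ls_E Phi' j *: v) = 0].

Definition rho_descendent (rho : nat) (Phi : leonard_data d AA)
    (Phi' : leonard_data d' AA') : Prop :=
  exists B : V -> V' -> K, rho_balanced rho Phi Phi' B.

End Balanced.

(* The closed forms. L plays the role of the algebraic closure of K, with
   embedding iota; all scalars other than theta_0, theta^*_0 range over L.
   In the formulas the exponents of (_ ^ _) are integers. *)
Section Forms.

Variables (K : fieldType) (L : closedFieldType) (iota : {rmorphism K -> L}).

Definition algebraic_closure : Prop := forall x : L, algebraicOver iota x.

Definition has_scalars (d : nat) (p : parray K) (th ths vph ph : nat -> L) :
    Prop :=
  (forall i, (i <= d)%N -> iota (theta p i) = th i /\ iota (thetas p i) = ths i)
  /\ (forall i, (1 <= i <= d)%N ->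
        iota (vphi p i) = vph i /\ iota (phi p i) = ph i).

(* q = 0 would force theta_1 = theta_0 in cases I and IA, so q != 0 (needed for
   the negative powers to make sense) holds for every parameter array. *)
Definition form_I (q h hs r1 r2 s ss : L) (th0 ths0 : K) (d : nat)
    (p : parray K) : Prop :=
  r1 * r2 = s * ss * q ^+ d.+1 /\
  has_scalars d p
    (fun i => iota th0 + h * (1 - q ^+ i) * (1 - s * q ^+ i.+1) * q ^- i)
    (fun i => iota ths0 + hs * (1 - q ^+ i) * (1 - ss * q ^+ i.+1) * q ^- i)
    (fun i => h * hs * q ^ (1 - 2 * i%:Z) * (1 - q ^+ i)
              * (1 - q ^ (i%:Z - d%:Z - 1)) * (1 - r1 * q ^+ i)
              * (1 - r2 * q ^+ i))
    (fun i => if ss != 0 then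
                h * hs * q ^ (1 - 2 * i%:Z) * (1 - q ^+ i)
                * (1 - q ^ (i%:Z - d%:Z - 1)) * (r1 - ss * q ^+ i)
                * (r2 - ss * q ^+ i) / ss
              else
                h * hs * q ^ (d%:Z + 2 - 2 * i%:Z) * (1 - q ^+ i)
                * (1 - q ^ (i%:Z - d%:Z - 1))
                * (s - r1 * q ^ (i%:Z - d%:Z - 1)
                     - r2 * q ^ (i%:Z - d%:Z - 1))).

Definition form_IA (q hs r s : L) (th0 ths0 : K) (d : nat) (p : parray K) :
    Prop :=
  has_scalars d p
    (fun i => iota th0 - s * q * (1 - q ^+ i))
    (fun i => iota ths0 + hs * (1 - q ^+ i) * q ^- i)
    (fun i => - r * hs * q ^ (1 - i%:Z) * (1 - q ^+ i)
              * (1 - q ^ (i%:Z - d%:Z - 1)))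
    (fun i => hs * q ^ (d%:Z + 2 - 2 * i%:Z) * (1 - q ^+ i)
              * (1 - q ^ (i%:Z - d%:Z - 1))
              * (s - r * q ^ (i%:Z - d%:Z - 1))).

Definition form_II (h hs r1 r2 s ss : L) (th0 ths0 : K) (d : nat)
    (p : parray K) : Prop :=
  r1 + r2 = s + ss + d%:R + 1 /\
  has_scalars d p
    (fun i => iota th0 + h * i%:R * (i%:R + 1 + s))
    (fun i => iota ths0 + hs * i%:R * (i%:R + 1 + ss))
    (fun i => h * hs * i%:R * (i%:R - d%:R - 1) * (i%:R + r1) * (i%:R + r2))
    (fun i => h * hs * i%:R * (i%:R - d%:R - 1) * (i%:R + ss - r1)
              * (i%:R + ss - r2)).

Definition form_IIA (h r s ss : L) (th0 ths0 : K) (d : nat) (p : parray K) :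
    Prop :=
  has_scalars d p
    (fun i => iota th0 + h * i%:R * (i%:R + 1 + s))
    (fun i => iota ths0 + ss * i%:R)
    (fun i => h * ss * i%:R * (i%:R - d%:R - 1) * (i%:R + r))
    (fun i => h * ss * i%:R * (i%:R - d%:R - 1) * (i%:R + r - s - d%:R - 1)).

Definition form_IIB (hs r s ss : L) (th0 ths0 : K) (d : nat) (p : parray K) :
    Prop :=
  has_scalars d p
    (fun i => iota th0 + s * i%:R)
    (fun i => iota ths0 + hs * i%:R * (i%:R + 1 + ss))
    (fun i => hs * s * i%:R * (i%:R - d%:R - 1) * (i%:R + r))
    (fun i => - hs * s * i%:R * (i%:R - d%:R - 1) * (i%:R + ss - r)).

Definition form_IIC (r s ss : L) (th0 ths0 : K) (d : nat) (p : parray K) :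
    Prop :=
  has_scalars d p
    (fun i => iota th0 + s * i%:R)
    (fun i => iota ths0 + ss * i%:R)
    (fun i => r * i%:R * (i%:R - d%:R - 1))
    (fun i => (r - s * ss) * i%:R * (i%:R - d%:R - 1)).

Definition form_III (h hs r1 r2 s ss : L) (th0 ths0 : K) (d : nat)
    (p : parray K) : Prop :=
  r1 + r2 = - s - ss + d%:R + 1 /\
  has_scalars d p
    (fun i => iota th0 + h * (s - 1 + (1 - s + 2 * i%:R) * (-1) ^+ i))
    (fun i => iota ths0 + hs * (ss - 1 + (1 - ss + 2 * i%:R) * (-1) ^+ i))
    (fun i => if ~~ odd d then
                if ~~ odd i then - 4 * h * hs * i%:R * (i%:R + r1)
                else - 4 * h * hs * (i%:R - d%:R - 1) * (i%:R + r2)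
              else
                if ~~ odd i then - 4 * h * hs * i%:R * (i%:R - d%:R - 1)
                else - 4 * h * hs * (i%:R + r1) * (i%:R + r2))
    (fun i => if ~~ odd d then
                if ~~ odd i then 4 * h * hs * i%:R * (i%:R - ss - r1)
                else 4 * h * hs * (i%:R - d%:R - 1) * (i%:R - ss - r2)
              else
                if ~~ odd i then - 4 * h * hs * i%:R * (i%:R - d%:R - 1)
                else - 4 * h * hs * (i%:R - ss - r1) * (i%:R - ss - r2)).

(* The scalars are listed from index 0; the leading 0 in the last two lists is
   a placeholder for the unused index 0. *)
Definition form_IV (h hs r s ss : L) (th0 ths0 : K) (d : nat) (p : parray K) :
    Prop :=
  [/\ 2%N \in [pchar K], d = 3%N &
  has_scalars d p
    (nth 0 [:: iota th0; iota th0 + h * (s + 1); iota th0 + h;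
               iota th0 + h * s])
    (nth 0 [:: iota ths0; iota ths0 + hs * (ss + 1); iota ths0 + hs;
               iota ths0 + hs * ss])
    (nth 0 [:: 0; h * hs * r; h * hs; h * hs * (r + s + ss)])
    (nth 0 [:: 0; h * hs * (r + s * (1 + ss)); h * hs;
               h * hs * (r + ss * (1 + s))])].

End Forms.

(* Main.v *)
Require Import Defs.
From HB Require Import structures.
From mathcomp Require Import all_boot all_order all_algebra.
From mathcomp Require Import ring zify.

Set Implicit Arguments.
Unset Strict Implicit.
Unset Printing Implicit Defensive.

Import GRing.Theory.
Local Open Scope ring_scope.

(** Descendents are first characterised by the parameter arrays alone
    ([descendentP]): Phi' is a rho-descendent of Phi if and only if
    theta^{*'}_k is an affine function of theta^*_{k+rho} for 0 <= k <= d', and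
    phi'_k / vphi'_k = phi_{k+rho} / vphi_{k+rho} for 1 <= k <= d'.

    The reason is the following. Let e_i and e2_i be the split bases of Phi and
    of its second inversion, and write primes for Phi'. Condition (B2) says
    that e_i is orthogonal to e2'_j, and e2_i to e'_j, whenever i + j > d. In
    particular B(e_d, _) is a multiple of the coordinate functional at e2'_0,
    and by (B1) the form B is determined by its d' + 1 values at pairs of dual
    eigenvectors. These values can be computed from (e, e2') and from (e2, e');
    equality of the results is the condition on the quotients. The functional
    B(e_{d-1}, _) lies in the span of the coordinate functionals at e2'_0 and
    e2'_1, which gives the affine relation ([balanced_necessary]). Conversely
    these two conditions let one define B by its values at the dual
    eigenvectors and propagate the orthogonality of e_d to the other e_i
    ([balanced_sufficient]).

    It remains to determine, for each family, the parameter arrays of Phi'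
    that satisfy the two conditions. That the listed arrays satisfy them is a
    computation. For the converse, a candidate array of the listed form with
    the correct dual eigenvalues, the correct quotients and the correct
    difference theta'_0 - theta'_{d'} is written down, and it is shown to be
    the only possibility ([regular_uniqueness], [irregular_uniqueness]). This
    uses three consequences of the existence of a Leonard system
    ([leonard_relations]): two formulas obtained by comparing A^* in the two
    split bases, and the three-term relation satisfied by theta' with the same
    constant as by theta^{*'}, which confines theta' to a three-parameter
    family ([family_of_relations]). The cases that do not occur are those in
    which vphi_i = phi_i holds at an index where it is impossible for Phi'. *)

(** * Split bases *)

Definition inj_upto (T : Type) (d : nat) (f : nat -> T) : Prop :=
  forall i j, (i <= d)%N -> (j <= d)%N -> f i = f j -> i = j.

Section SplitBasis.

Variables (K : fieldType) (V : lmodType K).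
Implicit Types (a star : {linear V -> V}) (th ths vph : nat -> K).

(** Statements about spans are proved as closure statements: a predicate closed
    under linear combinations that holds on a spanning family holds everywhere. *)
Definition subspace (Q : V -> Prop) : Prop :=
  Q 0 /\ forall (c : K) (u v : V), Q u -> Q v -> Q (c *: u + v).

(** A basis e_0, .., e_d in which a is lower bidiagonal with subdiagonal 1 and
    star is upper bidiagonal, with the coordinate functionals eps_k. Indices are
    natural numbers and e_i = 0 for i > d, so that the shift relations need no
    boundary case at i = d. *)
Record split_basis (d : nat) a star th ths vph (e : nat -> V)
    (eps : nat -> {scalar V}) : Prop := SplitBasis {
  sb_dual : forall i k, (i <= d)%N -> eps k (e i) = (k == i)%:R;
  sb_over : forall i, (d < i)%N -> e i = 0;
  sb_exp : forall v, v = \sum_(i < d.+1) eps i v *: e i;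
  sb_a : forall i, (i <= d)%N -> a (e i) = th i *: e i + e i.+1;
  sb_as0 : star (e 0%N) = ths 0%N *: e 0%N;
  sb_asS : forall i, (i < d)%N ->
    star (e i.+1) = ths i.+1 *: e i.+1 + vph i.+1 *: e i
}.

Lemma subspace_sum (Q : V -> Prop) (I : finType) (P : pred I) (c : I -> K) (w : I -> V) :
  subspace Q -> (forall i, P i -> c i != 0 -> Q (w i)) ->
  Q (\sum_(i | P i) c i *: w i).
Proof.
case=> Q0 QD Qw; elim/big_rec: _ => // i x Pi Qx.
by have [->|c0] := eqVneq (c i) 0; [rewrite scale0r add0r | apply: QD => //; apply: Qw].
Qed.

Let linZ := (scalarZ, linearZ_LR).

Section Theory.
Variables (d : nat) (a star : {linear V -> V}) (th ths vph : nat -> K).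
Variables (e : nat -> V) (eps : nat -> {scalar V}).
Hypothesis sb : split_basis d a star th ths vph e eps.

Lemma eps_over k v : (d < k)%N -> eps k v = 0.
Proof.
move=> dk; rewrite (sb_exp sb v) linear_sum big1 // => i _.
rewrite linZ /= (sb_dual sb) -1?ltnS //.
by case: eqP => [ki|]; rewrite ?mulr0 //; move: (ltn_ord i); lia.
Qed.

Lemma sum_nat_ord_delta (F : nat -> K) k :
  (forall i, (d < i)%N -> F i = 0) ->
  \sum_(i < d.+1) F i * (k == i :> nat)%:R = F k.
Proof.
move=> F0; case: (leqP k d) => kd; last first.
  rewrite F0 // big1 // => i _; case: eqP => [ki|]; rewrite ?mulr0 //.
  by move: (ltn_ord i); lia.
rewrite (bigD1 (inord k)) //= big1 ?addr0 => [|i nik].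
  by rewrite inordK ?ltnS // eqxx mulr1.
case: eqP => [ki|]; rewrite ?mulr0 //.
by case/eqP: nik; apply: val_inj; rewrite /= inordK.
Qed.

Lemma eps_a0 v : eps 0 (a v) = th 0%N * eps 0 v.
Proof.
rewrite {1}(sb_exp sb v) !linear_sum /=.
transitivity (\sum_(i < d.+1) (fun i => th i * eps i v) i * (0%N == i)%:R).
  apply: eq_bigr => i _; have id : (i <= d)%N by rewrite -ltnS.
  rewrite !linZ /= (sb_a sb id) linearD linZ /= (sb_dual sb _ id).
  have -> : eps 0 (e i.+1) = 0.
    case: (leqP i.+1 d) => h; first by rewrite (sb_dual sb _ h).
    by rewrite (sb_over sb h) linear0.
  by ring.
by rewrite (sum_nat_ord_delta (F := fun i => th i * eps i v)) // => i di; rewrite eps_over ?mulr0.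
Qed.

Lemma eps_aS k v : (k < d)%N -> eps k.+1 (a v) = th k.+1 * eps k.+1 v + eps k v.
Proof.
move=> kd; rewrite {1}(sb_exp sb v) !linear_sum /=.
transitivity (\sum_(i < d.+1) ((fun i => th i * eps i v) i * (k.+1 == i)%:R +
   (fun i => eps i v) i * (k == i)%:R)).
  apply: eq_bigr => i _; have id : (i <= d)%N by rewrite -ltnS.
  rewrite !linZ /= (sb_a sb id) linearD linZ /= (sb_dual sb _ id).
  have -> : eps k.+1 (e i.+1) = (k == i)%:R.
    case: (leqP i.+1 d) => h; first by rewrite (sb_dual sb _ h).
    by rewrite (sb_over sb h) linear0; case: eqP => [ki|//]; move: h kd; lia.
  by ring.
rewrite big_split /= (sum_nat_ord_delta (F := fun i => th i * eps i v)).
  by rewrite (sum_nat_ord_delta (F := fun i => eps i v)) // => i /eps_over ->.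
by move=> i di; rewrite eps_over ?mulr0.
Qed.

Lemma eps_as k v : (k <= d)%N ->
  eps k (star v) = ths k * eps k v + vph k.+1 * eps k.+1 v.
Proof.
move=> kd; rewrite {1}(sb_exp sb v) !linear_sum /=.
transitivity (\sum_(i < d.+1) ((fun i => ths i * eps i v) i * (k == i)%:R +
   (fun i => vph i * eps i v) i * (k.+1 == i)%:R)).
  apply: eq_bigr => -[[|i] /= id] _; rewrite ltnS in id.
    by rewrite !linZ /= (sb_as0 sb) linZ /= (sb_dual sb _ id); ring.
  rewrite !linZ /= (sb_asS sb id) linearD !linZ /= (sb_dual sb _ id).
  by rewrite (sb_dual sb _ (ltnW id)) eqSS; ring.
rewrite big_split /= (sum_nat_ord_delta (F := fun i => ths i * eps i v)).
  rewrite (sum_nat_ord_delta (F := fun i => vph i * eps i v)) // => i di.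
  by rewrite eps_over ?mulr0.
by move=> i di; rewrite eps_over ?mulr0.
Qed.

Lemma split_eq0 v : (forall k, (k <= d)%N -> eps k v = 0) -> v = 0.
Proof.
move=> v0; rewrite (sb_exp sb v) big1 // => i _.
by rewrite v0 ?scale0r // -ltnS.
Qed.

Lemma split_span (Q : V -> Prop) : subspace Q ->
  (forall i, (i <= d)%N -> Q (e i)) -> forall v, Q v.
Proof.
move=> sQ Qe v; rewrite (sb_exp sb v); apply: subspace_sum => // i _ _.
by apply: Qe; rewrite -ltnS.
Qed.

Lemma a_e i : (i <= d)%N -> e i.+1 = a (e i) - th i *: e i.
Proof. by move=> id; rewrite (sb_a sb id) addrAC subrr add0r. Qed.

(** The first nonzero coordinate of an eigenvector exhibits its eigenvalue on
    the diagonal. *)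
Lemma eigen_a_val v t : v != 0 -> a v = t *: v -> exists2 k, (k <= d)%N & t = th k.
Proof.
move=> v0 av.
have exk : exists k, eps k v != 0.
  have [/existsP[k]|/existsPn H] := boolP [exists k : 'I_d.+1, eps k v != 0].
    by exists k.
  case/eqP: v0; apply: split_eq0 => k kd.
  by have := H (Ordinal (kd : (k < d.+1)%N)); rewrite negbK => /eqP.
case: (ex_minnP exk) => k ek min.
have kd : (k <= d)%N by rewrite leqNgt; apply: contra ek => /eps_over ->.
exists k => //; apply: (mulIf ek).
transitivity (eps k (a v)); first by rewrite av linZ.
case: k ek min kd => [|k] ek min kd; first by rewrite eps_a0.
rewrite eps_aS //.
have -> : eps k v = 0.
  by apply/eqP; apply: contraTT (ltnSn k) => /min; rewrite -leqNgt.
by rewrite addr0.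
Qed.

Lemma eigen_as_val v t : v != 0 -> star v = t *: v -> exists2 k, (k <= d)%N & t = ths k.
Proof.
move=> v0 av.
have exk : exists k, eps k v != 0.
  have [/existsP[k]|/existsPn H] := boolP [exists k : 'I_d.+1, eps k v != 0].
    by exists k.
  case/eqP: v0; apply: split_eq0 => k kd.
  by have := H (Ordinal (kd : (k < d.+1)%N)); rewrite negbK => /eqP.
have bd k : eps k v != 0 -> (k <= d)%N.
  by move=> ek; rewrite leqNgt; apply: contra ek => /eps_over ->.
case: (ex_maxnP exk bd) => k ek max.
exists k; first exact: bd.
apply: (mulIf ek).
transitivity (eps k (star v)); first by rewrite av linZ.
rewrite eps_as ?bd //.
have -> : eps k.+1 v = 0.
  by apply/eqP; apply: contraTT (ltnSn k) => /max; rewrite -leqNgt.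
by rewrite mulr0 addr0.
Qed.


(** The span of e_0, .., e_n, described by the coordinates that vanish on it. *)
Definition low n v := forall m, (n < m)%N -> eps m v = 0.

Lemma low_mono n m v : (n <= m)%N -> low n v -> low m v.
Proof. by move=> nm lv k mk; apply: lv; apply: leq_ltn_trans mk. Qed.

Lemma low_e i : low i (e i).
Proof.
move=> m im; case: (leqP i d) => id; last by rewrite (sb_over sb id) linear0.
by rewrite (sb_dual sb _ id); case: eqP im => // ->; rewrite ltnn.
Qed.

Lemma low_a n v : low n v -> low n.+1 (a v).
Proof.
move=> lv [//|m]; rewrite ltnS => nm; case: (ltnP m d) => md.
  by rewrite eps_aS // !lv ?mulr0 ?addr0 // ltnW.
by rewrite eps_over.
Qed.

Lemma low_star n v : low n v -> low n (star v).
Proof.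
move=> lv m nm; case: (leqP m d) => md; last by rewrite eps_over.
by rewrite eps_as // !lv ?mulr0 ?addr0 // ltnW.
Qed.

Lemma lead_a n v : low n v -> (n < d)%N -> eps n.+1 (a v) = eps n v.
Proof. by move=> lv nd; rewrite eps_aS // (lv n.+1) // mulr0 add0r. Qed.

Lemma lead_star n v : low n v -> (n <= d)%N -> eps n (star v) = ths n * eps n v.
Proof. by move=> lv nd; rewrite eps_as // (lv n.+1) // mulr0 addr0. Qed.

Lemma lowB n u v : low n u -> low n v -> low n (u - v).
Proof. by move=> lu lv m nm; rewrite linearB /= lu // lv // subrr. Qed.

Lemma lowZ n c v : low n v -> low n (c *: v).
Proof. by move=> lv m nm; rewrite linZ /= lv // mulr0. Qed.

Section Eigen.
Hypothesis th_inj : inj_upto d th.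

Lemma eigen_a_low v k i : (k <= d)%N -> a v = th k *: v -> (i < k)%N -> eps i v = 0.
Proof.
move=> kd av; elim: i => [|i IH] ik.
  have := eps_a0 v; rewrite av linZ /= => /eqP.
  rewrite -subr_eq0 -mulrBl mulf_eq0 subr_eq0 => /orP[/eqP h|/eqP //].
  by move: ik; rewrite (th_inj kd _ h).
have id : (i < d)%N by lia.
have := eps_aS v id; rewrite av linZ /= IH 1?ltnW // addr0 => /eqP.
rewrite -subr_eq0 -mulrBl mulf_eq0 subr_eq0 => /orP[/eqP h|/eqP //].
by move: ik; rewrite (th_inj kd _ h) ?ltnn.
Qed.

Lemma eigen_a_lead v k : (k <= d)%N -> a v = th k *: v -> v != 0 -> eps k v != 0.
Proof.
move=> kd av; apply: contra => /eqP ek; apply/eqP/split_eq0 => i id.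
case: (ltnP i k) => [|ki]; first exact: eigen_a_low.
rewrite -(subnKC ki); have: (k + (i - k) <= d)%N by lia.
elim: (i - k)%N => [|n IH]; first by rewrite addn0.
rewrite addnS => nd; have := eps_aS v nd.
rewrite av linZ /= IH 1?ltnW // addr0 => /eqP.
rewrite -subr_eq0 -mulrBl mulf_eq0 subr_eq0 => /orP[/eqP h|/eqP //].
by have := th_inj kd nd h; lia.
Qed.

Variable u : nat -> V.
Hypothesis ua : forall k, (k <= d)%N -> a (u k) = th k *: u k.
Hypothesis u0 : forall k, (k <= d)%N -> u k != 0.

(** Together with the converse [flag_e]: the spans of u_i, .., u_d and of
    e_i, .., e_d coincide, because a is triangular on the latter. This is how
    conditions on eigenspaces are turned into conditions on a split basis. *)
Lemma flag_u (Q : V -> Prop) i : subspace Q -> (i <= d)%N ->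
  (forall k, (i <= k <= d)%N -> Q (e k)) -> Q (u i).
Proof.
move=> sQ id Qe; rewrite (sb_exp sb (u i)).
apply: subspace_sum => // k _ ek; apply: Qe.
rewrite (ltn_ord k : (k <= d)%N) andbT leqNgt; apply: contra ek => ki.
by rewrite (eigen_a_low id (ua id) ki).
Qed.

Lemma flag_e (Q : V -> Prop) i : subspace Q -> (i <= d)%N ->
  (forall k, (i <= k <= d)%N -> Q (u k)) -> Q (e i).
Proof.
move=> sQ; move en : (d - i)%N => n; elim/ltn_ind: n i en => n IH i en id Qu.
have Qe k : (i < k <= d)%N -> Q (e k).
  move=> /andP[ik kd]; apply: (IH (d - k)%N) => //; first lia.
  by move=> l /andP[kl ld]; apply: Qu; lia.
have eN0 : eps i (u i) != 0 by apply: eigen_a_lead (u0 id); last exact: ua.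
have iS : (i < d.+1)%N by [].
have := sb_exp sb (u i); rewrite (bigD1 (Ordinal iS)) //= => ui.
have -> : e i = (eps i (u i))^-1 *: (u i - \sum_(k < d.+1 | k != Ordinal iS)
    eps k (u i) *: e k).
  by rewrite {2}ui addrK scalerA mulVf // scale1r.
have [Q0 QD] := sQ; rewrite -[_ *: _]addr0; apply: (QD) => //.
rewrite addrC -scaleN1r; apply: QD; last by apply: Qu; rewrite leqnn.
apply: subspace_sum => // k ki ek; apply: Qe.
rewrite (ltn_ord k : (k <= d)%N) andbT.
rewrite ltn_neqAle; apply/andP; split.
  by apply: contra ki => /eqP ik; apply/eqP/val_inj.
rewrite leqNgt; apply: contra ek => kli.
by rewrite (eigen_a_low id (ua id) kli).
Qed.

Lemma span_u (Q : V -> Prop) : subspace Q ->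
  (forall k, (k <= d)%N -> Q (u k)) -> forall v, Q v.
Proof.
move=> sQ Qu; apply: split_span => // i id; apply: flag_e => // k /andP[_ kd].
exact: Qu.
Qed.

End Eigen.

Section EigenStar.
Hypothesis ths_inj : inj_upto d ths.

Lemma eigen_star_low v k : (k <= d)%N -> star v = ths k *: v -> low k v.
Proof.
move=> kd sv i ki; case: (leqP i d) => id; last by rewrite eps_over.
move en : (d - i)%N => n; elim: n i en ki id => [|n IH] i en ki id.
  have := eps_as v id; rewrite sv linZ /= (@eps_over i.+1) ?mulr0 ?addr0; last lia.
  move/eqP; rewrite -subr_eq0 -mulrBl mulf_eq0 subr_eq0 => /orP[/eqP h|/eqP //].
  by have := ths_inj kd id h; lia.
have := eps_as v id; rewrite sv linZ /= (IH i.+1) ?mulr0 ?addr0; try lia.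
move/eqP; rewrite -subr_eq0 -mulrBl mulf_eq0 subr_eq0 => /orP[/eqP h|/eqP //].
by have := ths_inj kd id h; lia.
Qed.

Lemma eigen_star_lead v k : (k <= d)%N -> star v = ths k *: v -> v != 0 ->
  eps k v != 0.
Proof.
move=> kd sv; apply: contra => /eqP ek; apply/eqP/split_eq0 => i id.
case: (ltnP k i) => [|ik]; first exact: eigen_star_low.
move en : (k - i)%N => n; elim: n i en ik id => [|n IH] i en ik id.
  by have -> : i = k by lia.
have := eps_as v id; rewrite sv linZ /= (IH i.+1) ?mulr0 ?addr0; try lia.
move/eqP; rewrite -subr_eq0 -mulrBl mulf_eq0 subr_eq0 => /orP[/eqP h|/eqP //].
by have := ths_inj kd id h; lia.
Qed.

Variable b : nat -> V.
Hypothesis bs : forall k, (k <= d)%N -> star (b k) = ths k *: b k.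
Hypothesis b1 : forall k, (k <= d)%N -> eps k (b k) = 1.

Lemma span_b (Q : V -> Prop) : subspace Q ->
  (forall k, (k <= d)%N -> Q (b k)) -> forall v, Q v.
Proof.
move=> sQ Qb; apply: split_span => // i; elim/ltn_ind: i => i IH id.
have iS : (i < d.+1)%N by [].
have := sb_exp sb (b i); rewrite (bigD1 (Ordinal iS)) //= b1 // scale1r => bi.
have -> : e i = (b i - \sum_(k < d.+1 | k != Ordinal iS) eps k (b i) *: e k).
  by rewrite {1}bi addrK.
have [Q0 QD] := sQ; rewrite addrC -scaleN1r; apply: QD; last exact: Qb.
apply: subspace_sum => // k ki ek; apply: IH; last by rewrite -ltnS.
rewrite ltn_neqAle; apply/andP; split.
  by apply: contra ki => /eqP ik; apply/eqP/val_inj.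
rewrite leqNgt; apply: contra ek => kli.
by rewrite (eigen_star_low id (bs id) kli).
Qed.

(** The eigenvalue equation of b_k for star is a first-order recurrence for its
    coordinates, here solved from eps_k = 1 down to eps_0 and cleared of
    denominators. *)
Lemma eps0_b k : (k <= d)%N ->
  eps 0 (b k) * \prod_(l < k) (ths k - ths l) = \prod_(l < k) vph l.+1.
Proof.
move=> kd.
suff H n : (n <= k)%N -> eps 0 (b k) * \prod_(l < n) (ths k - ths l) =
    eps n (b k) * \prod_(l < n) vph l.+1 by rewrite H // b1 // mul1r.
elim: n => [|n IH] nk; first by rewrite !big_ord0.
rewrite !big_ord_recr /= mulrA IH; last lia.
have nd : (n <= d)%N by lia.
have := eps_as (b k) nd; rewrite (bs kd) linZ /= => E.
have -> : eps n (b k) * \prod_(l < n) vph l.+1 * (ths k - ths n) =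
  (ths k * eps n (b k) - ths n * eps n (b k)) * \prod_(l < n) vph l.+1 by ring.
by rewrite E; ring.
Qed.

Lemma eps1_b k : (k <= d)%N ->
  vph 1%N * eps 1 (b k) = (ths k - ths 0%N) * eps 0 (b k).
Proof. by move=> kd; have := @eps_as 0 (b k) isT; rewrite (bs kd) linZ /= => E; rewrite mulrBl E; ring. Qed.

Section Functional.
Variables (X : {scalar V}) (k : nat).
Hypothesis kd : (k <= d)%N.
Hypothesis Xs : forall v, X (star v) = ths k * X v.

(** A functional X with X (star v) = theta^*_k X v obeys a first-order
    recurrence along the split basis: it vanishes on e_0, .., e_{k-1}, and its
    values at e_k and e_d determine each other. *)
Lemma functional_rec i : (i < d)%N ->
  (ths k - ths i.+1) * X (e i.+1) = vph i.+1 * X (e i).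
Proof.
move=> id; rewrite mulrBl -Xs (sb_asS sb id) linearD !linZ /=.
by rewrite addrAC subrr add0r.
Qed.

Lemma functional_low i : (i < k)%N -> X (e i) = 0.
Proof.
elim: i => [|i IH] ik.
  have := Xs (e 0%N); rewrite (sb_as0 sb) linZ /= => /eqP.
  rewrite -subr_eq0 -mulrBl mulf_eq0 subr_eq0 => /orP[/eqP h|/eqP //].
  by have := ths_inj (leq0n d) kd h; lia.
have id' : (i.+1 <= d)%N by lia.
have /eqP := functional_rec id'.
rewrite IH 1?ltnW // mulr0 mulf_eq0 subr_eq0 => /orP[/eqP h|/eqP //].
by have := ths_inj kd id' h; lia.
Qed.

Lemma functional_top :
  X (e d) * \prod_(k.+1 <= l < d.+1) (ths k - ths l) =
  X (e k) * \prod_(k.+1 <= l < d.+1) vph l.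
Proof.
suff H n : (k <= n <= d)%N ->
   X (e n) * \prod_(k.+1 <= l < n.+1) (ths k - ths l) =
   X (e k) * \prod_(k.+1 <= l < n.+1) vph l by apply: H; rewrite kd leqnn.
elim: n => [|n IH] /andP[kn nd].
  by rewrite (_ : k = 0%N) ?big_geq //; lia.
case: (leqP k n) => kn'; last by rewrite (_ : k = n.+1) ?big_geq //; lia.
rewrite !(big_nat_recr n.+1) //=.
have E := functional_rec nd.
have /IH {}IH : (k <= n <= d)%N by lia.
set P := \prod_(_ <= _ < _) _ in IH *; set Q := \prod_(_ <= _ < _) _ in IH *.
transitivity ((ths k - ths n.+1) * X (e n.+1) * P); first by ring.
rewrite E; transitivity (vph n.+1 * (X (e n) * P)); first by ring.
by rewrite IH; ring.
Qed.

Lemma functional_on_low v : low k v -> (forall i, (i < k)%N -> X (e i) = 0) -> X v = eps k v * X (e k).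
Proof.
move=> lv X0; rewrite {1}(sb_exp sb v) linear_sum /=.
have kS : (k < d.+1)%N by [].
rewrite (bigD1 (Ordinal kS)) //= linZ /= big1 ?addr0 // => i ik.
rewrite linZ /=; case: (ltngtP i k) => h.
- by rewrite X0 ?mulr0.
- by rewrite lv ?mul0r.
- by case/eqP: ik; apply: val_inj.
Qed.

End Functional.
End EigenStar.
End Theory.
End SplitBasis.

(** * The two split bases of a Leonard system *)

(** Necessary conditions on a parameter array. [lr_sum] and [lr_S] compare the
    matrices of the dual operator in the two split bases; [lr_S] is the formula
    for phi_i in which S_i, defined by a recurrence in the eigenvalues only, is
    left unevaluated, since each family of arrays evaluates it separately.
    [lr_tri] says that both eigenvalue sequences satisfy the same three-term
    relation; its constant is the inverse of beta + 1. *)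
Record leonard_relations (F : fieldType) (d : nat) (th ths vph ph : nat -> F) :
    Prop := LeonardRelations {
  lr_th : inj_upto d th;
  lr_ths : inj_upto d ths;
  lr_vph : forall i, (0 < i <= d)%N -> vph i != 0;
  lr_ph : forall i, (0 < i <= d)%N -> ph i != 0;
  lr_sum : forall i, (i < d)%N -> vph i.+1 - ph i.+1 =
    (ths i.+1 - ths i) * \sum_(h < i.+1) (th h - th (d - h)%N);
  lr_S : exists2 S : nat -> F,
    S 1%N = 1 /\ forall i, (0 < i < d)%N ->
      S i.+1 * (th 0%N - th (d - i).+1) =
        (th 1%N - th (d - i)%N) * S i + (th 0%N - th (d - i).+1)
    & forall i, (i < d)%N ->
      ph i.+1 = vph 1%N * S i.+1 + (ths i.+1 - ths 0%N) * (th (d - i)%N - th 0%N);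
  lr_tri : exists c, forall j, (j.+3 <= d)%N ->
    ths j.+1 - ths j.+2 = c * (ths j - ths j.+3) /\
    th j.+1 - th j.+2 = c * (th j - th j.+3)
}.

Section TwoSplits.

Variables (K : fieldType) (V : lmodType K) (d : nat) (a star : {linear V -> V}).

(** Both e_i and e2_i are monic polynomials of degree i in a applied to the same
    vector, so e2_i equals e_i modulo e_0, .., e_{i-1}. *)
Lemma e2_low (th th2 ths vph ph : nat -> K) (e e2 : nat -> V) (eps eps2 : nat -> {scalar V}) i :
  split_basis d a star th ths vph e eps ->
  split_basis d a star th2 ths ph e2 eps2 ->
  e2 0%N = e 0%N -> (i <= d)%N -> low eps i (e2 i) /\ eps i (e2 i) = 1.
Proof.
move=> sb sb2 e20; elim: i => [|i IH] id.
  by rewrite e20 (sb_dual sb) //; split => //; apply: (low_e sb).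
have [l1 l2] := IH (ltnW id).
rewrite (a_e sb2 (ltnW id)); split.
  apply: lowB; first exact: (low_a sb).
  by apply: lowZ; apply: low_mono l1.
by rewrite linearB /= (lead_a sb l1) // l2 scalarZ l1 // mulr0 subr0.
Qed.

Variables (th th2 ths vph ph : nat -> K).
Variables (e e2 : nat -> V) (eps eps2 : nat -> {scalar V}).
Hypothesis sb : split_basis d a star th ths vph e eps.
Hypothesis sb2 : split_basis d a star th2 ths ph e2 eps2.
Hypothesis e20 : e2 0%N = e 0%N.

(** The two split bases define the same flag with the same leading
    coefficients. *)
Lemma lead_eps2 v k : (k <= d)%N -> low eps k v -> eps2 k v = eps k v.
Proof.
move=> kd lv; rewrite {1}(sb_exp sb v) linear_sum /=.
have kS : (k < d.+1)%N by [].
rewrite (bigD1 (Ordinal kS)) //= scalarZ.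
have [_ ->] := e2_low sb2 sb (esym e20) kd.
rewrite mulr1 big1 ?addr0 // => i ik; rewrite scalarZ.
case: (ltngtP i k) => h.
- have [l _] := e2_low sb2 sb (esym e20) (ltac:(lia) : (i <= d)%N).
  by rewrite l ?mulr0.
- by rewrite lv ?mul0r.
- by case/eqP: ik; apply: val_inj.
Qed.

(** Compare the coefficients of e_i in the two expressions of star e2_{i+1}.
    The coefficient of e_i in e2_{i+1} is the sum of the th_h - th2_h. *)
Lemma splits_sum i : (i < d)%N -> vph i.+1 - ph i.+1 =
  (ths i.+1 - ths i) * \sum_(h < i.+1) (th h - th2 h).
Proof.
move=> id.
have T n : (n < d)%N -> eps n (e2 n.+1) = \sum_(h < n.+1) (th h - th2 h).
  elim: n => [|n IH] nd.
    rewrite big_ord1 (a_e sb2) // linearB /= (eps_a0 sb) scalarZ e20.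
    by rewrite (sb_dual sb) // eqxx /=; ring.
  rewrite big_ord_recr /= -IH ?(ltnW nd) // (a_e sb2 (ltnW nd)) linearB /=.
  have [_ l2] := e2_low sb sb2 e20 (ltnW nd).
  by rewrite (eps_aS sb) ?(ltnW nd) // scalarZ l2; ring.
rewrite -T //.
have := congr1 (eps i) (sb_asS sb2 id).
have [l1 l2] := e2_low sb sb2 e20 id.
have [_ l4] := e2_low sb sb2 e20 (ltnW id).
rewrite (eps_as sb) ?(ltnW id) // linearD !scalarZ l2 l4 /= => E.
transitivity (ths i * eps i (e2 i.+1) + vph i.+1 * 1 - ph i.+1 * 1 -
  ths i * eps i (e2 i.+1)); first by ring.
by rewrite E; ring.
Qed.

(** Compare the coefficients of e_0 instead. The coefficients of e2_i at e_0 and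
    e_1 satisfy recurrences in the eigenvalues only; S_i is the coefficient of
    e2_i at e_1 divided by that of e2_{i-1} at e_0. *)
Lemma splits_S : (0 < d)%N -> (forall h, (h < d)%N -> th 0%N != th2 h) ->
  exists2 S : nat -> K,
    S 1%N = 1 /\ forall i, (0 < i < d)%N ->
      S i.+1 * (th 0%N - th2 i.-1) =
        (th 1%N - th2 i) * S i + (th 0%N - th2 i.-1)
    & forall i, (i < d)%N ->
      ph i.+1 = vph 1%N * S i.+1 + (ths i.+1 - ths 0%N) * (th2 i - th 0%N).
Proof.
move=> d0 thN.
pose eta i := eps 0 (e2 i); pose y i := eps 1 (e2 i).
have etaS i : (i < d)%N -> eta i.+1 = (th 0%N - th2 i) * eta i.
  move=> id; rewrite /eta (a_e sb2) ?(ltnW id) // linearB /= (eps_a0 sb) scalarZ.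
  by ring.
have yS i : (i < d)%N -> y i.+1 = (th 1%N - th2 i) * y i + eta i.
  move=> id; rewrite /y (a_e sb2) ?(ltnW id) // linearB /= (eps_aS sb) // scalarZ.
  by rewrite /eta; ring.
have eta_n0 i : (i <= d)%N -> eta i != 0.
  elim: i => [|i IH] id; first by rewrite /eta e20 (sb_dual sb) // oner_eq0.
  by rewrite etaS // mulf_neq0 ?IH ?(ltnW id) // subr_eq0 thN.
have y0 : y 0%N = 0 by rewrite /y e20 (sb_dual sb).
exists (fun i => y i / eta i.-1).
  split; first by rewrite yS // y0 mulr0 add0r /= divff ?eta_n0.
  move=> [//|i] /= id; have id' : (i < d)%N by lia.
  have := eta_n0 _ (ltnW id); rewrite etaS // yS // => ee.
  have := eta_n0 _ (ltnW id') => e0.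
  have t0 : th 0%N - th2 i != 0 by rewrite subr_eq0 thN.
  by rewrite etaS //; field; rewrite e0 t0.
move=> i id /=; have e0 := eta_n0 _ (ltnW id).
have := congr1 (eps 0) (sb_asS sb2 id).
rewrite (eps_as sb) // linearD !scalarZ /= -/(eta _) -/(eta _) -/(y _) etaS // => E.
apply: (mulIf e0).
transitivity (ths i.+1 * ((th 0%N - th2 i) * eta i) + ph i.+1 * eta i -
   ths i.+1 * ((th 0%N - th2 i) * eta i)); first by ring.
by rewrite -E; field.
Qed.

End TwoSplits.

(** * The three-term relation between eigenvalues *)

(** Terwilliger's argument for the three-term relation. The operator P is
    diagonal in the eigenbasis of a and satisfies
    [P, star] = a^2 star a - a star a^2. The right-hand side shifts the flag of the
    split basis by at most three, which forces P to be a cubic polynomial in a.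
    Its leading coefficient c appears in the relation for theta^* by comparing
    leading coefficients at e_j, and in the relation for theta because the
    eigenvalues of P are values of that cubic. *)
Section Commutator.

Variables (K : fieldType) (V : lmodType K) (d : nat) (a star : {linear V -> V}).
Variables (th ths vph : nat -> K) (e u : nat -> V) (eps : nat -> {scalar V}).
Hypothesis sb : split_basis d a star th ths vph e eps.
Hypothesis th_inj : inj_upto d th.
Hypothesis ths_inj : inj_upto d ths.
Hypothesis ua : forall k, (k <= d)%N -> a (u k) = th k *: u k.
Hypothesis u0 : forall k, (k <= d)%N -> u k != 0.
Variables (P : {linear V -> V}) (p : nat -> K).
Hypothesis Pu : forall k, (k <= d)%N -> P (u k) = p k *: u k.
Hypothesis p_step : forall k, (k < d)%N ->
  p k - p k.+1 = th k * th k.+1 * (th k - th k.+1).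
Hypothesis Pcomm : forall v,
  P (star v) - star (P v) = a (a (star (a v))) - a (star (a (a v))).

Lemma P_a v : P (a v) = a (P v).
Proof.
apply: (@span_u _ _ _ _ _ _ _ _ _ _ sb th_inj _ ua u0 (fun v => P (a v) = a (P v))).
  split=> [|c x y Hx Hy]; first by rewrite !linear0.
  by rewrite !linearP Hx Hy.
by move=> k kd /=; rewrite ua // !linearZ_LR /= Pu // [in RHS]linearZ_LR /= ua // !scalerA mulrC.
Qed.

Lemma low_W j : low eps j.+3
  (a (a (star (a (e j)))) - a (star (a (a (e j))))).
Proof.
apply: lowB; first by do 2!apply: (low_a sb); apply: (low_star sb);
  apply: (low_a sb); apply: (low_e sb).
by apply: (low_a sb); apply: (low_star sb); do 2!apply: (low_a sb); apply: (low_e sb).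
Qed.

Lemma lead_W j : (j.+3 <= d)%N -> eps j.+3
  (a (a (star (a (e j)))) - a (star (a (a (e j))))) = ths j.+1 - ths j.+2.
Proof.
move=> jd; have l0 : low eps j (e j) by apply: (low_e sb).
have l1 := low_a sb l0; have l2 := low_a sb l1.
have s1 := low_star sb l1; have s2 := low_star sb l2; have t1 := low_a sb s1.
have e1 : eps j (e j) = 1 by rewrite (sb_dual sb) ?eqxx //; lia.
rewrite linearB /= (lead_a sb t1) // (lead_a sb s1) 1?ltnW //.
rewrite (lead_a sb s2) // (lead_star sb l1); last lia.
rewrite (lead_star sb l2); last lia.
rewrite (lead_a sb l1) 1?ltnW // (lead_a sb l0) ?e1 ?mulr1 //; lia.
Qed.

(** The coordinates of P e_0 beyond the third vanish: by the commutator relation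
    at e_0, coordinate m is (theta^*_0 - theta^*_m)^{-1} times a multiple of
    coordinate m + 1. *)
Lemma low_P0 : low eps 3 (P (e 0%N)).
Proof.
move=> m m3; case: (leqP m d) => md; last by rewrite (eps_over sb).
move en : (d - m)%N => n; elim: n m en m3 md => [|n IH] m en m3 md;
  have := congr1 (eps m) (Pcomm (e 0%N)); rewrite (low_W m3) linearB /=;
  rewrite (sb_as0 sb) linearZ_LR /= scalarZ (eps_as sb) //.
- rewrite (@eps_over _ _ _ _ _ _ _ _ _ _ sb m.+1) ?mulr0 ?addr0; last lia.
  rewrite -mulrBl => /eqP; rewrite mulf_eq0 subr_eq0 => /orP[/eqP h|/eqP //].
  by have := ths_inj (leq0n d) md h; lia.
- rewrite (IH m.+1) ?mulr0 ?addr0; try lia.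
  rewrite -mulrBl => /eqP; rewrite mulf_eq0 subr_eq0 => /orP[/eqP h|/eqP //].
  by have := ths_inj (leq0n d) md h; lia.
Qed.

Lemma lead_P j : (j <= d)%N -> low eps j.+3 (P (e j)) /\
  ((j.+3 <= d)%N -> eps j.+3 (P (e j)) = eps 3 (P (e 0%N))).
Proof.
elim: j => [|j IH] jd; first by split=> //; apply: low_P0.
have [l1 l2] := IH (ltnW jd).
rewrite (a_e sb (ltnW jd)) linearB linearZ_LR /= P_a; split.
  by apply: lowB; [apply: (low_a sb) | apply: lowZ; apply: low_mono l1].
move=> j4; rewrite linearB /= scalarZ (lead_a sb l1) // l2 1?ltnW //.
by rewrite l1 // mulr0 subr0.
Qed.

Lemma tri_ths j : (j.+3 <= d)%N ->
  ths j.+1 - ths j.+2 = eps 3 (P (e 0%N)) * (ths j - ths j.+3).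
Proof.
move=> jd; rewrite -(lead_W jd) -Pcomm.
have [l1 l2] := lead_P (ltnW (ltnW (ltnW jd))).
rewrite linearB /= (lead_star sb l1) // l2 //.
suff -> : eps j.+3 (P (star (e j))) = ths j * eps 3 (P (e 0%N)) by ring.
case: j jd l1 l2 => [|j] jd l1 l2; first by rewrite (sb_as0 sb) linearZ_LR scalarZ.
rewrite (sb_asS sb); last lia.
rewrite linearD !linearZ_LR linearD !scalarZ l2 //=.
have [l3 _] := lead_P (ltac:(lia) : (j <= d)%N).
by rewrite l3 ?mulr0 ?addr0.
Qed.

(** P and the cubic polynomial in a that agrees with it at e_0 both commute with
    a, and e_0 generates the space under a; so they are equal. *)
Lemma P_cubic : (3 <= d)%N -> exists c0 c1 c2, forall k, (k <= d)%N ->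
  p k = c0 + c1 * th k + c2 * th k ^+ 2 + eps 3 (P (e 0%N)) * th k ^+ 3.
Proof.
move=> d3; set c3 := eps 3 _.
rewrite {}/c3.
have [A AE] : exists A : nat -> {linear V -> V},
    forall j v, A j v = a v - th j *: v.
  by exists (fun j => a \- (th j \*: idfun)).
have Aa j v : A j (a v) = a (A j v) by rewrite !AE linearB [in RHS]linearZ_LR.
have Ae j : (j <= d)%N -> A j (e j) = e j.+1 by move=> jd; rewrite AE -(a_e sb).
have Au j k : (k <= d)%N -> A j (u k) = (th k - th j) *: u k.
  by move=> kd; rewrite AE ua // scalerBl.
pose x i := eps i (P (e 0%N)); rewrite -/(x 3%N).
pose N : {linear V -> V} := P \- (x 0%N \*: idfun \+ (x 1%N \*: A 0%N \+
  (x 2%N \*: (A 1%N \o A 0%N) \+ x 3%N \*: (A 2%N \o (A 1%N \o A 0%N))))).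
have NE v : N v = P v - (x 0%N *: v + (x 1%N *: A 0%N v +
  (x 2%N *: A 1%N (A 0%N v) + x 3%N *: A 2%N (A 1%N (A 0%N v))))) by [].
have N_a v : N (a v) = a (N v).
  have aZ c w : a (c *: w) = c *: a w by exact: linearZ_LR.
  by rewrite !NE P_a !Aa (linearB a) !(linearD a) !aZ.
have Ne0 : N (e 0%N) = 0.
  rewrite NE !Ae //; try lia.
  rewrite {1}(sb_exp sb (P (e 0%N))).
  rewrite -(big_mkord xpredT (fun i => x i *: e i)).
  have H0 : \sum_(4 <= i < d.+1) x i *: e i = 0.
    rewrite big_nat_cond big1 // => i; rewrite andbT => /andP[i4 _].
    by rewrite /x low_P0 ?scale0r.
  rewrite (big_cat_nat (n := 4)) //= H0 addr0.
  by rewrite !big_nat_recr //= big_geq // add0r !addrA subrr.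
have Ne j : (j <= d)%N -> N (e j) = 0.
  elim: j => [//|j IH] jd; have /IH Nj := ltnW jd.
  by rewrite (a_e sb (ltnW jd)) (linearB N) N_a (linearZ_LR N) Nj linear0 scaler0 subrr.
have Nv v : N v = 0.
  apply: (split_span sb (Q := fun v => N v = 0)) => //; split; first exact: linear0.
  by move=> c y z Hy Hz; rewrite linearP Hy Hz scaler0 addr0.
exists (x 0%N - x 1%N * th 0%N + x 2%N * th 1%N * th 0%N - x 3%N * th 2%N * th 1%N * th 0%N).
exists (x 1%N - x 2%N * (th 0%N + th 1%N) +
    x 3%N * (th 0%N * th 1%N + th 0%N * th 2%N + th 1%N * th 2%N)).
exists (x 2%N - x 3%N * (th 0%N + th 1%N + th 2%N)) => k kd.
have AZ j c w : A j (c *: w) = c *: A j w by exact: linearZ_LR.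
have := Nv (u k); rewrite NE Pu // (Au 0%N k kd) !AZ (Au 1%N k kd) !AZ (Au 2%N k kd).
rewrite !scalerA -!scalerDl -scalerBl => /eqP; rewrite scaler_eq0 (negPf (u0 kd)) orbF.
by rewrite subr_eq0 => /eqP ->; ring.
Qed.

Lemma tri_relations : exists c, forall j, (j.+3 <= d)%N ->
  ths j.+1 - ths j.+2 = c * (ths j - ths j.+3) /\
  th j.+1 - th j.+2 = c * (th j - th j.+3).
Proof.
exists (eps 3 (P (e 0%N))) => j jd; split; first exact: tri_ths.
have [c0 [c1 [c2 H]]] := P_cubic (ltac:(lia) : (3 <= d)%N).
have [d0 [d1 [d2 d3]]] : (j <= d)%N /\ (j.+1 <= d)%N /\ (j.+2 <= d)%N /\ (j.+3 <= d)%N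
  by lia.
have := p_step d1; have := p_step d2; have := p_step d3.
rewrite !H //; set c := eps 3 _.
have neq x y : (x <= d)%N -> (y <= d)%N -> (x < y)%N -> th x - th y != 0.
  by move=> xd yd xy; rewrite subr_eq0; apply/eqP => /(th_inj xd yd); lia.
have n1 := neq _ _ d0 d1 (ltnSn _); have n2 := neq _ _ d1 d2 (ltnSn _).
have n3 := neq _ _ d2 d3 (ltnSn _).
have n4 := neq _ _ d0 d2 (ltac:(lia)); have n5 := neq _ _ d1 d3 (ltac:(lia)).
move: n1 n2 n3 n4 n5; move: (th j) (th j.+1) (th j.+2) (th j.+3) => x y z w n1 n2 n3 n4 n5 H3 H2 H1.
have G1 : x * y = c * (x ^+ 2 + x * y + y ^+ 2) + c2 * (x + y) + c1.
  by apply: (mulIf n1); rewrite -H1; ring.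
have G2 : y * z = c * (y ^+ 2 + y * z + z ^+ 2) + c2 * (y + z) + c1.
  by apply: (mulIf n2); rewrite -H2; ring.
have G3 : z * w = c * (z ^+ 2 + z * w + w ^+ 2) + c2 * (z + w) + c1.
  by apply: (mulIf n3); rewrite -H3; ring.
(* differences of consecutive equations, divided by x - z and y - w *)
have F1 : y = c * (x + y + z) + c2.
  by apply: (mulIf n4); rewrite mulrBr [y * x]mulrC G1 G2; ring.
have F2 : z = c * (y + z + w) + c2.
  by apply: (mulIf n5); rewrite mulrBr [z * y]mulrC G2 G3; ring.
transitivity (c * (x + y + z) + c2 - (c * (y + z + w) + c2)); last by ring.
by rewrite -F1 -F2.
Qed.

End Commutator.

(** * Bilinear forms and split bases *)

Definition scalar_of (K : fieldType) (V : lmodType K) (f : V -> K)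
  (fP : scalar f) : {scalar V} := HB.pack f (GRing.isLinear.Build K V K *%R f fP).

(** In the split basis the functional is given by the solution of the recurrence
    of [functional_rec] that starts with 0 below k and with 1 at k. *)
Lemma functional_exists (K : fieldType) (V : lmodType K) d (a star : {linear V -> V})
    th ths vph e eps k :
  split_basis d a star th ths vph e eps -> inj_upto d ths -> (k <= d)%N ->
  exists2 X : {scalar V}, (forall v, X (star v) = ths k * X v) & X (e k) = 1.
Proof.
move=> sb ths_inj kd.
pose g := fix g i := if (i < k)%N then 0 else if i == k then 1 else
  if i is j.+1 then vph i / (ths k - ths i) * g j else 0.
have g_low i : (i < k)%N -> g i = 0 by case: i => [|i] /= ik; rewrite ?ik.
have g_k : g k = 1 by rewrite /g; case: (k) => [|i] /=; rewrite ?ltnn ?eqxx.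
have gS i : (i < d)%N -> (ths k - ths i.+1) * g i.+1 = vph i.+1 * g i.
  move=> id; case: (ltngtP i.+1 k) => h.
  - by rewrite !g_low ?mulr0 // ltnW.
  - have -> : g i.+1 = vph i.+1 / (ths k - ths i.+1) * g i.
      by rewrite /= ltnNge (ltnW h) /= gtn_eqF.
    have n0 : ths k - ths i.+1 != 0.
      by rewrite subr_eq0; apply/eqP => /(ths_inj _ _ kd id); lia.
    by field.
  - by rewrite h subrr mul0r g_low ?mulr0 //; lia.
have XP : scalar (fun v => \sum_(i < d.+1) eps i v * g i).
  move=> c x y; rewrite mulr_sumr -big_split /=; apply: eq_bigr => i _.
  by rewrite scalarP mulrDl mulrA.
pose X := scalar_of XP.
have Xe i : (i <= d)%N -> X (e i) = g i.
  move=> id; have iS : (i < d.+1)%N by [].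
  rewrite /X /= (bigD1 (Ordinal iS)) //= (sb_dual sb) // eqxx mul1r big1 ?addr0 //.
  move=> l li; rewrite (sb_dual sb) //; case: eqP; rewrite ?mul0r // => E.
  by case/eqP: li; apply: val_inj.
exists X; last by rewrite Xe.
apply: (split_span sb (Q := fun v => X (star v) = ths k * X v)).
  split=> [|c x y Hx Hy]; first by rewrite !linear0 mulr0.
  by rewrite linearP !scalarP Hx Hy; ring.
move=> [|i] id.
  rewrite (sb_as0 sb) scalarZ Xe //.
  by case: (posnP k) => [->//|k0]; rewrite g_low // !mulr0.
rewrite (sb_asS sb) // linearD !scalarZ Xe // Xe 1?ltnW // -gS //; ring.
Qed.

Section Forms.

Variables (K : fieldType) (V V' : lmodType K).

Definition biform (B : V -> V' -> K) : Prop :=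
  (forall (k : K) u v w, B (k *: u + v) w = k * B u w + B v w) /\
  (forall (k : K) u v w, B u (k *: v + w) = k * B u v + B u w).

Section Half.

Variables (B : V -> V' -> K).
Hypothesis Bbi : biform B.

Let Bl y : scalar (B^~ y). Proof. by move=> c u v; rewrite (proj1 Bbi). Qed.
Let Br x : scalar (B x). Proof. by move=> c u v; rewrite (proj2 Bbi). Qed.

Lemma biform_l0 x : B 0 x = 0. Proof. exact: (linear0 (scalar_of (Bl x))). Qed.
Lemma biform_r0 x : B x 0 = 0. Proof. exact: (linear0 (scalar_of (Br x))). Qed.
Lemma biform_lZ c x y : B (c *: x) y = c * B x y.
Proof. exact: (scalarZ (scalar_of (Bl y))). Qed.
Lemma biform_rZ c x y : B x (c *: y) = c * B x y.
Proof. exact: (scalarZ (scalar_of (Br x))). Qed.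
Lemma biform_lD x z y : B (x + z) y = B x y + B z y.
Proof. exact: (linearD (scalar_of (Bl y))). Qed.
Lemma biform_rD x z y : B x (y + z) = B x y + B x z.
Proof. exact: (linearD (scalar_of (Br x))). Qed.
Lemma biform_rsum (I : finType) (c : I -> K) (w : I -> V') x :
  B x (\sum_i c i *: w i) = \sum_i c i * B x (w i).
Proof.
have /= -> := linear_sum (scalar_of (Br x)) (index_enum I) xpredT (fun i => c i *: w i).
by apply: eq_bigr => i _; exact: biform_rZ.
Qed.
Lemma biform_lker y : subspace (fun x => B x y = 0).
Proof.
split; first exact: biform_l0.
by move=> c u v Hu Hv; rewrite (proj1 Bbi) Hu Hv mulr0 addr0.
Qed.
Lemma biform_rker x : subspace (fun y => B x y = 0).
Proof.
split; first exact: biform_r0.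
by move=> c u v Hu Hv; rewrite (proj2 Bbi) Hu Hv mulr0 addr0.
Qed.

Variables (d d' rho : nat).
Hypothesis rd : (rho + d' <= d)%N.
Variables (a star : {linear V -> V}) (a' star' : {linear V' -> V'}).
Variables (th ths vph th' ths' vph' : nat -> K).
Variables (e : nat -> V) (eps : nat -> {scalar V}).
Variables (e' b' : nat -> V') (eps' : nat -> {scalar V'}).
Hypothesis sb : split_basis d a star th ths vph e eps.
Hypothesis sb' : split_basis d' a' star' th' ths' vph' e' eps'.
Hypothesis ths_inj : inj_upto d ths.
Hypothesis ths_inj' : inj_upto d' ths'.
Hypothesis bs' : forall k, (k <= d')%N -> star' (b' k) = ths' k *: b' k.
Hypothesis b1' : forall k, (k <= d')%N -> eps' k (b' k) = 1.

Section Necessity.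
Hypothesis Bs : forall k x, (k <= d')%N ->
  B (star x) (b' k) = ths (k + rho)%N * B x (b' k).
Hypothesis Bd : forall j, (0 < j <= d')%N -> B (e d) (e' j) = 0.

Lemma top_functional k : B (e d) (b' k) = B (e d) (e' 0%N) * eps' 0 (b' k).
Proof.
rewrite {1}(sb_exp sb' (b' k)) biform_rsum big_ord_recl /= big1 ?addr0 1?mulrC //.
by move=> i _; rewrite Bd ?mulr0 //= ; exact: ltn_ord.
Qed.

(** The functional B (e d) is a multiple of the coordinate functional at e'_0,
    since it kills the other e'_j; and B (_, b'_k) is an eigenfunctional of star
    for theta^*_{k+rho}. Evaluating B (e_d, b'_k) in both ways expresses
    B (e_{k+rho}, b'_k), the coefficient that determines the form, by the
    parameters. *)
Lemma connection k : (k <= d')%N ->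
  B (e d) (e' 0%N) * \prod_(l < k) vph' l.+1 *
    \prod_((k + rho).+1 <= l < d.+1) (ths (k + rho)%N - ths l) =
  B (e (k + rho)%N) (b' k) * \prod_((k + rho).+1 <= l < d.+1) vph l *
    \prod_(l < k) (ths' k - ths' l).
Proof.
move=> kd'; have kd : (k + rho <= d)%N by lia.
have /= <- := functional_top sb kd (X := scalar_of (Bl (b' k))) (fun v => Bs v kd').
by rewrite top_functional -(eps0_b sb' bs' b1' kd'); ring.
Qed.

(** A single vanishing coefficient forces B (e_d, e'_0) = 0, then all
    coefficients vanish, and with them the form. *)
Lemma connection_neq0 x y : (forall l, (0 < l <= d)%N -> vph l != 0) ->
  (forall l, (0 < l <= d')%N -> vph' l != 0) -> B x y != 0 ->
  B (e d) (e' 0%N) != 0 /\ forall k, (k <= d')%N -> B (e (k + rho)%N) (b' k) != 0.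
Proof.
move=> v0 v0' Bxy.
have D0 k : (k <= d')%N ->
  \prod_((k + rho).+1 <= l < d.+1) (ths (k + rho)%N - ths l) != 0.
  move=> kd'; rewrite prodf_seq_neq0; apply/allP => l; rewrite mem_index_iota.
  move=> /andP[kl ld]; rewrite /= subr_eq0; apply/eqP => h.
  by have := ths_inj (ltac:(lia) : (k + rho <= d)%N) (ltac:(lia) : (l <= d)%N) h; lia.
have N0 k : (k <= d')%N -> \prod_(l < k) (ths' k - ths' l) != 0.
  move=> kd'; apply/prodf_neq0 => l _; rewrite subr_eq0; apply/eqP => h.
  have lk := ltn_ord l.
  by have := ths_inj' kd' (ltac:(lia) : (l <= d')%N) h; lia.
have P0 k : (k <= d')%N -> \prod_((k + rho).+1 <= l < d.+1) vph l != 0.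
  move=> kd'; rewrite prodf_seq_neq0; apply/allP => l; rewrite mem_index_iota.
  by move=> /andP[kl ld]; rewrite /= v0 //; lia.
have P0' k : (k <= d')%N -> \prod_(l < k) vph' l.+1 != 0.
  by move=> kd'; apply/prodf_neq0 => l _; apply: v0'; move: (ltn_ord l); lia.
have m0 : B (e d) (e' 0%N) != 0.
  apply: contra Bxy => /eqP m0; apply/eqP.
  move: x; apply: (split_span sb (biform_lker y)) => i id; move: y.
  apply: (span_b sb' ths_inj' bs' b1' (biform_rker (e i))) => k kd'.
  have kd : (k + rho <= d)%N by lia.
  have rec := functional_rec sb (X := scalar_of (Bl (b' k))) (fun v => Bs v kd').
  case: (ltnP i (k + rho)) => ik.
    exact: (functional_low sb ths_inj (X := scalar_of (Bl (b' k))) kd (fun v => Bs v kd') ik).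
  have ck : B (e (k + rho)%N) (b' k) = 0.
    have /eqP := connection kd'; rewrite m0 !mul0r eq_sym !mulf_eq0.
    by rewrite (negPf (P0 _ kd')) (negPf (N0 _ kd')) !orbF => /eqP.
  rewrite -(subnKC ik); move: (subnKC ik) id => <-.
  rewrite addKn; elim: (i - (k + rho))%N => [|n IH] nd; first by rewrite addn0.
  rewrite addnS in nd *; have /= := rec _ nd; rewrite IH 1?ltnW // mulr0 => /eqP.
  rewrite mulf_eq0 subr_eq0 => /orP[/eqP h|/eqP //].
  by have := ths_inj kd nd h; lia.
split=> // k kd'; have := connection kd'; apply: contra_eqN => /eqP ->.
by rewrite !mul0r !mulf_neq0 ?D0 ?P0'.
Qed.

(** The functional B (e_{d-1}, _) lies in the span of the coordinate functionals
    at e'_0 and e'_1. Its quotient by B (e_d, _) at b'_k is affine in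
    theta^*_{k+rho} when computed in V, and affine in theta^{*'}_k when computed
    in V'. *)
Lemma affine_of_balanced : (0 < d')%N ->
  (forall l, (0 < l <= d)%N -> vph l != 0) ->
  (forall l, (0 < l <= d')%N -> vph' l != 0) ->
  B (e d) (e' 0%N) != 0 ->
  (forall j, (1 < j <= d')%N -> B (e d.-1) (e' j) = 0) ->
  exists x y, forall k, (k <= d')%N -> ths (k + rho)%N = x + y * ths' k.
Proof.
move=> d0' v0 v0' m0 Bd1; set m := B (e d) (e' 0%N) in m0.
have d0 : (0 < d)%N by lia.
have vd : vph d != 0 by rewrite v0 // d0 leqnn.
have v1 : vph' 1%N != 0 by rewrite v0'.
pose al := B (e d.-1) (e' 0%N); pose be := B (e d.-1) (e' 1%N).
exists (ths d + vph d * (al - be * ths' 0%N / vph' 1%N) / m).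
exists (vph d * be / vph' 1%N / m) => k kd'.
have kd : (k + rho <= d)%N by lia.
have h0 : eps' 0 (b' k) != 0.
  have := eps0_b sb' bs' b1' kd'; apply: contra_eqN => /eqP ->.
  rewrite mul0r eq_sym; apply/prodf_neq0 => l _; apply: v0'.
  by move: (ltn_ord l); lia.
have E1 : B (e d.-1) (b' k) = al * eps' 0 (b' k) + be * eps' 1 (b' k).
  rewrite {1}(sb_exp sb' (b' k)) biform_rsum.
  rewrite -(big_mkord xpredT (fun i => eps' i (b' k) * B (e d.-1) (e' i))).
  have H0 : \sum_(2 <= i < d'.+1) eps' i (b' k) * B (e d.-1) (e' i) = 0.
    rewrite big_nat_cond big1 // => i /andP[/andP[i2 id] _].
    by rewrite Bd1 ?mulr0 //; lia.
  rewrite (big_cat_nat (n := 2)) //= ?ltnS // H0 addr0.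
  by rewrite !big_nat_recr //= big_geq // add0r /al /be; ring.
have E2 := functional_rec sb (X := scalar_of (Bl (b' k))) (fun v => Bs v kd')
  (ltac:(lia) : (d.-1 < d)%N).
rewrite prednK //= top_functional -/m E1 in E2.
have E3 := eps1_b sb' bs' kd'.
apply: (mulIf h0); apply: (mulIf m0).
have -> : ths (k + rho)%N * eps' 0 (b' k) * m =
  (ths (k + rho)%N - ths d) * (m * eps' 0 (b' k)) + ths d * eps' 0 (b' k) * m by ring.
have E4 : eps' 1 (b' k) = (ths' k - ths' 0%N) * eps' 0 (b' k) / vph' 1%N.
  by rewrite -E3; field.
by rewrite E2 E4; field; rewrite m0 v1.
Qed.

End Necessity.

(** Once the operators star and star' are intertwined up to an affine change,
    the vanishing for i = d propagates to all smaller i. *)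
Lemma vanish_of_top (x y : K) : x != 0 ->
  (forall l, (0 < l <= d)%N -> vph l != 0) ->
  (forall u v, x * B (star u) v + y * B u v = B u (star' v)) ->
  (forall j, (0 < j <= d')%N -> B (e d) (e' j) = 0) ->
  forall i j, (i <= d)%N -> (j <= d')%N -> (d < i + j)%N -> B (e i) (e' j) = 0.
Proof.
move=> x0 v0 Bs Bd.
suff H n i j : (i + n = d)%N -> (j <= d')%N -> (d < i + j)%N -> B (e i) (e' j) = 0.
  by move=> i j id jd; apply: (H (d - i)%N); lia.
elim: n i j => [|n IH] i j id jd ij.
  by rewrite addn0 in id; subst i; apply: Bd; lia.
case: j jd ij => [|j] jd ij; first lia.
have E := Bs (e i.+1) (e' j.+1); move: E.
rewrite (sb_asS sb) ?(sb_asS sb'); try lia.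
rewrite biform_lD biform_rD !biform_lZ !biform_rZ.
rewrite (IH i.+1 j.+1) ?(IH i.+1 j); try lia.
have vi : vph i.+1 != 0 by apply: v0; lia.
rewrite !mulr0 !addr0 => /eqP.
by rewrite add0r !mulf_eq0 (negPf x0) (negPf vi) /= => /eqP.
Qed.

End Half.
End Forms.

(** * Balanced forms *)

(** The linear algebra of a Leonard system: the split bases e and e2 of the
    system and of its second inversion, normalised to start with the same
    vector, and eigenbases u of a and b of star. *)
Record leonard_model (K : fieldType) (V : lmodType K) (d : nat)
    (a star : {linear V -> V}) (p : parray K) (e e2 b u : nat -> V)
    (eps eps2 : nat -> {scalar V}) : Prop := LeonardModel {
  lm_sb : split_basis d a star (theta p) (thetas p) (vphi p) e eps;
  lm_sb2 : split_basis d a star (fun i => theta p (d - i)%N) (thetas p) (phi p)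
    e2 eps2;
  lm_e20 : e2 0%N = e 0%N;
  lm_b : forall k, (k <= d)%N -> star (b k) = thetas p k *: b k;
  lm_b1 : forall k, (k <= d)%N -> eps k (b k) = 1;
  lm_u : forall k, (k <= d)%N -> a (u k) = theta p k *: u k;
  lm_u0 : forall k, (k <= d)%N -> u k != 0;
  lm_th : inj_upto d (theta p);
  lm_ths : inj_upto d (thetas p);
  lm_vph : forall i, (0 < i <= d)%N -> vphi p i != 0;
  lm_ph : forall i, (0 < i <= d)%N -> phi p i != 0
}.

Lemma inj_rev (T : Type) n (f : nat -> T) : inj_upto n f -> inj_upto n (fun i => f (n - i)%N).
Proof. by move=> fi i j id jd /fi h; have := h (leq_subr _ _) (leq_subr _ _); lia. Qed.

Section Balanced.

Variables (K : fieldType) (V V' : lmodType K).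

(** Each u_i is triangular with respect to the split basis, so orthogonality of
    the two flags can be tested on either basis. *)
Lemma flags_vanish (B : V -> V' -> K) d d' a star a' star' th ths vph th' ths' vph'
    e eps e' eps' (u : nat -> V) (u' : nat -> V') :
  biform B -> split_basis d a star th ths vph e eps ->
  split_basis d' a' star' th' ths' vph' e' eps' ->
  inj_upto d th -> inj_upto d' th' ->
  (forall k, (k <= d)%N -> a (u k) = th k *: u k) ->
  (forall k, (k <= d)%N -> u k != 0) ->
  (forall k, (k <= d')%N -> a' (u' k) = th' k *: u' k) ->
  (forall k, (k <= d')%N -> u' k != 0) ->
  (forall i j, (i <= d)%N -> (j <= d')%N -> (d < i + j)%N -> B (u i) (u' j) = 0) <->
  (forall i j, (i <= d)%N -> (j <= d')%N -> (d < i + j)%N -> B (e i) (e' j) = 0).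
Proof.
move=> Bbi sb sb' thi thi' ua u0 ua' u0'; split=> H i j id jd ij.
  apply: (flag_e sb thi ua u0 (Q := fun x => B x (e' j) = 0)) => //.
    exact: biform_lker.
  move=> k /andP[ik kd].
  apply: (flag_e sb' thi' ua' u0' (Q := fun x => B (u k) x = 0)) => //.
    exact: biform_rker.
  by move=> l /andP[jl ld]; apply: H => //; lia.
apply: (flag_u sb thi ua (Q := fun x => B x (u' j) = 0)) => //.
  exact: biform_lker.
move=> k /andP[ik kd].
apply: (flag_u sb' thi' ua' (Q := fun x => B (e k) x = 0)) => //.
  exact: biform_rker.
by move=> l /andP[jl ld]; apply: H => //; lia.
Qed.

Variables (d d' rho : nat) (a star : {linear V -> V}) (a' star' : {linear V' -> V'}).
Variables (p p' : parray K) (e e2 b u : nat -> V) (e' e2' b' u' : nat -> V').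
Variables (eps eps2 : nat -> {scalar V}) (eps' eps2' : nat -> {scalar V'}).
Hypothesis lm : leonard_model d a star p e e2 b u eps eps2.
Hypothesis lm' : leonard_model d' a' star' p' e' e2' b' u' eps' eps2'.
Hypothesis d0' : (0 < d')%N.
Hypothesis rd : (rho + d' <= d)%N.

Definition balanced_model (B : V -> V' -> K) : Prop :=
  [/\ biform B, exists x y, B x y != 0,
      forall i j, (i <= d)%N -> (j <= d')%N -> i <> (j + rho)%N -> B (b i) (b' j) = 0 &
      forall i j, (i <= d)%N -> (j <= d')%N -> (i < j)%N \/ (j + (d - d') < i)%N ->
        B (u i) (u' j) = 0].

(** The dual eigenvalues of the smaller system are an affine image of those of
    the larger one, shifted by rho, and the quotients phi_i / vphi_i agree up to
    this shift. Both are written without denominators, so that they can be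
    transported along field embeddings in both directions. *)
Definition descent_condition (F : fieldType) (ths vph ph ths' vph' ph' : nat -> F) : Prop :=
  (forall k, (k <= d')%N -> (ths' k - ths' 0%N) * (ths rho.+1 - ths rho) =
     (ths' 1%N - ths' 0%N) * (ths (k + rho)%N - ths rho)) /\
  (forall k, (0 < k <= d')%N -> ph' k * vph (k + rho)%N = vph' k * ph (k + rho)%N).

Let sb := lm_sb lm.
Let sb2 := lm_sb2 lm.
Let sb' := lm_sb lm'.
Let sb2' := lm_sb2 lm'.

Lemma balanced_flags (B : V -> V' -> K) : biform B ->
  (forall i j, (i <= d)%N -> (j <= d')%N -> (i < j)%N \/ (j + (d - d') < i)%N ->
        B (u i) (u' j) = 0) <->
  (forall i j, (i <= d)%N -> (j <= d')%N -> (d < i + j)%N -> B (e i) (e2' j) = 0) /\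
  (forall i j, (i <= d)%N -> (j <= d')%N -> (d < i + j)%N -> B (e2 i) (e' j) = 0).
Proof.
move=> Bbi.
have F1 := flags_vanish Bbi sb sb2' (lm_th lm) (inj_rev (lm_th lm')) (lm_u lm) (lm_u0 lm)
  (u' := fun k => u' (d' - k)%N) (fun k _ => lm_u lm' (leq_subr k d'))
  (fun k _ => lm_u0 lm' (leq_subr k d')).
have F2 := flags_vanish Bbi sb2 sb' (inj_rev (lm_th lm)) (lm_th lm')
  (u := fun k => u (d - k)%N) (fun k _ => lm_u lm (leq_subr k d))
  (fun k _ => lm_u0 lm (leq_subr k d)) (lm_u lm') (lm_u0 lm').
split=> [H|[/F1 H1 /F2 H2] i j id jd [ij|ij]].
- split; [apply/F1|apply/F2] => i j id jd ij; apply: H; lia.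
- rewrite -(subKn id); apply: H2; lia.
- rewrite -(subKn jd); apply: H1; lia.
Qed.

Let tail n (f : nat -> K) := \prod_(n.+1 <= l < d.+1) f l.
Let hd n (f : nat -> K) := \prod_(l < n) f l.+1.

Let tailS n f : (n < d)%N -> tail n f = f n.+1 * tail n.+1 f.
Proof. by move=> nd; rewrite /tail big_ltn. Qed.
Let hdS n f : hd n.+1 f = hd n f * f n.+1.
Proof. by rewrite /hd big_ord_recr. Qed.
Let tail_neq0 n f : (forall i, (0 < i <= d)%N -> f i != 0) -> tail n f != 0.
Proof.
move=> f0; rewrite prodf_seq_neq0; apply/allP => l; rewrite mem_index_iota.
by move=> /andP[kl ld]; apply: f0; lia.
Qed.
Let hd_neq0 n f : (n <= d')%N -> (forall i, (0 < i <= d')%N -> f i != 0) -> hd n f != 0.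
Proof.
by move=> nd f0; apply/prodf_neq0 => l _; apply: f0; move: (ltn_ord l); lia.
Qed.
Let delta_neq0 k : (k <= d)%N -> \prod_(k.+1 <= l < d.+1) (thetas p k - thetas p l) != 0.
Proof.
move=> kd; rewrite prodf_seq_neq0; apply/allP => l; rewrite mem_index_iota.
move=> /andP[kl ld]; rewrite /= subr_eq0; apply/eqP => h.
by have := lm_ths lm kd (ltac:(lia) : (l <= d)%N) h; lia.
Qed.
Let nabla_neq0 k : (k <= d')%N -> \prod_(l < k) (thetas p' k - thetas p' l) != 0.
Proof.
move=> kd'; apply/prodf_neq0 => l _; rewrite subr_eq0; apply/eqP => h.
have lk := ltn_ord l.
by have := lm_ths lm' kd' (ltac:(lia) : (l <= d')%N) h; lia.
Qed.

Lemma lm_b2 k : (k <= d')%N -> eps2' k (b' k) = 1.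
Proof.
move=> kd; rewrite (lead_eps2 sb' sb2' (lm_e20 lm') kd) ?(lm_b1 lm') //.
exact: (eigen_star_low sb' (lm_ths lm') kd (lm_b lm' kd)).
Qed.

(** The form is determined by its values c_k at (e_{k+rho}, b'_k).
    [connection] computes them twice, from (e, e2') and from (e2, e'); the
    quotient of the two answers gives the condition on phi / vphi. *)
Lemma balanced_necessary B : balanced_model B ->
  descent_condition (thetas p) (vphi p) (phi p) (thetas p') (vphi p') (phi p').
Proof.
case=> Bbi [x0 [y0 B0]] Bb /(balanced_flags Bbi)[BE BE2].
have Bl y : scalar (B^~ y) by move=> c v w; rewrite (proj1 Bbi).
have Bs k x : (k <= d')%N -> B (star x) (b' k) = thetas p (k + rho)%N * B x (b' k).
  move=> kd'; move: x; apply: (span_b sb (lm_ths lm) (lm_b lm) (lm_b1 lm)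
    (Q := fun x => B (star x) (b' k) = thetas p (k + rho)%N * B x (b' k))).
    split=> [|c v w Hv Hw]; first by rewrite linear0 biform_l0 ?mulr0.
    by rewrite linearP !(proj1 Bbi) Hv Hw; ring.
  move=> i id; rewrite (lm_b lm id) biform_lZ //.
  by have [->//|/eqP ik] := eqVneq i (k + rho)%N; rewrite Bb // !mulr0.
have Bd1 j : (0 < j <= d')%N -> B (e d) (e2' j) = 0.
  by move=> /andP[j0 jd]; apply: BE => //; lia.
have Bd2 j : (0 < j <= d')%N -> B (e2 d) (e' j) = 0.
  by move=> /andP[j0 jd]; apply: BE2 => //; lia.
have [m0 c0] := connection_neq0 Bbi rd sb sb2' (lm_ths lm) (lm_ths lm') (lm_b lm') lm_b2
  Bs Bd1 (lm_vph lm) (lm_ph lm') B0.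
split.
  have [x [y H]] := affine_of_balanced Bbi rd sb sb2' (lm_b lm') lm_b2 Bs Bd1
    d0' (lm_vph lm) (lm_ph lm') m0
    (fun j jd => BE _ _ (leq_pred d) (proj2 (andP jd)) (ltac:(lia))).
  move=> k kd; have H0 := H 0%N (leq0n _); have H1 := H 1%N d0'; rewrite add0n in H0.
  by rewrite add1n in H1; rewrite H0 H1 H //; ring.
have C1 k (kd : (k <= d')%N) := connection Bbi rd sb sb2' (lm_b lm') lm_b2 Bs Bd1 kd.
have C2 k (kd : (k <= d')%N) := connection Bbi rd sb2 sb' (lm_b lm') (lm_b1 lm') Bs Bd2 kd.
set m := B (e d) (e2' 0%N) in m0 C1; set n := B (e2 d) (e' 0%N) in C2.
have G k : (k <= d')%N -> m * hd k (phi p') * tail (k + rho) (phi p) =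
    n * hd k (vphi p') * tail (k + rho) (vphi p).
  move=> kd; have kr : (k + rho <= d)%N by lia.
  apply: (mulIf (delta_neq0 kr)); rewrite mulrAC C1 // [RHS]mulrAC C2 //.
  have [l1 l2] := e2_low sb sb2 (lm_e20 lm) kr.
  have -> : B (e2 (k + rho)%N) (b' k) = B (e (k + rho)%N) (b' k).
    have /= -> := functional_on_low (X := scalar_of (Bl (b' k))) sb kr l1.
      by rewrite l2 mul1r.
    exact: (functional_low sb (lm_ths lm) kr (X := scalar_of (Bl (b' k))) (fun v => Bs k v kd)).
  by rewrite /tail; ring.
move=> [//|k] /andP[_ kd]; rewrite addSn.
have kr : (k + rho < d)%N by lia.
have Gk := G _ (ltnW kd); have := G _ kd; rewrite !hdS addSn => Gk1.
rewrite !(tailS _ kr) in Gk.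
have t0 := tail_neq0 (k + rho).+1 (lm_ph lm).
have h0 := hd_neq0 (ltnW kd) (lm_ph lm').
set al := m * hd k (phi p') * tail (k + rho).+1 (phi p).
have al0 : al != 0 by rewrite /al !mulf_neq0.
apply: (mulfI al0).
transitivity (m * (hd k (phi p') * phi p' k.+1) * tail (k + rho).+1 (phi p) * vphi p (k + rho).+1).
  by rewrite /al; ring.
rewrite Gk1.
transitivity (m * hd k (phi p') * (phi p (k + rho).+1 * tail (k + rho).+1 (phi p)) * vphi p' k.+1).
  by rewrite Gk; ring.
by rewrite /al; ring.
Qed.

(** The eigenfunctionals X_k and Y_k of the two dual operators give the form
    sum_k c_k X_k Y_k, and the weights c_k are chosen such that e_d is
    orthogonal to all e2'_j with j > 0. The condition on phi / vphi makes e2_d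
    orthogonal to all e'_j with j > 0 for the same weights, and the affine
    relation propagates both facts by [vanish_of_top]. *)
Lemma balanced_sufficient :
  descent_condition (thetas p) (vphi p) (phi p) (thetas p') (vphi p') (phi p') ->
  exists B, balanced_model B.
Proof.
case=> aff rat.
have kr (k : 'I_d'.+1) : (k + rho <= d)%N by move: (ltn_ord k); lia.
have kd (k : 'I_d'.+1) : (k <= d')%N by rewrite -ltnS.
have [X Xs X1] := fin_all_exists2 (fun k : 'I_d'.+1 => functional_exists sb (lm_ths lm) (kr k)).
have [Y Ys Y1] := fin_all_exists2 (fun k : 'I_d'.+1 => functional_exists sb' (lm_ths lm') (kd k)).
have Xtop k := functional_top sb (kr k) (Xs k); have Xtop2 k := functional_top sb2 (kr k) (Xs k).
have X0 k : X k (e d) != 0.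
  have := Xtop k; rewrite X1 mul1r; apply: contra_eqN => /eqP ->.
  by rewrite mul0r eq_sym tail_neq0 //; exact: lm_vph lm.
have X21 k : X k (e2 (k + rho)%N) = 1.
  have [l1 l2] := e2_low sb sb2 (lm_e20 lm) (kr k).
  rewrite (functional_on_low sb (kr k) l1) ?l2 ?X1 ?mulr1 // => i ik.
  exact: (functional_low sb (lm_ths lm) (kr k) (Xs k)).
have Yb k l : (l <= d')%N -> Y k (b' l) = (k == l :> nat)%:R.
  move=> ld; case: eqP => [<-|/eqP kl].
    have bl := eigen_star_low sb' (lm_ths lm') (kd k) (lm_b lm' (kd k)).
    rewrite (functional_on_low sb' (kd k) bl) ?Y1 ?(lm_b1 lm') ?mulr1 // => i ik.
    exact: (functional_low sb' (lm_ths lm') (kd k) (Ys k)).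
  have := Ys k (b' l); rewrite (lm_b lm' ld) scalarZ => /eqP.
  rewrite -subr_eq0 -mulrBl mulf_eq0 subr_eq0 => /orP[/eqP h|/eqP //].
  by case/eqP: kl; rewrite (lm_ths lm' ld (kd k) h).
pose c (k : 'I_d'.+1) := eps2' 0 (b' k) / X k (e d).
pose B x y := \sum_(k < d'.+1) c k * X k x * Y k y.
have Bbi : biform B.
  split=> [t v w y|t v w y]; rewrite /B mulr_sumr -big_split; apply: eq_bigr => k _;
    by rewrite scalarP /=; ring.
have Bb x (k : 'I_d'.+1) : B x (b' k) = c k * X k x.
  rewrite /B (bigD1 k) //= Yb // eqxx mulr1 big1 ?addr0 // => l lk.
  by rewrite Yb // (negPf (lk : l != k :> nat)) mulr0.
have Bspan x (Z : {scalar V'}) : (forall k : 'I_d'.+1, B x (b' k) = Z (b' k)) ->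
    forall y, B x y = Z y.
  move=> H; apply: (span_b sb' (lm_ths lm') (lm_b lm') (lm_b1 lm')).
    split=> [|t v w Hv Hw]; first by rewrite linear0 biform_r0.
    by rewrite (proj2 Bbi) Hv Hw scalarP.
  by move=> k kd'; apply: (H (Ordinal (kd' : (k < d'.+1)%N))).
have Bd y : B (e d) y = eps2' 0 y.
  by apply: Bspan => k; rewrite Bb /c divfK.
pose n := tail rho (phi p) / tail rho (vphi p).
have tv k := tail_neq0 k (lm_vph lm); have tp k := tail_neq0 k (lm_ph lm).
have H k : (k <= d')%N -> hd k (phi p') * tail (k + rho) (phi p) =
    n * (hd k (vphi p') * tail (k + rho) (vphi p)).
  elim: k => [|k IH] kd'; first by rewrite /hd !big_ord0 add0n /n !mul1r divfK.
  have {}IH := IH (ltnW kd'); have kr' : (k + rho < d)%N by lia.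
  rewrite !(tailS _ kr') in IH; rewrite !hdS addSn.
  have r := rat k.+1 kd'; rewrite addSn in r.
  have v0 : vphi p (k + rho).+1 != 0 by apply: (lm_vph lm); lia.
  have p0 : phi p (k + rho).+1 != 0 by apply: (lm_ph lm); lia.
  apply: (mulIf v0); apply: (mulIf p0).
  set T := tail _ (phi p) in IH *; set T' := tail _ (vphi p) in IH *.
  transitivity (hd k (phi p') * (phi p (k + rho).+1 * T) * (phi p' k.+1 * vphi p (k + rho).+1)).
    by ring.
  by rewrite IH r; ring.
have Bd2 y : B (e2 d) y = n * eps' 0 y.
  have Zs : scalar (fun y => n * eps' 0 y).
    by move=> t v w; rewrite scalarP; ring.
  apply: (Bspan _ (scalar_of Zs)) => k /=; rewrite Bb /c.
  apply: (mulIf (X0 k)); rewrite mulrAC divfK //.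
  apply: (mulIf (delta_neq0 (kr k))); apply: (mulIf (nabla_neq0 (kd k))).
  have E1 := eps0_b sb' (lm_b lm') (lm_b1 lm') (kd k).
  have E2 := eps0_b sb2' (lm_b lm') lm_b2 (kd k).
  have := Xtop k; have := Xtop2 k; rewrite X21 X1 !mul1r => T2 T1.
  transitivity (hd k (phi p') * tail (k + rho) (phi p)).
    by rewrite /tail -T2 /hd -E2; ring.
  by rewrite H // /tail -T1 /hd -E1; ring.
have rr : thetas p rho.+1 - thetas p rho != 0.
  rewrite subr_eq0; apply/eqP => h.
  by have := lm_ths lm (ltac:(lia) : (rho.+1 <= d)%N) (ltac:(lia) : (rho <= d)%N) h; lia.
have rr' : thetas p' 1%N - thetas p' 0%N != 0.
  by rewrite subr_eq0; apply/eqP => h; have := lm_ths lm' d0' (leq0n _) h.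
pose xi := (thetas p' 1%N - thetas p' 0%N) / (thetas p rho.+1 - thetas p rho).
pose ze := thetas p' 0%N - xi * thetas p rho.
have xi0 : xi != 0 by rewrite mulf_neq0 ?invr_eq0.
have Baff x y : xi * B (star x) y + ze * B x y = B x (star' y).
  move: y; apply: (span_b sb' (lm_ths lm') (lm_b lm') (lm_b1 lm')
    (Q := fun y => xi * B (star x) y + ze * B x y = B x (star' y))).
    split=> [|t v w Hv Hw]; first by rewrite linear0 !biform_r0 ?mulr0 ?addr0.
    by rewrite linearP !(proj2 Bbi) -Hv -Hw; ring.
  move=> k kd'; pose k' := Ordinal (kd' : (k < d'.+1)%N).
  rewrite (lm_b lm' kd') biform_rZ //.
  have := Bb (star x) k'; have /= -> := Bb x k'; move=> /= ->; rewrite Xs /=.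
  have := aff k kd' => /eqP; rewrite -subr_eq0 => /eqP E.
  have -> : thetas p' k = xi * thetas p (k + rho)%N + ze.
    apply: (mulIf rr); rewrite /ze /xi; apply/eqP; rewrite -subr_eq0 -E; apply/eqP.
    by field.
  by ring.
exists B; split=> //.
- exists (e rho), (b' 0%N).
  have /= -> := Bb (e rho) ord0; have /= := X1 ord0; rewrite add0n => ->.
  rewrite mulr1 /c mulf_neq0 ?invr_eq0 ?X0 //=.
  by rewrite lm_b2 ?oner_eq0.
- move=> i j id jd ij; have /= -> := Bb (b i) (Ordinal (jd : (j < d'.+1)%N)).
  set k := Ordinal _.
  have := Xs k (b i); rewrite (lm_b lm id) scalarZ => /eqP.
  rewrite -subr_eq0 -mulrBl mulf_eq0 subr_eq0 => /orP[/eqP h|/eqP ->].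
    by case: ij; rewrite (lm_ths lm id (kr k) h).
  by rewrite mulr0.
apply/(balanced_flags Bbi); split.
  apply: (vanish_of_top Bbi rd sb sb2' xi0 (lm_vph lm) Baff) => j /andP[j0 jd].
  by rewrite Bd (sb_dual sb2') // eq_sym gtn_eqF.
apply: (vanish_of_top Bbi rd sb2 sb' xi0 (lm_ph lm) Baff) => j /andP[j0 jd].
by rewrite Bd2 (sb_dual sb') // eq_sym gtn_eqF // mulr0.
Qed.

End Balanced.

(** * Modules over a matrix algebra as vector spaces *)

(** A copy of the module that carries the vector space structure induced by
    the scalars of the algebra. *)
Definition kmod (K : fieldType) (AA : algType K) (V : lmodType AA) : Type := V.

Section KModule.
Variables (K : fieldType) (AA : algType K) (V : lmodType AA).

HB.instance Definition _ := GRing.Zmodule.copy (kmod V) V.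

Let kscale (k : K) (v : kmod V) : kmod V := (k%:A : AA) *: (v : V).

Fact kscaleA x y v : kscale x (kscale y v) = kscale (x * y) v.
Proof. by rewrite /kscale scalerA -scalerAl mul1r scalerA. Qed.
Fact kscale1 : left_id 1 kscale.
Proof. by move=> v; rewrite /kscale !scale1r. Qed.
Fact kscaleDr : right_distributive kscale +%R.
Proof. by move=> k u v; rewrite /kscale scalerDr. Qed.
Fact kscaleDl v : {morph kscale^~ v : x y / x + y}.
Proof. by move=> x y; rewrite /kscale scalerDl scalerDl. Qed.

HB.instance Definition _ := GRing.Zmodule_isLmodule.Build K (kmod V)
  kscaleA kscale1 kscaleDr kscaleDl.

Lemma kscaleE (k : K) (v : kmod V) : k *: v = (k%:A : AA) *: (v : V) :> V.
Proof. by []. Qed.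

Definition act (X : AA) (v : kmod V) : kmod V := X *: (v : V).

Fact act_linear X : linear (act X).
Proof.
move=> k u v; rewrite /act scalerDr; congr (_ + _).
change (X *: ((k%:A : AA) *: (u : V)) = (k%:A : AA) *: (X *: (u : V))).
by rewrite !scalerA mulr_algl mulr_algr.
Qed.
HB.instance Definition _ X :=
  GRing.isLinear.Build K (kmod V) (kmod V) *:%R (act X) (act_linear X).

Lemma actM X Y v : act (X * Y) v = act X (act Y v).
Proof. by rewrite /act scalerA. Qed.
Lemma actZ k X v : act (k *: X) v = k *: act X v.
Proof. by rewrite /act kscaleE scalerA mulr_algl. Qed.
Lemma act_sum (I : finType) (F : I -> AA) v : act (\sum_i F i) v = \sum_i act (F i) v.
Proof.
apply: (big_morph (fun X => act X v)) => [X Y|]; first exact: (scalerDl (v : V)).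
exact: (scale0r (v : V)).
Qed.
End KModule.

Section Coordinates.
Variables (K : fieldType) (d : nat) (AA : algType K) (V : lmodType AA).
Variable f : {lrmorphism AA -> 'M[K]_d.+1}.
Hypothesis f_iso : algebra_iso f.
Hypothesis V_irr : irreducible_module V.

(** The images E_{i0} w of a nonzero vector w = E_{00} w under the matrix units
    form a basis; irreducibility makes them span. *)
Lemma matrix_units_basis : exists e : 'I_d.+1 -> kmod V,
  [/\ forall c : 'I_d.+1 -> K, \sum_i c i *: e i = 0 -> forall i, c i = 0,
      forall v, exists c : 'I_d.+1 -> K, v = \sum_i c i *: e i &
      forall X j, act X (e j) = \sum_i f X i j *: e i].
Proof.
have [g fK gK] := f_iso; have f_inj := can_inj fK.
pose m i j := g (delta_mx i j).
have fm i j : f (m i j) = delta_mx i j by rewrite /m gK.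
have mm i j k l : m i j * m k l = m i l *+ (j == k).
  by apply: f_inj; rewrite rmorphM rmorphMn /= !fm -mul_delta_mx_cond.
have m1 : \sum_i m i i = 1.
  apply: f_inj; rewrite linear_sum rmorph1 /= (_ : 1 = 1%:M) // mx1_sum_delta.
  by apply: eq_bigr => i _; exact: fm.
have [[v v0] irr] := V_irr.
have [j mj] : exists j, m j j *: v != 0.
  apply/existsP; apply: contraR v0; rewrite negb_exists => /forallP H.
  rewrite -[v]scale1r -m1 scaler_suml big1 // => i _.
  by have := H i; rewrite negbK => /eqP.
pose w : kmod V := m ord0 j *: v.
have w0 : w != 0.
  apply: contra mj => /eqP w0; have -> : m j j = m j ord0 * m ord0 j.
    by rewrite mm eqxx mulr1n.
  by rewrite -scalerA -/w w0 scaler0.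
have mw : m ord0 ord0 *: (w : V) = w by rewrite /w scalerA mm eqxx mulr1n.
pose e i : kmod V := act (m i ord0) w.
have Xe X k : act X (e k) = \sum_i f X i k *: e i.
  rewrite /e -actM.
  have -> : X * m k ord0 = \sum_i f X i k *: m i ord0.
    apply: f_inj; rewrite rmorphM linear_sum /= fm.
    apply/matrixP => r s; rewrite summxE mxE (bigD1 k) //= big1 ?addr0; last first.
      by move=> i ik; rewrite mxE (negPf ik) mulr0.
    rewrite (bigD1 r) //= big1 ?addr0; last first.
      by move=> i ir; rewrite linearZ /= mxE fm mxE eq_sym (negPf ir) mulr0.
    by rewrite linearZ /= mxE fm !mxE !eqxx.
  by rewrite act_sum; apply: eq_bigr => i _; rewrite actZ.
exists e; split=> //.
- move=> c /(congr1 (fun v => act (m ord0 _) v)) H i.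
  have := H i; rewrite linear0 linear_sum (bigD1 i) //= big1 ?addr0; last first.
    move=> k ki; rewrite linearZ_LR /= /e -actM mm eq_sym (negPf ki) mulr0n.
    by rewrite /act scale0r scaler0.
  rewrite linearZ_LR /= /e -actM mm eqxx mulr1n /act mw => /eqP.
  by rewrite scaler_eq0 (negPf w0) orbF => /eqP.
- pose W (x : V) := exists c : 'I_d.+1 -> K, x = \sum_i c i *: e i.
  have W0 : W 0 by exists (fun=> 0); rewrite big1 // => i _; rewrite scale0r.
  have WD (X : AA) (x y : V) : W x -> W y -> W (X *: x + y).
    move=> [c xc] [c' yc]; exists (fun i => \sum_k f X i k * c k + c' i).
    under [RHS]eq_bigr do rewrite scalerDl.
    rewrite big_split /= -yc; congr (_ + _).
    change (act X x = \sum_i (\sum_k f X i k * c k) *: e i); rewrite xc.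
    have /= -> := linear_sum (act X) (index_enum 'I_d.+1) xpredT (fun k => c k *: e k).
    under [RHS]eq_bigr do rewrite scaler_suml.
    rewrite exchange_big /=; apply: eq_bigr => k _.
    rewrite linearZ_LR /= Xe scaler_sumr; apply: eq_bigr => i _.
    by rewrite scalerA mulrC.
  have [H|//] := irr W W0 WD.
  case/eqP: w0; apply: H; exists (fun i => (i == ord0)%:R).
  rewrite (bigD1 ord0) //= ?eqxx scale1r big1 ?addr0; first by rewrite /e /act mw.
  by move=> i i0; rewrite (negPf i0) scale0r.
Qed.

Lemma split_coordinates : exists (e : nat -> kmod V) (eps : nat -> {scalar (kmod V)}),
  [/\ forall i k, (i <= d)%N -> eps k (e i) = (k == i)%:R,
      forall i, (d < i)%N -> e i = 0,
      forall v, v = \sum_(i < d.+1) eps i v *: e i &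
      forall X (j : 'I_d.+1), act X (e j) = \sum_(i < d.+1) f X i j *: e i].
Proof.
have [e [indep span eX]] := matrix_units_basis.
have spanb v : exists c : {ffun 'I_d.+1 -> K}, v == \sum_i c i *: e i.
  have [c vc] := span v; exists (finfun c); apply/eqP; rewrite {1}vc.
  by apply: eq_bigr => i _; rewrite ffunE.
pose coord v := xchoose (spanb v).
have coordP v : v = \sum_i coord v i *: e i by apply/eqP/(xchooseP (spanb v)).
have coord_uniq v (c : 'I_d.+1 -> K) : v = \sum_i c i *: e i -> forall i, coord v i = c i.
  move=> vc i; apply/eqP; rewrite -subr_eq0; apply/eqP.
  apply: (indep (fun i => coord v i - c i)).
  under eq_bigr do rewrite scalerBl.
  by rewrite sumrB -coordP -vc subrr.
pose epsf (k : nat) v := if (k <= d)%N then coord v (inord k) else 0.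
have epsP k : scalar (epsf k).
  move=> c u v; rewrite /epsf; case: ifP => _; last by rewrite mulr0 addr0.
  apply: (coord_uniq _ (fun i => c * coord u i + coord v i)).
  under eq_bigr do rewrite scalerDl -scalerA.
  by rewrite big_split /= -scaler_sumr -!coordP.
exists (fun i => if (i <= d)%N then e (inord i) else 0), (fun k => scalar_of (epsP k)).
split=> [i k id|i|v|X j].
- rewrite id /= /epsf; case: (leqP k d) => kd; last by case: eqP => // ki; move: kd id; lia.
  rewrite (coord_uniq _ (fun l => (l == inord i)%:R)).
    by rewrite -val_eqE /= !inordK.
  rewrite (bigD1 (inord i)) //= eqxx scale1r big1 ?addr0 // => l li.
  by rewrite (negPf li) scale0r.
- by rewrite ltnNge => /negPf ->.
- rewrite {1}(coordP v); apply: eq_bigr => i _ /=.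
  by rewrite /epsf (ltn_ord i : (i <= d)%N) inord_val.
- rewrite (ltn_ord j : (j <= d)%N) inord_val eX; apply: eq_bigr => i _.
  by rewrite (ltn_ord i : (i <= d)%N) inord_val.
Qed.

Lemma split_basis_of_iso (A As : AA) th ths vph :
  f A = lower_bidiag d th -> f As = upper_bidiag d ths vph ->
  exists (e : nat -> kmod V) (eps : nat -> {scalar (kmod V)}),
    split_basis d (act A) (act As) th ths vph e eps /\
    forall X (j : 'I_d.+1), act X (e j) = \sum_(i < d.+1) f X i j *: e i.
Proof.
move=> fA fAs; have [e [eps [dual over expn eX]]] := split_coordinates.
exists e, eps; split=> //.
have pick (k : nat) : \sum_(i < d.+1) (i == k :> nat)%:R *: e i = e k.
  case: (leqP k d) => kd; last first.
    rewrite over // big1 // => i _; case: eqP => [ki|]; rewrite ?scale0r //.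
    by move: (ltn_ord i); lia.
  rewrite (bigD1 (Ordinal (kd : (k < d.+1)%N))) //= eqxx scale1r big1 ?addr0 //.
  by move=> i ik; rewrite (negPf (ik : i != k :> nat)) scale0r.
have pick2 (F : 'I_d.+1 -> K) (k l : nat) x y :
    (forall i : 'I_d.+1, F i = x * (i == k :> nat)%:R + y * (i == l :> nat)%:R) ->
    \sum_(i < d.+1) F i *: e i = x *: e k + y *: e l.
  move=> FE; rewrite -(pick k) -(pick l) !scaler_sumr -big_split /=.
  by apply: eq_bigr => i _; rewrite FE scalerDl !scalerA.
split=> //.
- move=> i id; have /= -> := eX A (Ordinal (id : (i < d.+1)%N)).
  rewrite -[e i.+1]scale1r; apply: pick2 => k; rewrite fA mxE -val_eqE /=.
  by case: (eqVneq (k : nat) i) => [->|_]; case: eqP => //= *; try lia; ring.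
- have /= -> := eX As ord0.
  have -> : ths 0%N *: e 0%N = ths 0%N *: e 0%N + 0 *: e 0%N by rewrite scale0r addr0.
  apply: pick2 => k; rewrite fAs mxE -val_eqE /=.
  by case: (eqVneq (k : nat) 0%N) => [->|_] /=; ring.
- move=> i id; have /= -> := eX As (Ordinal (id : (i.+1 < d.+1)%N)).
  apply: pick2 => k; rewrite fAs mxE -val_eqE /=.
  case: (eqVneq (k : nat) i.+1) => [->|_]; rewrite ?eqSS 1?[i == k]eq_sym.
    by case: eqP => *; [lia | rewrite /=; ring].
  by case: (eqVneq (k : nat) i) => [_|_] /=; ring.
Qed.

End Coordinates.

(** * Leonard systems in split coordinates *)

Lemma split_basis_scale (K : fieldType) (V : lmodType K) d (a star : {linear V -> V})
    th ths vph e eps (c : K) :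
  c != 0 -> split_basis d a star th ths vph e eps ->
  exists eps2 : nat -> {scalar V},
    split_basis d a star th ths vph (fun i => c *: e i) eps2.
Proof.
move=> c0 sb.
have epsP k : scalar (fun v => c^-1 * eps k v).
  by move=> t u v; rewrite scalarP; ring.
exists (fun k => scalar_of (epsP k)); split=> /=.
- by move=> i k id; rewrite scalarZ (sb_dual sb) // mulKf.
- by move=> i id; rewrite (sb_over sb) // scaler0.
- move=> v; rewrite {1}(sb_exp sb v); apply: eq_bigr => i _.
  by rewrite scalerA mulrAC mulVf // mul1r.
- by move=> i id; rewrite linearZ_LR (sb_a sb) // scalerDr !scalerA mulrC.
- by rewrite linearZ_LR (sb_as0 sb) !scalerA mulrC.
- move=> i id; rewrite linearZ_LR (sb_asS sb) // scalerDr !scalerA.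
  by rewrite [c * ths _]mulrC [c * vph _]mulrC.
Qed.

Section Model.
Variables (K : fieldType) (d : nat) (AA : algType K) (V : lmodType AA).

(** All d + 1 distinct eigenvalues occur among th_0, .., th_d, which are
    therefore distinct. *)
Lemma eigenvalues_inj (X : AA) (th : nat -> K) :
  (forall (v : kmod V) t, v != 0 -> act X v = t *: v -> exists2 k, (k <= d)%N & t = th k) ->
  multiplicity_free d V X -> inj_upto d th.
Proof.
move=> H [t t_inj teig].
have [g gE] : exists g : 'I_d.+1 -> 'I_d.+1, forall i, t i = th (g i).
  apply: (fin_all_exists (P := fun i (k : 'I_d.+1) => t i = th k)) => i.
  have [v v0 Xv] := teig i; have [k kd tk] := H v (t i) v0 Xv.
  by exists (Ordinal (kd : (k < d.+1)%N)).
have g_inj : injective g by move=> i j gij; apply: t_inj; rewrite !gE gij.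
have [g' gK g'K] := injF_bij g_inj.
move=> i j id jd thij.
pose i' := Ordinal (id : (i < d.+1)%N); pose j' := Ordinal (jd : (j < d.+1)%N).
suff /(congr1 val) : i' = j' by [].
rewrite -[i']g'K -[j']g'K; congr (g _); apply: t_inj.
by rewrite !gE !g'K.
Qed.

Lemma eigenvectors (X : AA) (t : nat -> K) (E : 'I_d.+1 -> AA) :
  inj_upto d t -> (forall i : 'I_d.+1, primitive_idempotent V X (t i) (E i)) ->
  exists u : nat -> kmod V,
    [/\ forall k, (k <= d)%N -> act X (u k) = t k *: u k,
        forall k, (k <= d)%N -> u k != 0 &
        forall (i : 'I_d.+1) k, (k <= d)%N ->
          act (E i) (u k) = (k == i)%:R *: u k].
Proof.
move=> t_inj Eprim.
have [u u0 Xu] : exists2 u : 'I_d.+1 -> kmod V, forall i, u i != 0 &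
    forall i, act X (u i) = t i *: u i.
  have : forall i : 'I_d.+1, exists2 v : kmod V, v != 0 & act X v = t i *: v.
    by move=> i; have [[v v0 Xv] _ _] := Eprim i; exists v.
  by move/fin_all_exists2.
have kE k : (k <= d)%N -> (inord k : 'I_d.+1) = k :> nat by move=> kd; rewrite inordK.
exists (fun k => u (inord k)); split.
- by move=> k kd; rewrite Xu kE.
- by move=> k kd.
- move=> i k kd; have Xk : act X (u (inord k)) = t k *: u (inord k) by rewrite Xu kE.
  have [_ E1 E0] := Eprim i.
  case: eqP => [ki|ki].
    by rewrite scale1r; apply: E1; rewrite -ki; exact: Xk.
  rewrite scale0r; apply: (E0 (t k)); last exact: Xk.
  by apply/eqP => /(t_inj _ _ kd (ltn_ord i : (i <= d)%N)).
Qed.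

Variable f : {lrmorphism AA -> 'M[K]_d.+1}.
Hypothesis f_iso : algebra_iso f.
Variables (e : nat -> kmod V) (eps : nat -> {scalar (kmod V)}).
Variables (A As : AA) (th ths vph : nat -> K).
Hypothesis sb : split_basis d (act A) (act As) th ths vph e eps.
Hypothesis eX : forall X (j : 'I_d.+1), act X (e j) = \sum_(i < d.+1) f X i j *: e i.

Lemma faithful X : (forall v : kmod V, act X v = 0) -> X = 0.
Proof.
move=> X0; apply: (bij_inj f_iso); rewrite linear0; apply/matrixP => i j.
rewrite mxE; have := congr1 (eps i) (eX X j); rewrite X0 linear0 linear_sum (bigD1 i) //=.
rewrite scalarZ (sb_dual sb) -1?ltnS // eqxx mulr1 big1 ?addr0 // => k ki.
rewrite scalarZ (sb_dual sb) -1?ltnS //.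
by rewrite eq_sym (negPf (ki : k != i :> nat)) mulr0.
Qed.

Variables (u : nat -> kmod V).
Hypothesis th_inj : inj_upto d th.
Hypothesis ua : forall k, (k <= d)%N -> act A (u k) = th k *: u k.
Hypothesis u0 : forall k, (k <= d)%N -> u k != 0.

(** If vph_{i+1} = 0 then the span of e_{i+1}, .., e_d is invariant under star.
    It contains u_{i+1} and is killed by the idempotent F of u_i, so F As G = 0. *)
Lemma split_vph_neq0 (F G : AA) i : (i < d)%N ->
  (forall k, (k <= d)%N -> act F (u k) = (k == i)%:R *: u k) ->
  (forall k, (k <= d)%N -> act G (u k) = (k == i.+1)%:R *: u k) ->
  F * As * G <> 0 -> vph i.+1 != 0.
Proof.
move=> id Fu Gu FG0; apply/negP => /eqP v0; apply: FG0; apply: faithful => v.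
have sub0 X : subspace (fun v : kmod V => act X v = 0).
  by split=> [|c x y Hx Hy]; rewrite ?linear0 // linearP /= Hx Hy scaler0 addr0.
apply: (span_u sb th_inj ua u0 (sub0 _)) => k kd; rewrite !actM Gu //.
have [->|ki] := eqVneq k i.+1; last by rewrite scale0r !linear0.
rewrite scale1r -actM.
have Fe l : (i < l <= d)%N -> act F (e l) = 0.
  move=> /andP[il ld]; apply: (flag_e sb th_inj ua u0 (sub0 F)) => // n /andP[ln nd].
  by rewrite Fu // gtn_eqF ?scale0r //; lia.
apply: (flag_u sb th_inj ua (sub0 _)) => // -[|l] /andP[il ld]; first by lia.
rewrite actM (sb_asS sb) // linearD !linearZ_LR /= Fe ?il // scaler0 add0r.
case: (ltnP i l) => h; first by rewrite Fe ?scaler0 //; lia.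
by rewrite (_ : l = i) ?v0 ?scale0r //; lia.
Qed.

Variable E : 'I_d.+1 -> AA.
Hypothesis Eu : forall (i : 'I_d.+1) k, (k <= d)%N -> act (E i) (u k) = (k == i)%:R *: u k.
Hypothesis tri : forall i j, (1 < gap i j)%N -> E i * As * E j = 0.
Hypothesis ths_inj : inj_upto d ths.

(** The eigenvalues p_k of P are chosen such that the commutator relation of
    [tri_relations] holds between neighbouring eigenspaces; between the others
    both sides vanish because As is tridiagonal there. *)
Lemma leonard_tri : exists c, forall j, (j.+3 <= d)%N ->
  ths j.+1 - ths j.+2 = c * (ths j - ths j.+3) /\
  th j.+1 - th j.+2 = c * (th j - th j.+3).
Proof.
pose p := fix p k := if k is l.+1 then p l - th l * th l.+1 * (th l - th l.+1) else 0.
pose P := \sum_k p (k : 'I_d.+1) *: E k.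
have Pu k : (k <= d)%N -> act P (u k) = p k *: u k.
  move=> kd; rewrite /P act_sum (bigD1 (Ordinal (kd : (k < d.+1)%N))) //= actZ Eu //.
  rewrite eqxx scale1r big1 ?addr0 // => i ik.
  by rewrite actZ Eu // eq_sym (negPf (ik : i != k :> nat)) scale0r scaler0.
have spn Q := span_u sb th_inj ua u0 (Q := Q).
have sumE (v : kmod V) : v = \sum_k act (E k) v.
  move: v; refine (spn (fun v => v = \sum_k act (E k) v) _ _).
    split=> [|c x y Hx Hy]; first by rewrite big1 // => k _; rewrite linear0.
    rewrite {1}Hx {1}Hy scaler_sumr -big_split; apply: eq_bigr => k _.
    by rewrite linearP.
  move=> k kd; rewrite (bigD1 (Ordinal (kd : (k < d.+1)%N))) //= Eu // eqxx scale1r.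
  rewrite big1 ?addr0 // => i ik.
  by rewrite Eu // eq_sym (negPf (ik : i != k :> nat)) scale0r.
have AE j (v : kmod V) : act A (act (E j) v) = th j *: act (E j) v.
  move: v; refine (spn (fun v => act A (act (E j) v) = th j *: act (E j) v) _ _).
    split=> [|c x y Hx Hy]; first by rewrite !linear0 ?scaler0.
    by rewrite !linearP /= Hx Hy.
  move=> k kd; rewrite Eu // [act A _]linearZ_LR /= ua //.
  by have [->|] := eqVneq k j; rewrite ?scale1r ?scale0r ?scaler0.
have PE j (v : kmod V) : act P (act (E j) v) = p j *: act (E j) v.
  move: v; refine (spn (fun v => act P (act (E j) v) = p j *: act (E j) v) _ _).
    split=> [|c x y Hx Hy]; first by rewrite !linear0 ?scaler0.
    by rewrite !linearP /= Hx Hy.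
  move=> k kd; rewrite Eu // [act P _]linearZ_LR /= Pu //.
  by have [->|] := eqVneq k j; rewrite ?scale1r ?scale0r ?scaler0.
apply: (tri_relations sb th_inj ths_inj ua u0 (P := act P) (p := p) Pu).
  by move=> k kd /=; rewrite opprB addrCA subrr addr0.
have [N NE] : exists N : {linear (kmod V) -> (kmod V)}, forall v, N v =
    (act P (act As v) - act As (act P v)) -
    (act A (act A (act As (act A v))) - act A (act As (act A (act A v)))).
  exists (((act P \o act As) \- (act As \o act P)) \-
    ((act A \o (act A \o (act As \o act A))) \- (act A \o (act As \o (act A \o act A))))).
  by move=> v.
move=> v; apply/eqP; rewrite -subr_eq0 -NE; apply/eqP; move: v.
apply: spn => [|l ld].
  by split=> [|c x y Hx Hy]; rewrite ?linear0 // linearP /= Hx Hy scaler0 addr0.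
pose x := act As (u l); pose l' := Ordinal (ld : (l < d.+1)%N).
have aZ X c v : act X (c *: v) = c *: act X v by exact: linearZ_LR.
have asum X (F : 'I_d.+1 -> kmod V) : act X (\sum_i F i) = \sum_i act X (F i).
  exact: linear_sum.
rewrite NE Pu // ua // !aZ ua // !aZ -/x.
have xE := sumE x.
have PxE : act P x = \sum_j p (j : 'I_d.+1) *: act (E j) x.
  by rewrite {1}xE asum; apply: eq_bigr => j _; rewrite PE.
have AxE : act A x = \sum_(j < d.+1) th j *: act (E j) x.
  by rewrite {1}xE asum; apply: eq_bigr => j _; rewrite AE.
have AAxE : act A (act A x) = \sum_(j < d.+1) (th j * th j) *: act (E j) x.
  by rewrite {1}AxE asum; apply: eq_bigr => j _; rewrite aZ AE scalerA.
rewrite PxE AAxE AxE {2}xE !scaler_sumr -!sumrB big1 // => j _.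
rewrite !scalerA -!scalerBl.
have [gap_jl|gap_jl] := ltnP 1 (gap j l').
  suff -> : act (E j) x = 0 by rewrite scaler0.
  have := congr1 (fun X => act X (u l)) (tri gap_jl).
  by rewrite !actM Eu // eqxx scale1r => ->; rewrite /act scale0r.
suff -> : p j - p l - (th l * (th j * th j) - th l * th l * th j) = 0 by rewrite scale0r.
have pS k : p k.+1 = p k - th k * th k.+1 * (th k - th k.+1) by [].
rewrite /gap /= in gap_jl.
have [->|[->|lj]] : j = l :> nat \/ j = l.+1 :> nat \/ l = j.+1 by lia.
- by ring.
- by rewrite pS; ring.
- by rewrite lj pS; ring.
Qed.

End Model.

(** * The characterisation of descendents *)

(** The split bases exist because the algebra acts on V by all matrices; the
    nonvanishing of vph and phi comes from the tridiagonal condition on the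
    system and on its second inversion. *)
Lemma leonard_modelP (K : fieldType) (d : nat) (AA : algType K) (V : lmodType AA)
    (Phi : leonard_data d AA) (p : parray K) :
  leonard_system V Phi -> parameter_array V Phi p ->
  exists (e e2 b u : nat -> kmod V) (eps eps2 : nat -> {scalar (kmod V)}),
  [/\ leonard_model d (act (ls_A Phi)) (act (ls_As Phi)) p e e2 b u eps eps2,
      forall (i : 'I_d.+1) k, (k <= d)%N ->
        act (ls_E Phi i) (u k) = (k == i)%:R *: u k,
      forall (i : 'I_d.+1) k, (k <= d)%N ->
        act (ls_Es Phi i) (b k) = (k == i)%:R *: b k &
      leonard_relations d (theta p) (thetas p) (vphi p) (phi p)].
Proof.
case: Phi => A As E Es [[d0 _] irr [mfA mfAs] _ axiom] [[/= EP EsP [f [f_iso fA fAs]]]].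
case=> /= _ _ [f2 [f2_iso f2A f2As]].
have [e [eps [sb eX]]] := split_basis_of_iso f_iso irr fA fAs.
have [e2' [eps2' [sb2' eX2]]] := split_basis_of_iso f2_iso irr f2A f2As.
have th_inj : inj_upto d (theta p).
  by apply: (eigenvalues_inj (X := A)) mfA => v t; apply: (eigen_a_val sb).
have ths_inj : inj_upto d (thetas p).
  by apply: (eigenvalues_inj (X := As)) mfAs => v t; apply: (eigen_as_val sb).
have [u [ua u0 Eu]] := eigenvectors th_inj EP.
have [b' [bs' b0' Eb']] := eigenvectors ths_inj EsP.
(* both split bases start in the same eigenspace of A^* *)
have s0 : eps 0 (e2' 0%N) != 0.
  apply: (eigen_star_lead sb ths_inj) => //; first exact: (sb_as0 sb2').
  apply/eqP => e20; have := sb_dual sb2' 0 (leq0n d); rewrite e20 linear0 /= => /eqP.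
  by rewrite eq_sym oner_eq0.
have e20 : e2' 0%N = eps 0 (e2' 0%N) *: e 0%N.
  rewrite {1}(sb_exp sb (e2' 0%N)) big_ord_recl /= big1 ?addr0 // => i _.
  by rewrite (eigen_star_low sb ths_inj (leq0n d) (sb_as0 sb2')) ?scale0r.
have [|eps2 sb2] := split_basis_scale (c := (eps 0 (e2' 0%N))^-1) _ sb2'.
  by rewrite invr_eq0.
set e2 := fun i => _ *: e2' i in sb2.
have e2e : e2 0%N = e 0%N by rewrite /e2 {2}e20 scalerA mulVf // scale1r.
pose b k := (eps k (b' k))^-1 *: b' k.
have tri i j : (1 < gap i j)%N -> E i * As * E j = 0 by case: (axiom i j).
have trn i j : gap i j = 1%N -> E i * As * E j <> 0 by case: (axiom i j).
have vph0 i : (0 < i <= d)%N -> vphi p i != 0.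
  case: i => // i id.
  have i1 : (i < d.+1)%N by lia.
  have i2 : (i.+1 < d.+1)%N by lia.
  apply: (split_vph_neq0 f_iso sb eX th_inj ua u0 (F := E (Ordinal i1))
    (G := E (Ordinal i2))) => //.
  - by move=> k kd; rewrite Eu.
  - by move=> k kd; rewrite Eu.
  - by apply: trn; rewrite /gap /=; lia.
have ph0 i : (0 < i <= d)%N -> phi p i != 0.
  case: i => // i id.
  have i1 : (i < d.+1)%N by lia.
  have i2 : (i.+1 < d.+1)%N by lia.
  have kk k m : (k <= d)%N -> (m <= d)%N -> ((d - k == d - m) = (k == m))%N.
    by move=> kd md; apply/eqP/eqP; lia.
  apply: (split_vph_neq0 f2_iso sb2' eX2 (inj_rev th_inj) (u := fun k => u (d - k)%N)
    (fun k _ => ua _ (leq_subr k d)) (fun k _ => u0 _ (leq_subr k d)) (F := E (rev_ord (Ordinal i1))) (G := E (rev_ord (Ordinal i2)))) => //.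
  - by move=> k kd; rewrite Eu ?leq_subr //= !subSS kk //; lia.
  - by move=> k kd; rewrite Eu ?leq_subr //= !subSS kk //; lia.
  - by apply: trn; rewrite /gap /=; lia.
exists e, e2, b, u, eps, eps2; split=> //=.
- split=> //.
  + by move=> k kd; rewrite /b linearZ_LR /= bs' // !scalerA mulrC.
  + move=> k kd; rewrite /b scalarZ mulVf //.
    by apply: (eigen_star_lead sb ths_inj kd); [apply: bs' | apply: b0'].
- by move=> i k kd; rewrite /b linearZ_LR /= Eb' // !scalerA mulrC.
- split=> //.
  + exact: (splits_sum sb sb2 e2e).
  + have [|S [S1 SS] SP] := splits_S sb sb2 e2e d0.
      move=> h hd; apply/eqP => /th_inj H; have := H (leq0n d) (leq_subr _ _); lia.
    exists S => //; split=> // i /andP[i0 id].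
    have -> : (d - i).+1 = (d - i.-1)%N by lia.
    by apply: SS; rewrite i0 id.
  + exact: (leonard_tri sb th_inj ua u0 Eu tri ths_inj).
Qed.

(** The image of each idempotent is the line spanned by the corresponding
    eigenvector, so the balanced forms are those of [balanced_model]. *)
Theorem descendentP (K : fieldType) (d d' rho : nat) (AA AA' : algType K)
    (V : lmodType AA) (V' : lmodType AA') (Phi : leonard_data d AA)
    (Phi' : leonard_data d' AA') (p p' : parray K) :
  (0 < d')%N -> (rho + d' <= d)%N ->
  leonard_system V Phi -> leonard_system V' Phi' ->
  parameter_array V Phi p -> parameter_array V' Phi' p' ->
  rho_descendent V V' rho Phi Phi' <->
  descent_condition d' rho (thetas p) (vphi p) (phi p) (thetas p') (vphi p') (phi p').
Proof.
move=> d0' rd HPhi HPhi' Hp Hp'.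
have [e [e2 [b [u [eps [eps2 [lm Eu Eb _]]]]]]] := leonard_modelP HPhi Hp.
have [e' [e2' [b' [u' [eps' [eps2' [lm' Eu' Eb' _]]]]]]] := leonard_modelP HPhi' Hp'.
split=> [[B [Bbi [x [y B0]] _ Bs BE]]|H].
  apply: (balanced_necessary lm lm' d0' rd (B := B)); split=> //.
  - by exists x, y.
  - move=> i j id jd ij.
    have := Bs (Ordinal (id : (i < d.+1)%N)) (Ordinal (jd : (j < d'.+1)%N)) ij (b i) (b' j).
    have := Eb (Ordinal (id : (i < d.+1)%N)) i id.
    have := Eb' (Ordinal (jd : (j < d'.+1)%N)) j jd.
    by rewrite /act /= !eqxx !scale1r => -> ->.
  - move=> i j id jd ij.
    have := BE (Ordinal (id : (i < d.+1)%N)) (Ordinal (jd : (j < d'.+1)%N)) ij (u i) (u' j).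
    have := Eu (Ordinal (id : (i < d.+1)%N)) i id.
    have := Eu' (Ordinal (jd : (j < d'.+1)%N)) j jd.
    by rewrite /act /= !eqxx !scale1r => -> ->.
have [B [Bbi [x [y B0]] Bb Bu]] := balanced_sufficient lm lm' d0' rd H.
have line (n : nat) (BB : algType K) (W : lmodType BB) (w : nat -> kmod W) (F : BB) (i : 'I_n.+1) :
    (forall Q : kmod W -> Prop, subspace Q -> (forall k, (k <= n)%N -> Q (w k)) ->
       forall v, Q v) ->
    (forall k, (k <= n)%N -> act F (w k) = (k == i)%:R *: w k) ->
    forall v, exists c : K, act F v = c *: w i.
  move=> spn Fw; apply: spn.
    split=> [|c v1 v2 [c1 E1] [c2 E2]]; first by exists 0; rewrite linear0 scale0r.
    by exists (c * c1 + c2); rewrite linearP /= E1 E2 scalerDl scalerA.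
  move=> k kd; rewrite Fw //; have [->|_] := eqVneq k i; first by exists 1.
  by exists 0; rewrite !scale0r.
exists B; split=> //; first by exists x, y.
- move=> i j ij v w.
  have id : (i <= d)%N by rewrite -ltnS.
  have jd : (j <= d')%N by rewrite -ltnS.
  have [c Ec] := line _ _ _ _ _ i (fun Q => span_b (lm_sb lm) (lm_ths lm) (lm_b lm) (lm_b1 lm) (Q := Q)) (Eb i) v.
  have [c' Ec'] := line _ _ _ _ _ j (fun Q => span_b (lm_sb lm') (lm_ths lm') (lm_b lm') (lm_b1 lm') (Q := Q)) (Eb' j) w.
  change (B (act (ls_Es Phi i) v) (act (ls_Es Phi' j) w) = 0).
  by rewrite Ec Ec' (biform_lZ Bbi) (biform_rZ Bbi) Bb // !mulr0.
- move=> i j ij v w.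
  have id : (i <= d)%N by rewrite -ltnS.
  have jd : (j <= d')%N by rewrite -ltnS.
  have [c Ec] := line _ _ _ _ _ i (fun Q => span_u (lm_sb lm) (lm_th lm) (lm_u lm) (lm_u0 lm) (Q := Q)) (Eu i) v.
  have [c' Ec'] := line _ _ _ _ _ j (fun Q => span_u (lm_sb lm') (lm_th lm') (lm_u lm') (lm_u0 lm') (Q := Q)) (Eu' j) w.
  change (B (act (ls_E Phi i) v) (act (ls_E Phi' j) w) = 0).
  by rewrite Ec Ec' (biform_lZ Bbi) (biform_rZ Bbi) Bu // !mulr0.
Qed.

(** * Parameter arrays are determined by partial data *)

Section Transport.
Variables (K L : fieldType) (iota : {rmorphism K -> L}).

Lemma relations_map d th ths vph ph : leonard_relations d th ths vph ph ->
  leonard_relations d (iota \o th) (iota \o ths) (iota \o vph) (iota \o ph).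
Proof.
case=> th_inj ths_inj v0 p0 sum [S [S1 SS] SP] [c tri]; split=> /=.
- by move=> i j id jd /fmorph_inj /th_inj; apply.
- by move=> i j id jd /fmorph_inj /ths_inj; apply.
- by move=> i id; rewrite /= fmorph_eq0 v0.
- by move=> i id; rewrite /= fmorph_eq0 p0.
- move=> i id; have := congr1 iota (sum i id).
  rewrite !(rmorphM, rmorphB, rmorph_sum) /= => ->; congr (_ * _).
  by apply: eq_bigr => h _; exact: rmorphB.
- exists (iota \o S) => [|i id] /=.
    split=> [|i id]; first by rewrite S1 rmorph1.
    by have := congr1 iota (SS i id); rewrite !(rmorphB, rmorphD, rmorphM) /=.
  by have := congr1 iota (SP i id); rewrite !(rmorphB, rmorphD, rmorphM) /=.
- exists (iota c) => j jd; have [t1 t2] := tri j jd.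
  have := congr1 iota t1; have := congr1 iota t2.
  by rewrite !(rmorphM, rmorphB) /=.
Qed.

Lemma descent_condition_map d rho (ths vph ph ths' vph' ph' : nat -> K) :
  descent_condition d rho ths vph ph ths' vph' ph' <->
  descent_condition d rho (iota \o ths) (iota \o vph) (iota \o ph)
    (iota \o ths') (iota \o vph') (iota \o ph').
Proof.
split=> -[H1 H2]; split=> k kd /=.
- by have := congr1 iota (H1 k kd); rewrite !(rmorphM, rmorphB) /=.
- by have := congr1 iota (H2 k kd); rewrite !rmorphM /=.
- by apply: (fmorph_inj iota); rewrite !(rmorphM, rmorphB); apply: H1.
- by apply: (fmorph_inj iota); rewrite !rmorphM; apply: H2.
Qed.
End Transport.

(** An array satisfying the relations is compared with a candidate that has the
    same dual eigenvalues, the same quotients phi_i / vphi_i, and the same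
    eigenvalues at the two ends. *)
Section Uniqueness.
Variables (F : fieldType) (d : nat) (th ths vph ph th2 vph2 ph2 : nat -> F).
Hypothesis d0 : (0 < d)%N.
Hypothesis rel : leonard_relations d th ths vph ph.
Hypothesis ratio : forall i, (0 < i <= d)%N -> ph i * vph2 i = vph i * ph2 i.
Hypothesis th_0 : th 0%N = th2 0%N.
Hypothesis th_d : th d = th2 d.

(** The difference and the quotient of two numbers determine them when the
    quotient is not 1. *)
Lemma same_by_ratio i : (0 < i <= d)%N -> vph i - ph i = vph2 i - ph2 i ->
  vph2 i != ph2 i -> vph i = vph2 i /\ ph i = ph2 i.
Proof.
move=> id E neq; have R := ratio id.
have n0 : vph2 i - ph2 i != 0 by rewrite subr_eq0.
have v : vph i = vph2 i.
  by apply: (mulIf n0); rewrite mulrBr -R -mulrBl E mulrC.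
by split=> //; move: E; rewrite v => /(addrI _)/oppr_inj.
Qed.

Lemma difference_0d : th 0%N - th d != 0.
Proof.
by rewrite subr_eq0; apply/eqP => h; have := lr_th rel (leq0n d) (leqnn d) h; lia.
Qed.

(** A deviation th - th2 that is symmetric under i -> d - i does not change the
    sums in [lr_sum]. So the differences vphi_i - phi_i are those of the
    candidate, and together with the quotients they determine vphi_i and phi_i.
    The formula for phi_2 then determines th_{d-1}, which is enough when th - th2
    lies in a suitable three-parameter family. *)
Lemma regular_uniqueness :
  (forall i, (i < d)%N -> vph2 i.+1 - ph2 i.+1 =
    (ths i.+1 - ths i) * \sum_(h < i.+1) (th2 h - th2 (d - h)%N)) ->
  ((1 < d)%N -> ph2 2%N * (th2 0%N - th2 d) =
     vph2 1%N * ((th2 1%N - th2 d.-1) + (th2 0%N - th2 d)) +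
     (ths 2%N - ths 0%N) * (th2 d.-1 - th2 0%N) * (th2 0%N - th2 d)) ->
  (forall i, (0 < i <= d)%N -> vph2 i != ph2 i) ->
  ((1 < d)%N -> (forall i, (i <= d)%N -> th i - th2 i = th (d - i)%N - th2 (d - i)%N) /\
    (th d.-1 - th2 d.-1 = 0 -> forall i, (i <= d)%N -> th i - th2 i = 0)) ->
  (forall i, (i <= d)%N -> th i = th2 i) /\
  (forall i, (0 < i <= d)%N -> vph i = vph2 i /\ ph i = ph2 i).
Proof.
move=> C1 C2 C3 H.
have sym i : (i <= d)%N -> th i - th2 i = th (d - i)%N - th2 (d - i)%N.
  move=> id; case: (ltnP 1 d) => d1; first exact: (proj1 (H d1)).
  have [->|->] : i = 0%N \/ i = d by lia.
    by rewrite subn0 th_0 th_d !subrr.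
  by rewrite subnn th_0 th_d !subrr.
have eqv i : (0 < i <= d)%N -> vph i = vph2 i /\ ph i = ph2 i.
  case: i => // i id; apply: same_by_ratio => //; last exact: C3.
  rewrite (lr_sum rel) // C1 //; congr (_ * _); apply: eq_bigr => h _.
  have hd : (h <= d)%N by move: (ltn_ord h); lia.
  have := sym h hd; set x := th h; set y := th (d - h)%N; set z := th2 h.
  by move/eqP; rewrite subr_eq => /eqP ->; ring.
split=> // i id; apply/eqP; rewrite -subr_eq0; apply/eqP.
case: (ltnP 1 d) => d1; last first.
  have [->|->] : i = 0%N \/ i = d by lia.
    by rewrite th_0 subrr.
  by rewrite th_d subrr.
apply: (proj2 (H d1)) id; have {}C2 := C2 d1.
have [S [S1 SS] SP] := lr_S rel.
have P2 := SP 1%N d1; have S2 := SS 1%N d1.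
have [v1 _] := eqv 1%N ltac:(lia); have [_ p2] := eqv 2%N ltac:(lia).
rewrite S1 mulr1 subn1 prednK // in S2; rewrite subn1 in P2.
have sd := difference_0d.
have n0 : ths 2%N - ths 0%N != 0.
  by rewrite subr_eq0; apply/eqP => h; have := lr_ths rel d1 (leq0n d) h.
have sym1 := sym 1%N d0; rewrite subn1 in sym1.
have e1 : th 1%N - th d.-1 = th2 1%N - th2 d.-1.
  by move/eqP: sym1; rewrite subr_eq => /eqP ->; ring.
apply: (mulIf sd); apply: (mulfI n0).
transitivity ((ths 2%N - ths 0%N) * (th d.-1 - th 0%N) * (th 0%N - th d) -
   (ths 2%N - ths 0%N) * (th2 d.-1 - th2 0%N) * (th2 0%N - th2 d)).
  by rewrite th_0 th_d; ring.
have -> : (ths 2%N - ths 0%N) * (th d.-1 - th 0%N) * (th 0%N - th d) =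
   ph 2%N * (th 0%N - th d) - vph 1%N * (S 2%N * (th 0%N - th d)).
  by rewrite P2; ring.
have -> : (ths 2%N - ths 0%N) * (th2 d.-1 - th2 0%N) * (th2 0%N - th2 d) =
  ph2 2%N * (th2 0%N - th2 d) -
  vph2 1%N * ((th2 1%N - th2 d.-1) + (th2 0%N - th2 d)) by rewrite C2; ring.
by rewrite S2 p2 v1 e1 th_0 th_d; ring.
Qed.

(** Here vphi_i = phi_i for even i, so that i = 2 gives no information. The
    first informative index beyond 1 is i = 3, which determines th_{d-2}; the
    entries with even index then follow from the formula for phi_i. *)
Lemma irregular_uniqueness : odd d ->
  (forall i, (i < d)%N ->
     \sum_(h < i.+1) (th h - th (d - h)%N) = (~~ odd i)%:R * (th 0%N - th d)) ->
  (forall S : nat -> F, S 1%N = 1 -> (forall i, (0 < i < d)%N ->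
      S i.+1 * (th 0%N - th (d - i).+1) =
        (th 1%N - th (d - i)%N) * S i + (th 0%N - th (d - i).+1)) ->
    forall i, (i < d)%N -> S i.+1 = (~~ odd i)%:R) ->
  (forall i, (i < d)%N -> vph2 i.+1 - ph2 i.+1 =
    (ths i.+1 - ths i) * ((~~ odd i)%:R * (th2 0%N - th2 d))) ->
  (forall i, (i < d)%N -> ph2 i.+1 = vph2 1%N * (~~ odd i)%:R +
    (ths i.+1 - ths 0%N) * (th2 (d - i)%N - th2 0%N)) ->
  ((1 < d)%N -> th (d - 2)%N - th2 (d - 2)%N = 0 -> forall i, (i <= d)%N -> th i - th2 i = 0) ->
  (forall i, (i <= d)%N -> th i = th2 i) /\
  (forall i, (0 < i <= d)%N -> vph i = vph2 i /\ ph i = ph2 i).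
Proof.
move=> od tE SE C1 C2 H.
have [S [S1 SS] SP] := lr_S rel; have {SS}SE := SE S S1 SS.
have D i : (i < d)%N -> vph i.+1 - ph i.+1 = vph2 i.+1 - ph2 i.+1.
  by move=> id; rewrite (lr_sum rel) // tE // C1 // th_0 th_d.
have eqo i : (i < d)%N -> ~~ odd i -> vph i.+1 = vph2 i.+1 /\ ph i.+1 = ph2 i.+1.
  move=> id oi; apply: same_by_ratio => //; first exact: D.
  rewrite -subr_eq0 C1 // oi mul1r mulf_neq0 //; last by rewrite -th_0 -th_d difference_0d.
  rewrite subr_eq0; apply/eqP => h.
  by have := lr_ths rel (ltac:(lia) : (i.+1 <= d)%N) (ltac:(lia) : (i <= d)%N) h; lia.
have [v1 _] := eqo 0%N d0 isT.
have thE i : (i <= d)%N -> th i = th2 i.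
  move=> id; apply/eqP; rewrite -subr_eq0; apply/eqP.
  case: (ltnP 1 d) => d1; last first.
    have [->|->] : i = 0%N \/ i = d by lia.
      by rewrite th_0 subrr.
    by rewrite th_d subrr.
  apply: (H d1) id.
  have d2 : (2 < d)%N by case: (d) d1 od => [|[|[|]]].
  have [_ p3] := eqo 2%N d2 isT.
  have := SP 2%N d2; rewrite SE // p3 C2 // v1 => /(addrI _) E.
  have n0 : ths 3%N - ths 0%N != 0.
    by rewrite subr_eq0; apply/eqP => h; have := lr_ths rel d2 (leq0n d) h.
  by have := mulfI n0 E; rewrite th_0 => /(addIr _) ->; rewrite subrr.
split=> // -[//|i] /andP[_ id].
have p : ph i.+1 = ph2 i.+1.
  by rewrite SP // SE // C2 // v1 !thE //; lia.
split=> //; have := D i id; rewrite p; exact: addIr.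
Qed.

End Uniqueness.

(** The three-term relation has a three-dimensional solution space. Its constant
    is the same for both eigenvalue sequences, so if the dual eigenvalues lie in
    the span of 1, g1 and g2, so do the eigenvalues. *)
Lemma family_of_relations (F : fieldType) d (g1 g2 th ths vph ph : nat -> F) :
  leonard_relations d th ths vph ph -> (1 < d)%N ->
  ((2 < d)%N -> exists c, forall j,
     g1 j.+1 - g1 j.+2 = c * (g1 j - g1 j.+3) /\
     g2 j.+1 - g2 j.+2 = c * (g2 j - g2 j.+3)) ->
  (g1 1%N - g1 0%N) * (g2 2%N - g2 0%N) - (g1 2%N - g1 0%N) * (g2 1%N - g2 0%N) != 0 ->
  (exists a b c, forall i, (i <= d)%N -> ths i = a + b * g1 i + c * g2 i) ->
  exists a b c, forall i, (i <= d)%N -> th i = a + b * g1 i + c * g2 i.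
Proof.
move=> rel d1 grec D0 [x [y [z thsE]]].
set D := _ - _ in D0.
pose b := ((th 1%N - th 0%N) * (g2 2%N - g2 0%N) - (th 2%N - th 0%N) * (g2 1%N - g2 0%N)) / D.
pose c := ((th 2%N - th 0%N) * (g1 1%N - g1 0%N) - (th 1%N - th 0%N) * (g1 2%N - g1 0%N)) / D.
exists (th 0%N - b * g1 0%N - c * g2 0%N), b, c.
have [H0 H1 H2] : let P i := th i = th 0%N - b * g1 0%N - c * g2 0%N + b * g1 i + c * g2 i in
    [/\ P 0%N, P 1%N & P 2%N].
  by split; rewrite /b /c /D; field; exact: D0.
case: (ltnP 2 d) => d2; last first.
  by move=> [|[|[|i]]] id //; lia.
have [k krec] := grec d2; have [m mrec] := lr_tri rel.
have mk : m = k.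
  have [E _] := mrec 0%N d2.
  have n0 : ths 0%N - ths 3%N != 0.
    by rewrite subr_eq0; apply/eqP => h; have := lr_ths rel (leq0n d) d2 h.
  apply: (mulIf n0); rewrite -E !thsE //; try lia.
  have [k1 k2] := krec 0%N.
  transitivity (y * (g1 1%N - g1 2%N) + z * (g2 1%N - g2 2%N)); first by ring.
  by rewrite k1 k2; ring.
have k0 : k != 0.
  have [E _] := mrec 0%N d2; apply: contra_eq_neq E; rewrite mk => ->.
  rewrite mul0r subr_eq0; apply/eqP => h.
  by have := lr_ths rel (ltac:(lia) : (1 <= d)%N) (ltac:(lia) : (2 <= d)%N) h.
elim/ltn_ind=> -[|[|[|i]]] IH id //.
have E i' : (i' < i.+3)%N -> th i' = th 0%N - b * g1 0%N - c * g2 0%N + b * g1 i' + c * g2 i'.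
  by move=> h; apply: IH => //; lia.
have [_ E3] := mrec i id; rewrite mk in E3; have [k1 k2] := krec i.
apply: (mulfI k0).
have -> : k * th i.+3 = k * th i - k * (th i - th i.+3) by ring.
rewrite -E3 (E i.+2) ?(E i.+1) ?(E i) ?ltnS ?leqnSn //; try lia.
have -> : k * (th 0%N - b * g1 0%N - c * g2 0%N + b * g1 i.+3 + c * g2 i.+3) =
  k * (th 0%N - b * g1 0%N - c * g2 0%N) + k * b * g1 i + k * c * g2 i -
  (b * (k * (g1 i - g1 i.+3)) + c * (k * (g2 i - g2 i.+3))) by ring.
by rewrite -k1 -k2; ring.
Qed.

(** * The q-Racah family *)

Section QArrays.
Variables (F : fieldType) (q : F).
Hypothesis q0 : q != 0.

(** The families I and IA in one normal form: theta_i is a combination of 1, q^i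
    and q^{-i}, and k replaces the remaining free parameter of vphi. Family I is
    b = h s q, c = h, b^* = h^* s^* q, c^* = h^*, k = - h h^* (r_1 + r_2); family IA
    is the degeneration c = b^* = 0. Passing from vphi to phi amounts to
    reversing the order of the theta_i. *)
Definition q_theta (b c t0 : F) (i : nat) : F :=
  t0 + b * (q ^+ i - 1) + c * ((q ^+ i)^-1 - 1).
Definition q_vphi (b c bs cs k : F) (d i : nat) : F :=
  - (1 - q ^+ i) * (1 - q ^+ d.+1 / q ^+ i) / q ^+ d *
    (c * cs / q ^+ i + k + b * bs * q ^+ d / q * q ^+ i).
Definition q_phi (b c bs cs k : F) (d i : nat) : F :=
  - (1 - q ^+ i) * (1 - q ^+ d.+1 / q ^+ i) / q ^+ d *
    (b * cs * q ^+ d / q ^+ i + k + c * bs / q * q ^+ i).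

Definition q_array (b c bs cs k : F) d (th ths vph ph : nat -> F) : Prop :=
  (forall i, (i <= d)%N ->
     th i = q_theta b c (th 0%N) i /\ ths i = q_theta bs cs (ths 0%N) i) /\
  (forall i, (0 < i <= d)%N ->
     vph i = q_vphi b c bs cs k d i /\ ph i = q_phi b c bs cs k d i).

Let qn0 n : q ^+ n != 0. Proof. by rewrite expf_neq0. Qed.

Lemma q_subn m n : (n <= m)%N -> q ^+ (m - n) = q ^+ m / q ^+ n.
Proof. by move=> nm; rewrite expfB_cond // (negPf q0). Qed.

Lemma q_sum b c t0 d i : (i <= d.+1)%N ->
  (1 - q) * \sum_(h < i) (q_theta b c t0 h - q_theta b c t0 (d - h)) =
  (b - c / q ^+ d) * (1 - q ^+ i) * (1 - q ^+ d.+1 / q ^+ i).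
Proof.
elim: i => [|i IH] id; first by rewrite big_ord0 expr0 mulr0 subrr mulr0 mul0r.
rewrite big_ord_recr /= mulrDr IH 1?ltnW // /q_theta (q_subn (_ : (i <= d)%N)) //.
rewrite !exprS; move: (qn0 i) (qn0 d); set x := q ^+ i; set D := q ^+ d => x0 D0.
by field; rewrite q0 x0 D0.
Qed.

(** With [q_identity2]: the closed form satisfies the relations that
    [regular_uniqueness] asks of a candidate. *)
Lemma q_identity b c t0 bs cs s0 k d i : (i < d)%N -> q != 1 ->
  q_vphi b c bs cs k d i.+1 - q_phi b c bs cs k d i.+1 =
  (q_theta bs cs s0 i.+1 - q_theta bs cs s0 i) *
    \sum_(h < i.+1) (q_theta b c t0 h - q_theta b c t0 (d - h)).
Proof.
move=> id q1; have q1' : 1 - q != 0 by rewrite subr_eq0 eq_sym.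
apply: (mulfI q1'); rewrite [RHS]mulrCA q_sum 1?ltnW // /q_vphi /q_phi /q_theta.
rewrite !exprS; move: (qn0 i) (qn0 d); set x := q ^+ i; set D := q ^+ d => x0 D0.
by field; rewrite q0 x0 D0.
Qed.

Lemma q_identity2 b c t0 bs cs s0 k d : (1 < d)%N ->
  let th := q_theta b c t0 in let ths := q_theta bs cs s0 in
  q_phi b c bs cs k d 2 * (th 0%N - th d) =
    q_vphi b c bs cs k d 1 * ((th 1%N - th d.-1) + (th 0%N - th d)) +
    (ths 2%N - ths 0%N) * (th d.-1 - th 0%N) * (th 0%N - th d).
Proof.
case: d => [//|d] d1 /=; rewrite /q_vphi /q_phi /q_theta.
rewrite !exprS expr0 !mulr1; move: (qn0 d); set D := q ^+ d => D0.
by field; rewrite q0 D0 oner_eq0.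
Qed.

Section Target.
Variables (d : nat) (th ths vph ph : nat -> F) (b c bs cs k : F).
Hypothesis d0 : (0 < d)%N.
Hypothesis qi : forall i, (0 < i <= d)%N -> q ^+ i != 1.
Hypothesis rel : leonard_relations d th ths vph ph.
Hypothesis thsE : forall i, (i <= d)%N -> ths i = q_theta bs cs (ths 0%N) i.
Hypothesis thD : th 0%N - th d = q_theta b c (th 0%N) 0 - q_theta b c (th 0%N) d.
Hypothesis ratio : forall i, (0 < i <= d)%N ->
  ph i * q_vphi b c bs cs k d i = vph i * q_phi b c bs cs k d i.

Let q_theta0 x y z : q_theta x y z 0 = z.
Proof. by rewrite /q_theta expr0 invr1 !subrr !mulr0 !addr0. Qed.
Let qi1 : q != 1.
Proof. by have := qi (ltac:(lia) : (0 < 1 <= d)%N); rewrite expr1. Qed.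

(** The deviation from the candidate is x + y q^i + z q^{-i} and vanishes at both
    ends. This forces y = z q^{-d}, hence the symmetry under i -> d - i; a further
    zero at d - 1 forces it to vanish, as q^{d-1} and q differ from 1. *)
Lemma q_target : q_array b c bs cs k d th ths vph ph.
Proof.
have D1 : 1 - q ^+ d != 0 by rewrite subr_eq0 eq_sym qi // d0 leqnn.
have q1 : 1 - q != 0 by rewrite subr_eq0 eq_sym.
have C1 i : (i < d)%N -> q_vphi b c bs cs k d i.+1 - q_phi b c bs cs k d i.+1 =
    (ths i.+1 - ths i) *
    \sum_(h < i.+1) (q_theta b c (th 0%N) h - q_theta b c (th 0%N) (d - h)).
  by move=> id; rewrite (thsE id) (thsE (ltnW id)) -(q_identity _ _ _ _ _ _ k).
have bc : b - c / q ^+ d != 0.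
  have := difference_0d d0 rel; rewrite thD /q_theta; apply: contra_neq => bc.
  have -> : b = c / q ^+ d by apply/eqP; rewrite -subr_eq0 bc.
  by rewrite expr0; field; rewrite ?qn0 ?q0 ?oner_eq0.
have [] := regular_uniqueness d0 rel ratio (th2 := q_theta b c (th 0%N)) _ _ C1.
- by rewrite q_theta0.
- by move: thD; rewrite q_theta0 => /(addrI _)/oppr_inj.
- by move=> d1; have := q_identity2 b c (th 0%N) bs cs (ths 0%N) k d1; rewrite /= (thsE d1) !q_theta0.
- move=> [//|i] id; rewrite -subr_eq0 C1 // mulf_neq0 //.
    rewrite subr_eq0; apply/eqP => h.
    by have := lr_ths rel (ltac:(lia) : (i.+1 <= d)%N) (ltac:(lia) : (i <= d)%N) h; lia.
  have := q_sum b c (th 0%N) (ltac:(lia) : (i.+1 <= d.+1)%N).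
  apply: contra_eq_neq => ->; rewrite mulr0 eq_sym !mulf_neq0 //.
    by rewrite subr_eq0 eq_sym qi.
  by rewrite -q_subn 1?subr_eq0 1?eq_sym ?qi //; lia.
- move=> d1.
  have [x [y [z thE]]] : exists x y z, forall i, (i <= d)%N ->
      th i = x + y * q ^+ i + z * (q ^+ i)^-1.
    apply: (family_of_relations rel d1).
    + move=> d2; have q31 : q ^+ 3 != 1 by apply: qi.
      have q3 : 1 + q + q ^+ 2 != 0.
        apply: contraNneq q31 => E; rewrite -subr_eq0.
        have -> : q ^+ 3 - 1 = (q - 1) * (1 + q + q ^+ 2) by ring.
        by rewrite E mulr0.
      exists (q / (1 + q + q ^+ 2)) => j; rewrite (exprS q j.+2) (exprS q j.+1) (exprS q j); move: (qn0 j).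
      by set X := q ^+ j => X0; split; field; rewrite ?q0 ?X0 ?q3.
    + have q2 : 1 - q ^+ 2 != 0 by rewrite subr_eq0 eq_sym qi.
      have -> : (q ^+ 1 - q ^+ 0) * ((q ^+ 2)^-1 - (q ^+ 0)^-1) -
        (q ^+ 2 - q ^+ 0) * ((q ^+ 1)^-1 - (q ^+ 0)^-1) =
        - (1 - q) * (1 - q) * (1 - q ^+ 2) / q ^+ 2 by field; rewrite q0 oner_eq0.
      by rewrite !mulf_neq0 ?oppr_eq0 ?invr_eq0 // expf_neq0.
    + exists (ths 0%N - bs - cs), bs, cs => i id; rewrite thsE // /q_theta.
      by field; rewrite ?qn0 ?q0 ?oner_eq0.
  pose x' := x - th 0%N + b + c; pose y' := y - b; pose z' := z - c.
  have dE i : (i <= d)%N -> th i - q_theta b c (th 0%N) i = x' + y' * q ^+ i + z' * (q ^+ i)^-1.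
    by move=> id; rewrite {1}thE // /q_theta /x' /y' /z'; ring.
  have e0 : x' + y' + z' = 0.
    by have := dE 0%N (leq0n d); rewrite q_theta0 subrr expr0 invr1 !mulr1.
  have ed : x' + y' * q ^+ d + z' / q ^+ d = 0.
    rewrite -dE //; move: thD; rewrite q_theta0 => /(addrI _)/oppr_inj ->.
    by rewrite subrr.
  have yz : y' = z' / q ^+ d.
    apply: (mulIf D1); apply/eqP; rewrite -subr_eq0; apply/eqP.
    rewrite -[RHS](subrr 0) -{1}e0 -ed; by field; rewrite ?qn0 ?q0 ?oner_eq0.
  split=> [i id|].
    rewrite !dE ?leq_subr // yz (q_subn id).
    by field; rewrite !qn0.
  have dd : (d.-1 <= d)%N by lia.
  rewrite dE // yz => E.
  have q1d : 1 - q ^+ d.-1 != 0 by rewrite subr_eq0 eq_sym qi //; lia.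
  have dS : q ^+ d = q * q ^+ d.-1 by rewrite -exprS prednK.
  have z0 : z' = 0.
    apply: (mulIf q1d); apply: (mulIf q1); rewrite !mul0r.
    move: e0 E; rewrite yz dS; move: (qn0 d.-1); set X := q ^+ d.-1 => X0 e0 E.
    transitivity ((x' + z' / (q * X) + z' - (x' + z' / (q * X) * X + z' / X)) * (q * X)).
      by field; rewrite q0 X0.
    by rewrite e0 E subrr mul0r.
  have y0 : y' = 0 by rewrite yz z0 mul0r.
  have x0 : x' = 0 by move: e0; rewrite y0 z0 !addr0.
  by move=> i id; rewrite dE // x0 y0 z0 !mul0r !addr0.
move=> thE vE; split=> i id; last exact: vE.
by split; [exact: thE | exact: thsE].
Qed.

End Target.

Section Source.
Variables (d d' rho : nat) (th ths vph ph th' ths' vph' ph' : nat -> F) (b c bs cs k : F).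
Hypothesis d0' : (0 < d')%N.
Hypothesis rd : (rho + d' <= d)%N.
Hypothesis rel : leonard_relations d th ths vph ph.
Hypothesis rel' : leonard_relations d' th' ths' vph' ph'.
Hypothesis arr : q_array b c bs cs k d th ths vph ph.

Lemma q_pow_neq1 i : (0 < i <= d)%N -> q ^+ i != 1.
Proof.
move=> /andP[i0 id]; apply/eqP => qi; have [H _] := arr; have [E _] := H i id.
move: E; rewrite /q_theta qi invr1 !subrr !mulr0 !addr0.
by move/(lr_th rel id (leq0n d)); lia.
Qed.

(** Shifting by rho multiplies the coefficients of q^i and q^{-i} in theta^* by
    q^rho and q^{-rho}. The quotient phi_i / vphi_i of the target must be that at
    i + rho of the source, which fixes b', c' and k' up to a common factor. *)
Lemma q_descent : descent_condition d' rho ths vph ph ths' vph' ph' <->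
  exists eta xi, q_array (eta * b * q ^+ (d - d')) (eta * c)
    (xi * bs * q ^+ rho) (xi * cs / q ^+ rho) (eta * xi * k) d' th' ths' vph' ph'.
Proof.
have dd : (d' <= d)%N by lia.
have [HT HV] := arr.
have qr i : q ^+ (i + rho) = q ^+ i * q ^+ rho by rewrite exprD.
(* the shifted sequence is again in normal form *)
have thsr xi i : (i <= d')%N ->
    q_theta (xi * bs * q ^+ rho) (xi * cs / q ^+ rho) (ths' 0%N) i =
    ths' 0%N + xi * (ths (i + rho)%N - ths rho).
  move=> id; have [_ ->] := HT (i + rho)%N (ltac:(lia)).
  have [_ ->] := HT rho (ltac:(lia)); rewrite /q_theta qr.
  by field; rewrite !qn0.
have rat eta xi i : (0 < i <= d')%N ->
    q_phi (eta * b * q ^+ (d - d')) (eta * c) (xi * bs * q ^+ rho)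
      (xi * cs / q ^+ rho) (eta * xi * k) d' i * vph (i + rho)%N =
    q_vphi (eta * b * q ^+ (d - d')) (eta * c) (xi * bs * q ^+ rho)
      (xi * cs / q ^+ rho) (eta * xi * k) d' i * ph (i + rho)%N.
  move=> id; have [-> ->] := HV (i + rho)%N (ltac:(lia)); rewrite /q_phi /q_vphi qr q_subn //.
  rewrite !exprS; move: (qn0 i) (qn0 d) (qn0 d') (qn0 rho).
  move: (q ^+ i) (q ^+ d) (q ^+ d') (q ^+ rho) => x D D' R x0 D0 D0' R0.
  by field; rewrite q0 x0 D0 D0' R0.
split=> [[aff ratio]|[eta [xi [HT' HV']]]]; last first.
  have aff i : (i <= d')%N -> ths' i = ths' 0%N + xi * (ths (i + rho)%N - ths rho).
    by move=> id; have [_ {1}->] := HT' i id; rewrite thsr.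
  split=> [i id|i id].
    by rewrite (aff i id) (aff 1%N d0') add1n; ring.
  have [-> ->] := HV' i id; exact: rat.
have sr : ths rho.+1 - ths rho != 0.
  rewrite subr_eq0; apply/eqP => h.
  by have := lr_ths rel (ltac:(lia) : (rho.+1 <= d)%N) (ltac:(lia) : (rho <= d)%N) h; lia.
pose xi := (ths' 1%N - ths' 0%N) / (ths rho.+1 - ths rho).
have n1 : 1 - q ^+ d' != 0 by rewrite subr_eq0 eq_sym q_pow_neq1 //; lia.
have bc : b * q ^+ d - c != 0.
  have d0 : (0 < d)%N by lia.
  have := difference_0d d0 rel; have [-> _] := HT d (leqnn d); rewrite /q_theta.
  apply: contra_neq => /eqP; rewrite subr_eq0 => /eqP bc; rewrite -bc.
  by field; rewrite ?qn0 ?q0 ?oner_eq0.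
(* eta adjusts theta'_0 - theta'_{d'} *)
pose eta := (th' 0%N - th' d') * q ^+ d' / ((1 - q ^+ d') * (b * q ^+ d - c)).
exists eta, xi; apply: q_target => //.
- by move=> i id; apply: q_pow_neq1; lia.
- move=> i id; rewrite thsr //; have A := aff i id.
  apply: (mulIf sr); rewrite mulrDl /xi.
  have -> : ths' i * (ths rho.+1 - ths rho) = ths' 0%N * (ths rho.+1 - ths rho) +
    (ths' i - ths' 0%N) * (ths rho.+1 - ths rho) by ring.
  by rewrite A; field.
- rewrite /q_theta expr0 /eta q_subn //; field.
  by rewrite !qn0 bc n1 oner_eq0.
- move=> i id; have v0 : vph (i + rho)%N != 0 by apply: (lr_vph rel); lia.
  apply: (mulIf v0); have R := rat eta xi i id; have R' := ratio i id.
  by rewrite -[RHS]mulrA R mulrAC R'; ring.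
Qed.

End Source.
End QArrays.

(** * The Racah family *)

Section PolynomialArrays.
Variable F : fieldType.

(** The families II, IIA, IIB and IIC in one normal form: theta_i is a polynomial
    of degree at most two in i. The leading coefficients c and c^* vanish in the
    degenerate families, and k is the value at i = 0 of the last factor of
    vphi_i. Passing from vphi to phi again amounts to reversing the order of the
    theta_i. *)
Definition p_theta (b c t0 : F) (i : nat) : F := t0 + b * i%:R + c * i%:R ^+ 2.
Definition p_vphi (b c bs cs k : F) (d i : nat) : F :=
  i%:R * (i%:R - d%:R - 1) *
    (k + (b * cs + c * bs + (d%:R - 1) * c * cs) * i%:R + c * cs * i%:R ^+ 2).
Definition p_phi (b c bs cs k : F) (d i : nat) : F :=
  i%:R * (i%:R - d%:R - 1) *
    (k - (bs - cs) * (b + c * d%:R) +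
     (c * bs - (b + 2 * c * d%:R) * cs + (d%:R - 1) * c * cs) * i%:R +
     c * cs * i%:R ^+ 2).

Definition p_array (b c bs cs k : F) d (th ths vph ph : nat -> F) : Prop :=
  (forall i, (i <= d)%N ->
     th i = p_theta b c (th 0%N) i /\ ths i = p_theta bs cs (ths 0%N) i) /\
  (forall i, (0 < i <= d)%N ->
     vph i = p_vphi b c bs cs k d i /\ ph i = p_phi b c bs cs k d i).

Lemma p_sum b c t0 d i : (i <= d.+1)%N ->
  \sum_(h < i) (p_theta b c t0 h - p_theta b c t0 (d - h)) =
  (b + c * d%:R) * i%:R * (i%:R - d%:R - 1).
Proof.
elim: i => [|i IH] id; first by rewrite big_ord0 mulr0 mul0r.
rewrite big_ord_recr /= IH 1?ltnW // /p_theta natrB //.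
by rewrite -natr1; ring.
Qed.

(** With [p_identity2]: the closed form satisfies the relations that
    [regular_uniqueness] asks of a candidate. *)
Lemma p_identity b c t0 bs cs s0 k d i : (i < d)%N ->
  p_vphi b c bs cs k d i.+1 - p_phi b c bs cs k d i.+1 =
  (p_theta bs cs s0 i.+1 - p_theta bs cs s0 i) *
    \sum_(h < i.+1) (p_theta b c t0 h - p_theta b c t0 (d - h)).
Proof.
by move=> id; rewrite p_sum 1?ltnW // /p_vphi /p_phi /p_theta -natr1; ring.
Qed.

Lemma p_identity2 b c t0 bs cs s0 k d : (1 < d)%N ->
  let th := p_theta b c t0 in let ths := p_theta bs cs s0 in
  p_phi b c bs cs k d 2 * (th 0%N - th d) =
    p_vphi b c bs cs k d 1 * ((th 1%N - th d.-1) + (th 0%N - th d)) +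
    (ths 2%N - ths 0%N) * (th d.-1 - th 0%N) * (th 0%N - th d).
Proof.
case: d => [//|d] d1 /=; rewrite /p_vphi /p_phi /p_theta -natr1; ring.
Qed.

Let p_theta0 x y z : p_theta x y z 0 = z.
Proof. by rewrite /p_theta expr0n /= !mulr0 !addr0. Qed.

Section Target.
Variables (d : nat) (th ths vph ph : nat -> F) (b c bs cs k : F).
Hypothesis d0 : (0 < d)%N.
Hypothesis ni : forall i, (0 < i <= d)%N -> i%:R != 0 :> F.
Hypothesis rel : leonard_relations d th ths vph ph.
Hypothesis thsE : forall i, (i <= d)%N -> ths i = p_theta bs cs (ths 0%N) i.
Hypothesis thD : th 0%N - th d = p_theta b c (th 0%N) 0 - p_theta b c (th 0%N) d.
Hypothesis ratio : forall i, (0 < i <= d)%N ->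
  ph i * p_vphi b c bs cs k d i = vph i * p_phi b c bs cs k d i.

(** The deviation from the candidate is a quadratic polynomial with zeros at 0
    and d, that is, a multiple of i (d - i); so it is symmetric, and zero as soon
    as it vanishes at d - 1. *)
Lemma p_target : p_array b c bs cs k d th ths vph ph.
Proof.
have nd : d%:R != 0 :> F by rewrite ni // d0 leqnn.
have C1 i : (i < d)%N -> p_vphi b c bs cs k d i.+1 - p_phi b c bs cs k d i.+1 =
    (ths i.+1 - ths i) *
    \sum_(h < i.+1) (p_theta b c (th 0%N) h - p_theta b c (th 0%N) (d - h)).
  by move=> id; rewrite (thsE id) (thsE (ltnW id)) -(p_identity _ _ _ _ _ _ k).
have bc : b + c * d%:R != 0.
  have := difference_0d d0 rel; rewrite thD p_theta0 /p_theta; apply: contra_neq => bc.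
  transitivity (- d%:R * (b + c * d%:R)); first by ring.
  by rewrite bc mulr0.
have [] := regular_uniqueness d0 rel ratio (th2 := p_theta b c (th 0%N)) _ _ C1.
- by rewrite p_theta0.
- by move: thD; rewrite p_theta0 => /(addrI _)/oppr_inj.
- by move=> d1; have := p_identity2 b c (th 0%N) bs cs (ths 0%N) k d1; rewrite /= (thsE d1) !p_theta0.
- move=> [//|i] id; rewrite -subr_eq0 C1 // mulf_neq0 //.
    rewrite subr_eq0; apply/eqP => h.
    by have := lr_ths rel (ltac:(lia) : (i.+1 <= d)%N) (ltac:(lia) : (i <= d)%N) h; lia.
  rewrite p_sum; last lia.
  rewrite !mulf_neq0 ?ni //.
  have -> : i.+1%:R - d%:R - 1 = - (d.+1 - i.+1)%N%:R :> F.
    by rewrite natrB; [rewrite -[d.+1%:R]natr1; ring | lia].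
  by rewrite oppr_eq0 ni //; lia.
- move=> d1.
  have n2 : 2%:R != 0 :> F by apply: ni.
  have [x [y [z thE]]] : exists x y z, forall i, (i <= d)%N ->
      th i = x + y * i%:R + z * i%:R ^+ 2.
    apply: (family_of_relations rel d1).
    + move=> d2; have n3 : 3%:R != 0 :> F by apply: ni.
      by exists (3%:R^-1) => j; split; rewrite -!natr1; field.
    + have -> : (1%:R - 0%:R) * (2%:R ^+ 2 - 0%:R ^+ 2) - (2%:R - 0%:R) * (1%:R ^+ 2 - 0%:R ^+ 2)
        = 2%:R :> F by ring.
      exact: n2.
    + by exists (ths 0%N), bs, cs => i id; rewrite {1}thsE.
  have x0 : x = th 0%N by rewrite thE // expr0n /= !mulr0 !addr0.
  pose y' := y - b; pose z' := z - c.
  have dE i : (i <= d)%N -> th i - p_theta b c (th 0%N) i = y' * i%:R + z' * i%:R ^+ 2.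
    by move=> id; rewrite {1}thE // /p_theta /y' /z' x0; ring.
  have yz : y' = - z' * d%:R.
    apply: (mulIf nd); have : y' * d%:R + z' * d%:R ^+ 2 = 0.
      rewrite -dE //; move: thD; rewrite p_theta0 => /(addrI _)/oppr_inj ->.
      by rewrite subrr.
    by move/eqP; rewrite addr_eq0 => /eqP ->; ring.
  split=> [i id|].
    by rewrite !dE ?leq_subr // yz natrB //; ring.
  have dd : (d.-1 <= d)%N by lia.
  rewrite dE // yz => /eqP E i id; rewrite dE // yz.
  have n1 : d.-1%:R != 0 :> F by apply: ni; lia.
  have z0 : z' = 0.
    have dS : d%:R = d.-1%:R + 1 :> F by rewrite natr1 prednK.
    move: E; rewrite dS.
    have -> : - z' * (d.-1%:R + 1) * d.-1%:R + z' * d.-1%:R ^+ 2 = - z' * d.-1%:R by ring.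
    by rewrite mulf_eq0 oppr_eq0 (negPf n1) orbF => /eqP.
  by rewrite z0 oppr0 !mul0r addr0.
move=> thE vE; split=> i id; last exact: vE.
by split; [exact: thE | exact: thsE].
Qed.

End Target.

Section Source.
Variables (d d' rho : nat) (th ths vph ph th' ths' vph' ph' : nat -> F) (b c bs cs k : F).
Hypothesis d0' : (0 < d')%N.
Hypothesis rd : (rho + d' <= d)%N.
Hypothesis rel : leonard_relations d th ths vph ph.
Hypothesis rel' : leonard_relations d' th' ths' vph' ph'.
Hypothesis arr : p_array b c bs cs k d th ths vph ph.

Lemma p_nat_neq0 i : (0 < i <= d)%N -> i%:R != 0 :> F.
Proof.
move=> /andP[i0 id]; apply/eqP => qi; have [H _] := arr; have [E _] := H i id.
move: E; rewrite /p_theta qi expr0n !mulr0 !addr0.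
by move/(lr_th rel id (leq0n d)); lia.
Qed.

(** The last factor of vphi is a quadratic polynomial Q(i); that of the target is
    a multiple of Q(i + rho), and similarly for phi. Comparing coefficients gives
    the parameters. *)
Lemma p_descent : descent_condition d' rho ths vph ph ths' vph' ph' <->
  exists eta xi, p_array (eta * (b + c * (d%:R - d'%:R))) (eta * c)
    (xi * (bs + 2 * cs * rho%:R)) (xi * cs)
    (eta * xi * (k + (b * cs + c * bs + (d%:R - 1) * c * cs) * rho%:R +
       c * cs * rho%:R ^+ 2)) d' th' ths' vph' ph'.
Proof.
have dd : (d' <= d)%N by lia.
have [HT HV] := arr.
have thsr xi i : (i <= d')%N ->
    p_theta (xi * (bs + 2 * cs * rho%:R)) (xi * cs) (ths' 0%N) i =
    ths' 0%N + xi * (ths (i + rho)%N - ths rho).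
  move=> id; have [_ ->] := HT (i + rho)%N (ltac:(lia)).
  by have [_ ->] := HT rho (ltac:(lia)); rewrite /p_theta natrD; ring.
pose K eta xi := eta * xi * (k + (b * cs + c * bs + (d%:R - 1) * c * cs) * rho%:R +
  c * cs * rho%:R ^+ 2).
have rat eta xi i : (0 < i <= d')%N ->
    p_phi (eta * (b + c * (d%:R - d'%:R))) (eta * c) (xi * (bs + 2 * cs * rho%:R)) (xi * cs)
      (K eta xi) d' i * vph (i + rho)%N =
    p_vphi (eta * (b + c * (d%:R - d'%:R))) (eta * c) (xi * (bs + 2 * cs * rho%:R)) (xi * cs)
      (K eta xi) d' i * ph (i + rho)%N.
  move=> id; have [-> ->] := HV (i + rho)%N (ltac:(lia)); rewrite /p_phi /p_vphi natrD /K.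
  by ring.
rewrite /K in rat => {K}.
split=> [[aff ratio]|[eta [xi [HT' HV']]]]; last first.
  have aff i : (i <= d')%N -> ths' i = ths' 0%N + xi * (ths (i + rho)%N - ths rho).
    by move=> id; have [_ {1}->] := HT' i id; rewrite thsr.
  split=> [i id|i id].
    by rewrite (aff i id) (aff 1%N d0') add1n; ring.
  have [-> ->] := HV' i id; exact: rat.
have sr : ths rho.+1 - ths rho != 0.
  rewrite subr_eq0; apply/eqP => h.
  by have := lr_ths rel (ltac:(lia) : (rho.+1 <= d)%N) (ltac:(lia) : (rho <= d)%N) h; lia.
pose xi := (ths' 1%N - ths' 0%N) / (ths rho.+1 - ths rho).
have n1 : d'%:R != 0 :> F by rewrite p_nat_neq0 //; lia.
have bc : b + c * d%:R != 0.
  have d0 : (0 < d)%N by lia.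
  have := difference_0d d0 rel; have [-> _] := HT d (leqnn d); rewrite /p_theta.
  apply: contra_neq => bc; transitivity (- d%:R * (b + c * d%:R)); first by ring.
  by rewrite bc mulr0.
pose eta := - (th' 0%N - th' d') / (d'%:R * (b + c * d%:R)).
exists eta, xi; apply: p_target => //.
- by move=> i id; apply: p_nat_neq0; lia.
- move=> i id; rewrite thsr //; have A := aff i id.
  apply: (mulIf sr); rewrite mulrDl /xi.
  have -> : ths' i * (ths rho.+1 - ths rho) = ths' 0%N * (ths rho.+1 - ths rho) +
    (ths' i - ths' 0%N) * (ths rho.+1 - ths rho) by ring.
  by rewrite A; field.
- rewrite /p_theta /eta; field.
  by rewrite n1 bc ?oner_eq0.
- move=> i id; have v0 : vph (i + rho)%N != 0 by apply: (lr_vph rel); lia.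
  apply: (mulIf v0); have R := rat eta xi i id; have R' := ratio i id.
  by rewrite -[RHS]mulrA R mulrAC R'; ring.
Qed.

End Source.
End PolynomialArrays.

(** * The Bannai-Ito family *)

Section AlternatingArrays.
Variable F : fieldType.

(** Family III. Here theta_i = x + (y + z i) (-1)^i, the case q = -1. *)
Definition alt_theta (h s t0 : F) (i : nat) : F :=
  t0 + h * (s - 1 + (1 - s + 2 * i%:R) * (-1) ^+ i).
Definition alt_vphi (h hs r1 r2 : F) (d i : nat) : F :=
  if ~~ odd d then
    if ~~ odd i then - 4 * h * hs * i%:R * (i%:R + r1)
    else - 4 * h * hs * (i%:R - d%:R - 1) * (i%:R + r2)
  else
    if ~~ odd i then - 4 * h * hs * i%:R * (i%:R - d%:R - 1)
    else - 4 * h * hs * (i%:R + r1) * (i%:R + r2).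
Definition alt_phi (h hs r1 r2 ss : F) (d i : nat) : F :=
  if ~~ odd d then
    if ~~ odd i then 4 * h * hs * i%:R * (i%:R - ss - r1)
    else 4 * h * hs * (i%:R - d%:R - 1) * (i%:R - ss - r2)
  else
    if ~~ odd i then - 4 * h * hs * i%:R * (i%:R - d%:R - 1)
    else - 4 * h * hs * (i%:R - ss - r1) * (i%:R - ss - r2).

Definition alt_array (h hs r1 r2 s ss : F) d (th ths vph ph : nat -> F) : Prop :=
  [/\ r1 + r2 = - s - ss + d%:R + 1,
    forall i, (i <= d)%N ->
      th i = alt_theta h s (th 0%N) i /\ ths i = alt_theta hs ss (ths 0%N) i &
    forall i, (0 < i <= d)%N ->
      vph i = alt_vphi h hs r1 r2 d i /\ ph i = alt_phi h hs r1 r2 ss d i].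

Let sgn (n : nat) : (-1) ^+ n = (if odd n then -1 else 1) :> F.
Proof. by rewrite -signr_odd; case: odd. Qed.

Let alt_theta0 x y z : alt_theta x y z 0 = z.
Proof. by rewrite /alt_theta expr0; ring. Qed.

Lemma alt_sum h s t0 d i : (i <= d.+1)%N ->
  \sum_(l < i) (alt_theta h s t0 l - alt_theta h s t0 (d - l)) =
  if odd d then (odd i)%:R * h * (2 - 2 * s + 2 * d%:R)
  else if odd i then - 2 * h * (d%:R + 1 - i%:R) else - 2 * h * i%:R.
Proof.
elim: i => [|i IH] id.
  by rewrite big_ord0 /=; case: odd; ring.
rewrite big_ord_recr /= IH 1?ltnW // /alt_theta !sgn oddB // natrB // -natr1.
by case: (odd d); case: (odd i) => /=; ring.
Qed.

Lemma alt_identity h s t0 hs ss s0 r1 r2 d i : (i < d)%N ->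
  r1 + r2 = - s - ss + d%:R + 1 ->
  alt_vphi h hs r1 r2 d i.+1 - alt_phi h hs r1 r2 ss d i.+1 =
  (alt_theta hs ss s0 i.+1 - alt_theta hs ss s0 i) *
    \sum_(l < i.+1) (alt_theta h s t0 l - alt_theta h s t0 (d - l)).
Proof.
move=> id r; have -> : r2 = - s - ss + d%:R + 1 - r1 by rewrite -r; ring.
rewrite alt_sum 1?ltnW // /alt_vphi /alt_phi /alt_theta !sgn -natr1 /=.
by case: (odd d); case: (odd i) => /=; ring.
Qed.

Lemma alt_identity2 h s t0 hs ss s0 r1 r2 d : (1 < d)%N -> ~~ odd d ->
  r1 + r2 = - s - ss + d%:R + 1 ->
  let th := alt_theta h s t0 in let ths := alt_theta hs ss s0 in
  alt_phi h hs r1 r2 ss d 2 * (th 0%N - th d) =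
    alt_vphi h hs r1 r2 d 1 * ((th 1%N - th d.-1) + (th 0%N - th d)) +
    (ths 2%N - ths 0%N) * (th d.-1 - th 0%N) * (th 0%N - th d).
Proof.
case: d => [//|d] d1 od r /=; have -> : r2 = - s - ss + d.+1%:R + 1 - r1 by rewrite -r; ring.
rewrite /alt_vphi /alt_phi /alt_theta od !sgn (negPf od) /= -natr1.
by move: od => /=; rewrite negbK => ->; ring.
Qed.

Lemma alt_identity_odd h s t0 hs ss s0 r1 r2 d i : (i < d)%N -> odd d ->
  r1 + r2 = - s - ss + d%:R + 1 ->
  alt_phi h hs r1 r2 ss d i.+1 = alt_vphi h hs r1 r2 d 1 * (~~ odd i)%:R +
    (alt_theta hs ss s0 i.+1 - alt_theta hs ss s0 0) *
    (alt_theta h s t0 (d - i) - alt_theta h s t0 0).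
Proof.
move=> id od r; have -> : r2 = - s - ss + d%:R + 1 - r1 by rewrite -r; ring.
rewrite /alt_vphi /alt_phi /alt_theta !sgn oddB 1?ltnW // od natrB 1?ltnW // -natr1 /=.
by case: (odd i) => /=; ring.
Qed.

Lemma alt_family d (th ths vph ph : nat -> F) hs ss s0 :
  leonard_relations d th ths vph ph -> (1 < d)%N -> 2%:R != 0 :> F ->
  (forall i, (i <= d)%N -> ths i = alt_theta hs ss s0 i) ->
  exists x y z, forall i, (i <= d)%N -> th i = x + y * (-1) ^+ i + z * (i%:R * (-1) ^+ i).
Proof.
move=> rel d1 n2 thsE; apply: (family_of_relations rel d1).
- move=> _; exists (-1) => j; split; rewrite !exprS -?natr1; ring.
- rewrite !exprS expr0.
  have -> : (-1 * 1 - 1) * (2%:R * (-1 * (-1 * 1)) - 0%:R * 1) -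
    (-1 * (-1 * 1) - 1) * (1%:R * (-1 * 1) - 0%:R * 1) = - (2%:R * 2%:R) :> F by ring.
  by rewrite oppr_eq0 mulf_neq0.
- exists (s0 + hs * (ss - 1)), (hs * (1 - ss)), (2 * hs) => i id.
  by rewrite thsE // /alt_theta; ring.
Qed.

Section Target.
Variables (d : nat) (th ths vph ph : nat -> F) (h hs r1 r2 s ss : F).
Hypothesis d0 : (0 < d)%N.
Hypothesis n2 : 2%:R != 0 :> F.
Hypothesis ni : forall i, (0 < i <= d)%N -> ~~ odd i -> i%:R != 0 :> F.
Hypothesis rel : leonard_relations d th ths vph ph.
Hypothesis rr : r1 + r2 = - s - ss + d%:R + 1.
Hypothesis thsE : forall i, (i <= d)%N -> ths i = alt_theta hs ss (ths 0%N) i.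
Hypothesis thD : th 0%N - th d = alt_theta h s (th 0%N) 0 - alt_theta h s (th 0%N) d.
Hypothesis ratio : forall i, (0 < i <= d)%N ->
  ph i * alt_vphi h hs r1 r2 d i = vph i * alt_phi h hs r1 r2 ss d i.

Let thd : th d = alt_theta h s (th 0%N) d.
Proof. by move: thD; rewrite alt_theta0 => /(addrI _)/oppr_inj. Qed.

Let C1 i : (i < d)%N -> alt_vphi h hs r1 r2 d i.+1 - alt_phi h hs r1 r2 ss d i.+1 =
    (ths i.+1 - ths i) *
    \sum_(l < i.+1) (alt_theta h s (th 0%N) l - alt_theta h s (th 0%N) (d - l)).
Proof. by move=> id; rewrite (thsE id) (thsE (ltnW id)) -(alt_identity _ _ _ _ id rr). Qed.

Let fam : (1 < d)%N -> exists x y z, forall i, (i <= d)%N ->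
  th i = x + y * (-1) ^+ i + z * (i%:R * (-1) ^+ i).
Proof. by move=> d1; apply: (alt_family rel d1 n2 thsE). Qed.

Let dfam : (1 < d)%N -> exists x y z, forall i, (i <= d)%N ->
  th i - alt_theta h s (th 0%N) i = x + y * (-1) ^+ i + z * (i%:R * (-1) ^+ i).
Proof.
move=> d1; have [x [y [z E]]] := fam d1.
exists (x - th 0%N - h * (s - 1)), (y - h * (1 - s)), (z - 2 * h) => i id.
by rewrite {1}E // /alt_theta; ring.
Qed.

(** For d even the deviation from the candidate is x + (y + z i) (-1)^i with
    z = 0, because it has equal values at 0 and d; so it is symmetric. *)
Lemma alt_target_even : ~~ odd d -> alt_array h hs r1 r2 s ss d th ths vph ph.
Proof.
move=> od; have nd : d%:R != 0 :> F by rewrite ni // d0 leqnn.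
have h0 : h != 0.
  have := difference_0d d0 rel; rewrite thD alt_theta0 /alt_theta; apply: contra_neq => ->.
  by ring.
have [] := regular_uniqueness d0 rel ratio (th2 := alt_theta h s (th 0%N)) _ _ C1.
- by rewrite alt_theta0.
- exact: thd.
- move=> d1; have := alt_identity2 h (th 0%N) hs (ths 0%N) d1 od rr.
  by rewrite /= (thsE d1) !alt_theta0.
- move=> [//|i] id; rewrite -subr_eq0 C1 // mulf_neq0 //.
    rewrite subr_eq0; apply/eqP => E.
    by have := lr_ths rel (ltac:(lia) : (i.+1 <= d)%N) (ltac:(lia) : (i <= d)%N) E; lia.
  rewrite alt_sum; last lia.
  rewrite (negPf od); case: ifP => oi; rewrite !mulf_neq0 ?oppr_eq0 //; last first.
    by apply: ni => //; rewrite oi.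
  have -> : d%:R + 1 - i.+1%:R = (d.+1 - i.+1)%N%:R :> F.
    by rewrite natrB ?natr1 //; lia.
  by rewrite ni //; lia.
- move=> d1; have [x [y [z dE]]] := dfam d1.
  have e0 := dE 0%N (leq0n d); rewrite alt_theta0 subrr expr0 in e0.
  have ed := dE d (leqnn d); rewrite thd subrr sgn (negPf od) in ed.
  have z0 : z = 0.
    apply: (mulIf nd); rewrite mul0r.
    transitivity ((x + y * 1 + z * (d%:R * 1)) - (x + y * 1 + z * (0%:R * 1))); first by ring.
    by rewrite -e0 -ed subrr.
  have xy : x = - y.
    by apply/eqP; rewrite -addr_eq0 e0 z0; apply/eqP; ring.
  split=> [i id|].
    by rewrite !dE ?leq_subr // !sgn oddB // (negPf od) z0 !mul0r.
  have dd : (d.-1 <= d)%N by lia.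
  have odd1 : odd d.-1 by move: od; rewrite -{1}(prednK d0) /= negbK.
  rewrite dE // z0 sgn odd1 xy => E i id; rewrite dE // z0 xy.
  have y0 : y = 0.
    by apply: (mulIf n2); rewrite mul0r -oppr0 -E; ring.
  by rewrite y0; ring.
move=> thE vE; split=> // i id.
by split; [exact: thE | exact: thsE].
Qed.

(** For d odd the sum of the theta_h - theta_{d-h} over h < i vanishes for even i,
    and S_i is 1 or 0 according to the parity of i: this is the situation of
    [irregular_uniqueness]. *)
Lemma alt_target_odd : odd d -> alt_array h hs r1 r2 s ss d th ths vph ph.
Proof.
move=> od.
have famE : exists x y z, forall i, (i <= d)%N ->
    th i = x + y * (-1) ^+ i + z * (i%:R * (-1) ^+ i).
  case: (ltnP 1 d) => d1; first exact: fam.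
  exists (th 0%N), 0, (th 0%N - th 1%N) => i id.
  have [->|->] : i = 0%N \/ i = 1%N by lia.
    by rewrite expr0; ring.
  by rewrite expr1; ring.
have [] := irregular_uniqueness d0 rel ratio (th2 := alt_theta h s (th 0%N)) _ _ od.
- by rewrite alt_theta0.
- exact: thd.
- have [x [y [z E]]] := famE; elim=> [|i IH] id.
    by rewrite big_ord1 subn0 /=; ring.
  rewrite big_ord_recr /= IH 1?ltnW // (E i.+1) ?(E (d - i.+1)%N) ?leq_subr // 1?ltnW //.
  rewrite (E 0%N) // (E d) // !sgn oddB 1?ltnW // od natrB 1?ltnW //=.
  by case: (odd i) => /=; ring.
- move=> S S1 SS; have [x [y [z E]]] := famE; elim=> [|i IH] id; first by rewrite S1.
  have idi : (0 < i.+1 < d)%N by [].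
  have := SS _ idi; rewrite IH 1?ltnW //=.
  have n0 : th 0%N - th (d - i.+1).+1 != 0.
    rewrite subr_eq0; apply/eqP => H.
    by have := lr_th rel (leq0n d) (ltac:(lia) : ((d - i.+1).+1 <= d)%N) H.
  case oi: (odd i) => /= H; apply: (mulIf n0); rewrite H; first by ring.
  rewrite mul0r (E 1%N) ?(E 0%N) ?(E (d - i.+1).+1) ?(E (d - i.+1)%N) //; try lia.
  by rewrite !sgn /= oddB 1?ltnW // od /= oi /= -[(d - i.+1).+1%:R]natr1 natrB 1?ltnW //; ring.
- move=> i id; rewrite C1 // alt_sum 1?ltnW // od /= alt_theta0 /alt_theta sgn od.
  by congr (_ * _); case: (odd i) => /=; ring.
- move=> i id; rewrite (alt_identity_odd h (th 0%N) hs (ths 0%N) id od rr) -thsE //.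
  by rewrite !alt_theta0.
- move=> d1; have [x [y [z dE]]] := dfam d1.
  have e0 := dE 0%N (leq0n d); rewrite alt_theta0 subrr expr0 in e0.
  have ed := dE d (leqnn d); rewrite thd subrr sgn od in ed.
  rewrite dE ?leq_subr // sgn oddB // od natrB //= => e2 i id.
  have z0 : z = 0.
    apply: (mulIf n2); rewrite mul0r.
    transitivity ((x + y * -1 + z * ((d%:R - 2%:R) * -1)) - (x + y * -1 + z * (d%:R * -1))).
      by ring.
    by rewrite e2 -ed subrr.
  have xy : x = - y by apply/eqP; rewrite -addr_eq0 e0 z0; apply/eqP; ring.
  have y0 : y = 0.
    by apply: (mulIf n2); rewrite mul0r -oppr0 ed z0 xy; ring.
  by rewrite dE // xy y0 z0; ring.
move=> thE vE; split=> // i id.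
by split; [exact: thE | exact: thsE].
Qed.

End Target.
End AlternatingArrays.

(** * Descents in the Bannai-Ito family *)

(** The difference vphi_1 - phi_1 is (theta^*_1 - theta^*_0)(theta_0 - theta_d). *)
Lemma relations_first (F : fieldType) d (th ths vph ph : nat -> F) :
  leonard_relations d th ths vph ph -> (0 < d)%N -> vph 1%N != ph 1%N.
Proof.
move=> rel d0; rewrite -subr_eq0 (lr_sum rel) // big_ord1 subn0 mulf_neq0 //.
  by rewrite subr_eq0; apply/eqP => E; have := lr_ths rel d0 (leq0n d) E.
exact: (difference_0d d0 rel).
Qed.

(** The quotient phi_i / vphi_i, in particular whether it is 1, is inherited. *)
Lemma descent_eq (F : fieldType) d d' rho (th ths vph ph th' ths' vph' ph' : nat -> F) i :
  leonard_relations d th ths vph ph -> leonard_relations d' th' ths' vph' ph' ->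
  (rho + d' <= d)%N -> (0 < i <= d')%N ->
  descent_condition d' rho ths vph ph ths' vph' ph' ->
  (vph' i == ph' i) = (vph (i + rho)%N == ph (i + rho)%N).
Proof.
move=> rel rel' rd id [_ /(_ i id) R].
have v0 : vph (i + rho)%N != 0 by apply: (lr_vph rel); lia.
have v0' := lr_vph rel' id.
apply/eqP/eqP => E.
  by move: R; rewrite -E => /(mulfI v0').
by move: R; rewrite -E => /(mulIf v0) ->.
Qed.

Section AlternatingSource.
Variable F : fieldType.
Variables (d d' rho : nat) (th ths vph ph th' ths' vph' ph' : nat -> F).
Variables (h hs r1 r2 s ss : F).
Hypothesis d0' : (0 < d')%N.
Hypothesis rd : (rho + d' <= d)%N.
Hypothesis rel : leonard_relations d th ths vph ph.
Hypothesis rel' : leonard_relations d' th' ths' vph' ph'.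
Hypothesis arr : alt_array h hs r1 r2 s ss d th ths vph ph.

Let sgn (n : nat) : (-1) ^+ n = (if odd n then -1 else 1) :> F.
Proof. by rewrite -signr_odd; case: odd. Qed.

Let d0 : (0 < d)%N. Proof. lia. Qed.

Lemma alt_two_neq0 : 2%:R != 0 :> F.
Proof.
apply/eqP => n2; have [_ HT _] := arr; have [E _] := HT 1%N d0.
have {}E : th 1%N = th 0%N.
  rewrite E /alt_theta expr1; transitivity (th 0%N + h * (s - 2%:R) * 2%:R); first by ring.
  by rewrite n2 mulr0 addr0.
by have := lr_th rel d0 (leq0n d) E.
Qed.

Lemma alt_hs_neq0 : hs != 0.
Proof.
apply/eqP => n2; have [_ HT _] := arr; have [_ E] := HT 1%N d0.
have {}E : ths 1%N = ths 0%N by rewrite E /alt_theta n2 mul0r addr0.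
by have := lr_ths rel d0 (leq0n d) E.
Qed.

Lemma alt_nat_neq0 i : (0 < i <= d)%N -> ~~ odd i -> i%:R != 0 :> F.
Proof.
move=> /andP[i0 id] oi; apply/eqP => n0; have [_ HT _] := arr; have [E _] := HT i id.
have {}E : th i = th 0%N by rewrite E /alt_theta sgn (negPf oi) n0; ring.
by have := lr_th rel id (leq0n d) E; lia.
Qed.

Lemma alt_thetas_descent i : descent_condition d' rho ths vph ph ths' vph' ph' ->
  (i <= d')%N -> ths' i = alt_theta
    ((ths' 1%N - ths' 0%N) / (ths rho.+1 - ths rho) * hs * (-1) ^+ rho)
    (ss - 2 * rho%:R) (ths' 0%N) i.
Proof.
move=> [aff _] id.
have sr : ths rho.+1 - ths rho != 0.
  rewrite subr_eq0; apply/eqP => E.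
  by have := lr_ths rel (ltac:(lia) : (rho.+1 <= d)%N) (ltac:(lia) : (rho <= d)%N) E; lia.
have A := aff i id; apply: (mulIf sr).
have -> : ths' i * (ths rho.+1 - ths rho) = ths' 0%N * (ths rho.+1 - ths rho) +
  (ths' i - ths' 0%N) * (ths rho.+1 - ths rho) by ring.
rewrite A /alt_theta; set xi := ths' 1%N - ths' 0%N; set D := ths rho.+1 - ths rho.
have [_ HT _] := arr; have [_ ->] := HT (i + rho)%N (ltac:(lia)).
have [_ ->] := HT rho (ltac:(lia)).
rewrite /alt_theta exprD natrD; move: ((-1) ^+ i) ((-1) ^+ rho) => x y.
by field.
Qed.

Lemma alt_ratio h' hs' i : odd d = odd d' -> (odd d -> ~~ odd rho) -> (0 < i <= d')%N ->
  let R1 := if odd rho then r2 + rho%:R else r1 + rho%:R in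
  let R2 := if odd rho then r1 + rho%:R else r2 + rho%:R in
  alt_phi h' hs' R1 R2 (ss - 2 * rho%:R) d' i * vph (i + rho)%N =
  alt_vphi h' hs' R1 R2 d' i * ph (i + rho)%N.
Proof.
move=> dd' drho id R1 R2; have [_ _ HV] := arr.
have [-> ->] := HV (i + rho)%N (ltac:(lia)).
rewrite /R1 /R2 /alt_phi /alt_vphi -dd' oddD natrD.
move: drho; case: (odd d) => [/(_ isT)/negPf ->|_]; last case: (odd rho);
  by case: (odd i) => /=; ring.
Qed.

(** For even d the two linear factors of vphi_i belong to even and to odd i; an
    odd shift exchanges them, whence the exchange of r_1 and r_2. *)
Lemma alt_descent : odd d = odd d' -> (odd d -> ~~ odd rho) ->
  let R1 := if odd rho then r2 + rho%:R else r1 + rho%:R in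
  let R2 := if odd rho then r1 + rho%:R else r2 + rho%:R in
  descent_condition d' rho ths vph ph ths' vph' ph' <->
  exists h' hs', alt_array h' hs' R1 R2 (s - d%:R + d'%:R) (ss - 2 * rho%:R)
    d' th' ths' vph' ph'.
Proof.
move=> dd' drho R1 R2; have [rr HT HV] := arr.
have rat h' hs' i := alt_ratio h' hs' (i := i) dd' drho.
split=> [H|[h' [hs' [_ HT' HV']]]]; last first.
  have aff i : (i <= d')%N -> ths' i = ths' 0%N +
      hs' * (-1) ^+ rho / hs * (ths (i + rho)%N - ths rho).
    move=> id; have [_ {1}->] := HT' i id; have [_ ->] := HT (i + rho)%N (ltac:(lia)).
    have [_ ->] := HT rho (ltac:(lia)).
    rewrite /alt_theta exprD natrD !sgn; have hs0 := alt_hs_neq0.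
    by case: (odd rho); field.
  split=> [i id|i id].
    by rewrite (aff i id) (aff 1%N d0') add1n; ring.
  have [-> ->] := HV' i id; exact: rat.
have n2 := alt_two_neq0.
have ni i : (0 < i <= d')%N -> ~~ odd i -> i%:R != 0 :> F.
  by move=> id; apply: alt_nat_neq0; lia.
have thsE i := alt_thetas_descent (i := i) H.
set hs' := _ * _ * _ in thsE.
(* theta'_0 - theta'_{d'} is tau times the scale factor h' *)
pose tau := if odd d' then 2 - 2 * s + 2 * d%:R else - 2 * d'%:R : F.
have tau0 : tau != 0.
  rewrite /tau; case: ifP => od'; last first.
    by rewrite mulf_neq0 ?oppr_eq0 // ni ?d0' ?leqnn ?od'.
  have := difference_0d d0 rel; have [E _] := HT d (leqnn d).
  rewrite E /alt_theta sgn dd' od'; apply: contra_neq => E'.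
  by transitivity (- h * (2 - 2 * s + 2 * d%:R) + 2 * h * (2 - 2 * s + 2 * d%:R)); [ring | rewrite E'; ring].
pose h' := (th' 0%N - th' d') / tau.
have E : r1 + r2 = - s - ss + d%:R + 1 by [].
exists h', hs'.
have RR : R1 + R2 = - (s - d%:R + d'%:R) - (ss - 2 * rho%:R) + d'%:R + 1.
  transitivity (r1 + r2 + 2 * rho%:R); first by rewrite /R1 /R2; case: (odd rho); ring.
  by rewrite E; ring.
have TD : th' 0%N - th' d' = alt_theta h' (s - d%:R + d'%:R) (th' 0%N) 0 -
    alt_theta h' (s - d%:R + d'%:R) (th' 0%N) d'.
  transitivity (h' * tau); first by rewrite /h' divfK.
  by rewrite /tau /alt_theta expr0 sgn; case: (odd d'); ring.
have RT i : (0 < i <= d')%N ->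
    ph' i * alt_vphi h' hs' R1 R2 d' i = vph' i * alt_phi h' hs' R1 R2 (ss - 2 * rho%:R) d' i.
  move=> id; have v0 : vph (i + rho)%N != 0 by apply: (lr_vph rel); lia.
  have [_ ratio] := H; apply: (mulIf v0).
  rewrite -[RHS]mulrA rat // mulrAC ratio //; ring.
case od: (odd d'); last exact: (alt_target_even d0' n2 ni rel' RR thsE TD RT (negbT od)).
exact: (alt_target_odd d0' n2 rel' RR thsE TD RT od).
Qed.

(** By [alt_sum] the sum in [lr_sum] vanishes only for d odd and i even. *)
Lemma alt_source_eq i : (0 < i <= d)%N -> (vph i == ph i) = odd d && ~~ odd i.
Proof.
case: i => // i id; have [rr HT HV] := arr.
rewrite -subr_eq0 (lr_sum rel) // mulf_eq0 subr_eq0.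
have -> : (ths i.+1 == ths i) = false.
  apply/eqP => E.
  by have := lr_ths rel (ltac:(lia) : (i.+1 <= d)%N) (ltac:(lia) : (i <= d)%N) E; lia.
have -> : \sum_(l < i.+1) (th l - th (d - l)%N) =
  \sum_(l < i.+1) (alt_theta h s (th 0%N) l - alt_theta h s (th 0%N) (d - l)).
  apply: eq_bigr => l _; have ld : (l <= d)%N by move: (ltn_ord l); lia.
  by have [<- _] := HT _ ld; have [<- _] := HT (d - l)%N (leq_subr _ _).
have n2 := alt_two_neq0.
have T0 := difference_0d d0 rel; have [TE _] := HT d (leqnn d).
have h0 : h != 0.
  by apply: contra_neq T0 => h0; rewrite TE h0 /alt_theta; ring.
rewrite alt_sum ?(ltnW id) //=; last lia.
case od: (odd d) => /=.
  case oi: (odd i) => /=; first by rewrite !mul0r eqxx.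
  apply/negbTE; rewrite mul1r; apply: contra_neq T0 => E.
  by rewrite TE /alt_theta sgn od -E; ring.
apply/negbTE; case: ifP => oi; rewrite !mulf_neq0 ?oppr_eq0 //; last first.
  by apply: alt_nat_neq0 => //=; rewrite oi.
have -> : d%:R + 1 - i.+1%:R = (d.+1 - i.+1)%N%:R :> F.
  by rewrite natrB ?natr1 //; lia.
by rewrite alt_nat_neq0 //; lia.
Qed.

(** By [alt_family] the eigenvalues of the target lie in the same family, so
    for d' >= 2 the quotient phi'_2 / vphi'_2 is 1 exactly when d' is odd, while
    phi'_1 / vphi'_1 is never 1. This contradicts [alt_source_eq] in each of the listed cases. *)
Lemma alt_no_descent :
  (~~ odd d /\ odd d' /\ (3 <= d')%N) \/ (odd d /\ (~~ odd d' \/ odd rho)) ->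
  ~ descent_condition d' rho ths vph ph ths' vph' ph'.
Proof.
move=> hyp H; have n2 := alt_two_neq0.
have deq i (id : (0 < i <= d')%N) := descent_eq rel rel' rd id H.
have first := relations_first rel' d0'.
have famE : (1 < d')%N -> exists x y z, forall i, (i <= d')%N ->
    th' i = x + y * (-1) ^+ i + z * (i%:R * (-1) ^+ i).
  by move=> d1; apply: (alt_family rel' d1 n2) => i; apply: alt_thetas_descent.
have second (d1 : (1 < d')%N) : (vph' 2%N == ph' 2%N) = odd d'.
  rewrite -subr_eq0 (lr_sum rel') // mulf_eq0 subr_eq0.
  have -> : (ths' 2%N == ths' 1%N) = false.
    by apply/eqP => E; have := lr_ths rel' d1 (ltnW d1) E.
  rewrite big_ord_recr big_ord1 subn0 /=.
  have [x [y [z E]]] := famE d1.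
  have := difference_0d d0' rel'; rewrite (E 0%N) // (E d') // !(E 1%N) ?(E (d' - 1)%N) ?leq_subr //.
  rewrite !sgn oddB // natrB //; case: (odd d') => /= T0.
    by apply/eqP; ring.
  apply/negbTE; apply: contra T0 => /eqP E2.
  have z0 : z = 0.
    apply: (mulIf n2); rewrite mul0r -oppr0 -[in RHS]E2; ring.
  by rewrite z0; apply/eqP; ring.
case: hyp => [[od [od' d3]]|[od [od'|orho]]].
- have := second (ltnW d3); rewrite deq; last lia.
  by rewrite alt_source_eq ?(negPf od) ?od' //; lia.
- have d1 : (1 < d')%N by case: (d') d0' od' => [|[|]].
  have := second d1; rewrite deq; last lia.
  rewrite alt_source_eq; last lia.
  rewrite od (negPf od') /= negbK => orho.
  move: first; rewrite deq ?d0' // alt_source_eq; last lia.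
  by rewrite od /= orho.
- move: first; rewrite deq ?d0' // alt_source_eq; last lia.
  by rewrite od /= orho.
Qed.

End AlternatingSource.

(** * Closed forms *)

Section ClosedForms.

Variables (K : fieldType) (L : closedFieldType) (iota : {rmorphism K -> L}).

(** The base points theta_0 and theta^*_0 of a closed form are the values of the
    sequences at 0. *)
Lemma closed_form_array d p (thf thsf thg thsg : L -> nat -> L) vphf phf vphg phg :
  (forall t, thg t 0%N = t) -> (forall t, thsg t 0%N = t) ->
  (forall t i, (i <= d)%N -> thf t i = thg t i) ->
  (forall t i, (i <= d)%N -> thsf t i = thsg t i) ->
  (forall i, (0 < i <= d)%N -> vphf i = vphg i) ->
  (forall i, (0 < i <= d)%N -> phf i = phg i) ->
  (exists th0 ths0, has_scalars iota d p (thf (iota th0)) (thsf (iota ths0)) vphf phf) <->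
  has_scalars iota d p (thg (iota (theta p 0))) (thsg (iota (thetas p 0))) vphg phg.
Proof.
move=> z zs E1 E2 E3 E4; split=> [[th0 [ths0 [H1 H2]]]|[H1 H2]].
  have [-> ->] := H1 0%N isT; rewrite E1 // E2 // z zs.
  split=> i id; first by rewrite -E1 // -E2 //; apply: H1.
  by rewrite -E3 // -E4 //; apply: H2.
exists (theta p 0), (thetas p 0); split=> i id; first by rewrite E1 // E2 //; apply: H1.
by rewrite E3 // E4 //; apply: H2.
Qed.

Lemma q_pows (q : L) (i d : nat) : q != 0 ->
  [/\ q ^ (1 - 2 * i%:Z) = q / q ^+ i ^+ 2, q ^ (1 - i%:Z) = q / q ^+ i,
      q ^ (i%:Z - d%:Z - 1) = q ^+ i / (q ^+ d * q) &
      q ^ (d%:Z + 2 - 2 * i%:Z) = q ^+ d * q ^+ 2 / q ^+ i ^+ 2].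
Proof.
move=> q0.
have E1 : q ^ (- i%:Z) = (q ^+ i)^-1 by rewrite -exprnN.
have E2 : q ^ (- (2 * i%:Z)) = (q ^+ i ^+ 2)^-1.
  have -> : 2 * i%:Z = (i * 2)%N%:Z by rewrite PoszM mulrC.
  by rewrite -exprnN exprM.
rewrite !expfzDr // E1 E2 -!exprnP -!exprnN expr1; split=> //.
by rewrite invfM mulrA.
Qed.

Lemma q_theta_0 (q b c t : L) : q_theta q b c t 0 = t.
Proof. by rewrite /q_theta expr0 invr1 !subrr !mulr0 !addr0. Qed.

Lemma p_theta_0 (b c t : L) : p_theta b c t 0 = t.
Proof. by rewrite /p_theta expr0n /= !mulr0 !addr0. Qed.

Lemma form_I_array q h hs r1 r2 s ss d p : q != 0 ->
  r1 * r2 = s * ss * q ^+ d.+1 ->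
  (exists th0 ths0, form_I iota q h hs r1 r2 s ss th0 ths0 d p) <->
  q_array q (h * s * q) h (hs * ss * q) hs (- (h * hs * (r1 + r2))) d
    (iota \o theta p) (iota \o thetas p) (iota \o vphi p) (iota \o phi p).
Proof.
move=> q0 rr.
have qn0 n : q ^+ n != 0 by rewrite expf_neq0.
have pows i := q_pows i d q0.
have E : r2 = r1 + r2 - r1 by ring.
have [F1 F2] : (forall i, (0 < i <= d)%N ->
   h * hs * q ^ (1 - 2 * i%:Z) * (1 - q ^+ i) * (1 - q ^ (i%:Z - d%:Z - 1))
     * (1 - r1 * q ^+ i) * (1 - r2 * q ^+ i) =
   q_vphi q (h * s * q) h (hs * ss * q) hs (- (h * hs * (r1 + r2))) d i) /\
  (forall i, (0 < i <= d)%N ->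
     (if ss != 0 then h * hs * q ^ (1 - 2 * i%:Z) * (1 - q ^+ i)
        * (1 - q ^ (i%:Z - d%:Z - 1)) * (r1 - ss * q ^+ i) * (r2 - ss * q ^+ i) / ss
      else h * hs * q ^ (d%:Z + 2 - 2 * i%:Z) * (1 - q ^+ i)
        * (1 - q ^ (i%:Z - d%:Z - 1)) * (s - r1 * q ^ (i%:Z - d%:Z - 1)
           - r2 * q ^ (i%:Z - d%:Z - 1))) =
   q_phi q (h * s * q) h (hs * ss * q) hs (- (h * hs * (r1 + r2))) d i).
  split=> i _; have [p1 _ p3 p4] := pows i; rewrite ?p1 ?p3 ?p4 /q_vphi /q_phi.
    rewrite -mulrA (_ : (1 - r1 * q ^+ i) * (1 - r2 * q ^+ i) =
      1 - (r1 + r2) * q ^+ i + r1 * r2 * q ^+ i ^+ 2); last by ring.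
    rewrite rr !exprS; move: (qn0 i) (qn0 d); set x := q ^+ i; set D := q ^+ d => x0 D0.
    by field; rewrite q0 x0 D0 ?oner_eq0.
  case: eqVneq => [ss0|ss0] /=.
    rewrite ss0 !exprS; move: (qn0 i) (qn0 d); set x := q ^+ i; set D := q ^+ d => x0 D0.
    by field; rewrite q0 x0 D0 ?oner_eq0.
  have -> X : X * (r1 - ss * q ^+ i) * (r2 - ss * q ^+ i) / ss =
      X * (r1 * r2 - (r1 + r2) * ss * q ^+ i + ss ^+ 2 * q ^+ i ^+ 2) / ss by ring.
  rewrite rr !exprS; move: (qn0 i) (qn0 d); set x := q ^+ i; set D := q ^+ d => x0 D0.
  by field; rewrite q0 x0 D0 ss0 ?oner_eq0.
apply: iff_trans (closed_form_array p
  (thf := fun t i => t + h * (1 - q ^+ i) * (1 - s * q ^+ i.+1) * q ^- i)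
  (thsf := fun t i => t + hs * (1 - q ^+ i) * (1 - ss * q ^+ i.+1) * q ^- i)
  (q_theta_0 q _ _) (q_theta_0 q _ _) _ _ F1 F2).
- by split=> [[x [y [_ H]]]|[x [y H]]]; exists x, y.
- by move=> t i _; rewrite /q_theta exprS; field; rewrite qn0.
- by move=> t i _; rewrite /q_theta exprS; field; rewrite qn0.
Qed.

Lemma form_IA_array q hs r s d p : q != 0 ->
  (exists th0 ths0, form_IA iota q hs r s th0 ths0 d p) <->
  q_array q (s * q) 0 0 hs (- (r * hs)) d
    (iota \o theta p) (iota \o thetas p) (iota \o vphi p) (iota \o phi p).
Proof.
move=> q0; have qn0 n : q ^+ n != 0 by rewrite expf_neq0.
apply: (closed_form_array p
  (thf := fun t i => t - s * q * (1 - q ^+ i))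
  (thsf := fun t i => t + hs * (1 - q ^+ i) * q ^- i)
  (q_theta_0 q _ _) (q_theta_0 q _ _)).
- by move=> t i _; rewrite /q_theta; ring.
- by move=> t i _; rewrite /q_theta; field; rewrite qn0.
- move=> i _; have [_ p2 p3 _] := q_pows i d q0; rewrite p2 p3 /q_vphi (exprS q d).
  move: (qn0 i) (qn0 d); set x := q ^+ i; set D := q ^+ d => x0 D0.
  by field; rewrite q0 x0 D0 ?oner_eq0.
- move=> i _; have [_ _ p3 p4] := q_pows i d q0; rewrite p3 p4 /q_phi (exprS q d).
  move: (qn0 i) (qn0 d); set x := q ^+ i; set D := q ^+ d => x0 D0.
  by field; rewrite q0 x0 D0 ?oner_eq0.
Qed.

Lemma form_II_array h hs r1 r2 s ss d p : r1 + r2 = s + ss + d%:R + 1 ->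
  (exists th0 ths0, form_II iota h hs r1 r2 s ss th0 ths0 d p) <->
  p_array (h * (1 + s)) h (hs * (1 + ss)) hs (h * hs * r1 * r2) d
    (iota \o theta p) (iota \o thetas p) (iota \o vphi p) (iota \o phi p).
Proof.
move=> rr; have E : r2 = s + ss + d%:R + 1 - r1 by rewrite -rr; ring.
apply: iff_trans (closed_form_array p
  (thf := fun t i => t + h * i%:R * (i%:R + 1 + s))
  (thsf := fun t i => t + hs * i%:R * (i%:R + 1 + ss))
  (vphf := fun i => h * hs * i%:R * (i%:R - d%:R - 1) * (i%:R + r1) * (i%:R + r2))
  (phf := fun i => h * hs * i%:R * (i%:R - d%:R - 1) * (i%:R + ss - r1) * (i%:R + ss - r2))
  (p_theta_0 _ _) (p_theta_0 _ _) _ _ _ _).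
- by split=> [[x [y [_ H]]]|[x [y H]]]; exists x, y.
- by move=> t i _; rewrite /p_theta; ring.
- by move=> t i _; rewrite /p_theta; ring.
- by move=> i _; rewrite /p_vphi E; ring.
- by move=> i _; rewrite /p_phi E; ring.
Qed.

Lemma form_IIA_array h r s ss d p :
  (exists th0 ths0, form_IIA iota h r s ss th0 ths0 d p) <->
  p_array (h * (1 + s)) h ss 0 (h * ss * r) d
    (iota \o theta p) (iota \o thetas p) (iota \o vphi p) (iota \o phi p).
Proof.
apply: (closed_form_array p
  (thf := fun t i => t + h * i%:R * (i%:R + 1 + s))
  (thsf := fun t i => t + ss * i%:R)
  (p_theta_0 _ _) (p_theta_0 _ _)).
- by move=> t i _; rewrite /p_theta; ring.
- by move=> t i _; rewrite /p_theta; ring.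
- by move=> i _; rewrite /p_vphi; ring.
- by move=> i _; rewrite /p_phi; ring.
Qed.

Lemma form_IIB_array hs r s ss d p :
  (exists th0 ths0, form_IIB iota hs r s ss th0 ths0 d p) <->
  p_array s 0 (hs * (1 + ss)) hs (hs * s * r) d
    (iota \o theta p) (iota \o thetas p) (iota \o vphi p) (iota \o phi p).
Proof.
apply: (closed_form_array p
  (thf := fun t i => t + s * i%:R)
  (thsf := fun t i => t + hs * i%:R * (i%:R + 1 + ss))
  (p_theta_0 _ _) (p_theta_0 _ _)).
- by move=> t i _; rewrite /p_theta; ring.
- by move=> t i _; rewrite /p_theta; ring.
- by move=> i _; rewrite /p_vphi; ring.
- by move=> i _; rewrite /p_phi; ring.
Qed.

Lemma form_IIC_array r s ss d p :
  (exists th0 ths0, form_IIC iota r s ss th0 ths0 d p) <->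
  p_array s 0 ss 0 r d
    (iota \o theta p) (iota \o thetas p) (iota \o vphi p) (iota \o phi p).
Proof.
apply: (closed_form_array p
  (thf := fun t i => t + s * i%:R)
  (thsf := fun t i => t + ss * i%:R)
  (p_theta_0 _ _) (p_theta_0 _ _)).
- by move=> t i _; rewrite /p_theta; ring.
- by move=> t i _; rewrite /p_theta; ring.
- by move=> i _; rewrite /p_vphi; ring.
- by move=> i _; rewrite /p_phi; ring.
Qed.

Lemma form_III_array h hs r1 r2 s ss d p :
  (exists th0 ths0, form_III iota h hs r1 r2 s ss th0 ths0 d p) <->
  alt_array h hs r1 r2 s ss d
    (iota \o theta p) (iota \o thetas p) (iota \o vphi p) (iota \o phi p).
Proof.
have z x y t : alt_theta x y t 0 = t :> L by rewrite /alt_theta expr0; ring.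
have C := closed_form_array p (d := d) (thf := alt_theta h s) (thsf := alt_theta hs ss)
  (vphf := alt_vphi h hs r1 r2 d) (phf := alt_phi h hs r1 r2 ss d)
  (z h s) (z hs ss) (fun t i _ => erefl) (fun t i _ => erefl) (fun i _ => erefl) (fun i _ => erefl).
split=> [[x [y [rr H]]]|[rr HT HV]].
  by have [HT HV] := proj1 C (ex_intro _ x (ex_intro _ y H)).
by have [x [y H]] := proj2 C (conj HT HV); exists x, y.
Qed.

End ClosedForms.

(** * Diameter three in characteristic two *)

Section FourPointArrays.
Variable F : fieldType.

(** Family IV. In [iv_vphi] and [iv_phi] the entry at index 0 is a placeholder. *)
Definition iv_theta (h s t0 : F) : nat -> F :=
  nth 0 [:: t0; t0 + h * (s + 1); t0 + h; t0 + h * s].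
Definition iv_vphi (h hs r s ss : F) : nat -> F :=
  nth 0 [:: 0; h * hs * r; h * hs; h * hs * (r + s + ss)].
Definition iv_phi (h hs r s ss : F) : nat -> F :=
  nth 0 [:: 0; h * hs * (r + s * (1 + ss)); h * hs; h * hs * (r + ss * (1 + s))].

Definition iv_array (h hs r s ss : F) (th ths vph ph : nat -> F) : Prop :=
  (forall i, (i <= 3)%N ->
     th i = iv_theta h s (th 0%N) i /\ ths i = iv_theta hs ss (ths 0%N) i) /\
  (forall i, (0 < i <= 3)%N ->
     vph i = iv_vphi h hs r s ss i /\ ph i = iv_phi h hs r s ss i).

Variables (th ths vph ph th' ths' vph' ph' : nat -> F) (h hs r s ss : F).
Hypothesis rel : leonard_relations 3 th ths vph ph.
Hypothesis arr : iv_array h hs r s ss th ths vph ph.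

Let upto3 (P : nat -> Prop) : P 0%N -> P 1%N -> P 2%N -> P 3%N ->
  forall i, (i <= 3)%N -> P i.
Proof. by move=> P0 P1 P2 P3 [|[|[|[|]]]]. Qed.

Let below3 (P : nat -> Prop) : P 0%N -> P 1%N -> P 2%N -> forall i, (i < 3)%N -> P i.
Proof. by move=> P0 P1 P2 [|[|[|]]]. Qed.

Lemma iv_neq0 : [/\ h != 0, hs != 0, s != 0 & ss != 0].
Proof.
have [HT _] := arr; have [E2 F2] := HT 2%N isT; have [E3 F3] := HT 3%N isT.
split; apply/eqP => z0.
- by have := lr_th rel (i := 2) (j := 0) isT isT; rewrite E2 /iv_theta /= z0 addr0 => /(_ erefl).
- by have := lr_ths rel (i := 2) (j := 0) isT isT; rewrite F2 /iv_theta /= z0 addr0 => /(_ erefl).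
- by have := lr_th rel (i := 3) (j := 0) isT isT; rewrite E3 /iv_theta /= z0 mulr0 addr0 => /(_ erefl).
- by have := lr_ths rel (i := 3) (j := 0) isT isT; rewrite F3 /iv_theta /= z0 mulr0 addr0 => /(_ erefl).
Qed.

(** The three-term relation for d = 3 reads theta_1 - theta_2 =
    - (theta_0 - theta_3), which makes the sums of [lr_sum] and the S_i the same as
    in the odd case of family III. *)
Lemma iv_descent : leonard_relations 3 th' ths' vph' ph' ->
  descent_condition 3 0 ths vph ph ths' vph' ph' <->
  exists h' hs', iv_array h' hs' r s ss th' ths' vph' ph'.
Proof.
move=> rel'; have [HT HV] := arr; have [h0 hs0 s0 ss0] := iv_neq0.
have [_ T1] := HT 1%N isT; have [_ T2] := HT 2%N isT; have [_ T3] := HT 3%N isT.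
have rat h' hs' i : (0 < i <= 3)%N ->
    iv_phi h' hs' r s ss i * vph i = iv_vphi h' hs' r s ss i * ph i.
  move=> id; have [-> ->] := HV i id; move: i id.
  by case=> [|[|[|[|]]]] // _; rewrite /iv_phi /iv_vphi /=; ring.
split=> [[aff ratio]|[h' [hs' [HT' HV']]]]; last first.
  have [_ T1'] := HT' 1%N isT; have [_ T2'] := HT' 2%N isT; have [_ T3'] := HT' 3%N isT.
  split=> [i id|i id].
    rewrite addn0; move: i id; apply: upto3; rewrite ?T1 ?T2 ?T3 ?T1' ?T2' ?T3' /iv_theta /=; ring.
  by rewrite addn0; have [-> ->] := HV' i id; exact: rat.
have ts : ths 1%N - ths 0%N != 0.
  by rewrite subr_eq0; apply/eqP => E; have := lr_ths rel (i := 1) (j := 0) isT isT E.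
pose xi := (ths' 1%N - ths' 0%N) / (ths 1%N - ths 0%N).
pose hs' := xi * hs; pose h' := - (th' 0%N - th' 3) / s.
have thsE i : (i <= 3)%N -> ths' i = iv_theta hs' ss (ths' 0%N) i.
  move=> id; have A := aff i id; rewrite addn0 in A.
  have -> : ths' i = ths' 0%N + xi * (ths i - ths 0%N).
    apply: (mulIf ts); rewrite mulrDl.
    have -> : ths' i * (ths 1%N - ths 0%N) = ths' 0%N * (ths 1%N - ths 0%N) +
      (ths' i - ths' 0%N) * (ths 1%N - ths 0%N) by ring.
    by rewrite A /xi; field.
  move: i id {A}; apply: upto3; rewrite ?T1 ?T2 ?T3 /iv_theta /hs' /=; ring.
have hs0' : hs' != 0.
  rewrite /hs' /xi !mulf_neq0 ?invr_eq0 // subr_eq0; apply/eqP => E.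
  by have := lr_ths rel' (i := 1) (j := 0) isT isT E.
have [T1' T2' T3'] : [/\ ths' 1%N = ths' 0%N + hs' * (ss + 1), ths' 2%N = ths' 0%N + hs' &
    ths' 3 = ths' 0%N + hs' * ss] by split; apply: thsE.
have [c tri] := lr_tri rel'; have [t1 t2] := tri 0%N isT.
have cN1 : c = -1.
  have n0 : - (hs' * ss) != 0 by rewrite oppr_eq0 mulf_neq0.
  apply: (mulIf n0); transitivity (c * (ths' 0%N - ths' 3)); first by rewrite T3'; ring.
  by rewrite -t1 T1' T2'; ring.
rewrite cN1 mulN1r in t2.
have th3 : th' 3 = iv_theta h' s (th' 0%N) 3 by rewrite /iv_theta /h' /=; field.
have RT i : (0 < i <= 3)%N ->
    ph' i * iv_vphi h' hs' r s ss i = vph' i * iv_phi h' hs' r s ss i.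
  move=> id; have v0 : vph i != 0 by apply: (lr_vph rel).
  have R := ratio i id; rewrite addn0 in R; apply: (mulIf v0).
  by rewrite -[RHS]mulrA rat // mulrAC R; ring.
have n03 := difference_0d (isT : (0 < 3)%N) rel'.
exists h', hs'.
have [] := irregular_uniqueness (isT : (0 < 3)%N) rel' RT (th2 := iv_theta h' s (th' 0%N)) _ _ isT.
- by [].
- exact: th3.
- apply: below3.
  + by rewrite big_ord1 /=; ring.
  + by rewrite big_ord_recr big_ord1 /= t2; ring.
  + by rewrite !big_ord_recr big_ord0 /= subn0; ring.
- move=> S S1 SS; have S2 := SS 1%N isT; have S3 := SS 2%N isT.
  have E2 : S 2%N = 0.
    by apply: (mulIf n03); rewrite mul0r S2 S1 /= t2; ring.
  have E3 : S 3 = 1.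
    have n02 : th' 0%N - th' 2%N != 0.
      by rewrite subr_eq0; apply/eqP => E; have := lr_th rel' (i := 0) (j := 2) isT isT E.
    by apply: (mulIf n02); rewrite S3 E2 /=; ring.
  exact: below3.
- by apply: below3 => /=; rewrite ?T1' ?T2' ?T3' /iv_theta /iv_vphi /iv_phi /=; ring.
- by apply: below3 => /=; rewrite ?T1' ?T2' ?T3' /iv_theta /iv_vphi /iv_phi /=; ring.
- move=> _ /= d1.
  have d2 : th' 2%N - iv_theta h' s (th' 0%N) 2 = 0.
    have -> : th' 2%N = th' 1%N + (th' 0%N - th' 3) by rewrite -[X in _ + X]opprK -t2; ring.
    rewrite th3 -[RHS]d1 /iv_theta /=; ring.
  apply: upto3 => //; first by rewrite subrr.
  by rewrite th3 subrr.
by move=> thE vE; split=> // i id; split; [exact: thE | exact: thsE].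
Qed.

End FourPointArrays.

Section FourPointForm.
Variables (K : fieldType) (L : closedFieldType) (iota : {rmorphism K -> L}).

Lemma form_IV_array h hs r s ss d p : 2%N \in [pchar K] -> d = 3%N ->
  (exists th0 ths0, form_IV iota h hs r s ss th0 ths0 d p) <->
  iv_array h hs r s ss (iota \o theta p) (iota \o thetas p) (iota \o vphi p) (iota \o phi p).
Proof.
move=> c2 ->.
have z x y t : iv_theta x y t 0 = t :> L by [].
have C := closed_form_array iota p (d := 3) (thf := iv_theta h s) (thsf := iv_theta hs ss)
  (vphf := iv_vphi h hs r s ss) (phf := iv_phi h hs r s ss)
  (z h s) (z hs ss) (fun t i _ => erefl) (fun t i _ => erefl) (fun i _ => erefl) (fun i _ => erefl).
split=> [[x [y [_ _ H]]]|H].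
  exact: (proj1 C (ex_intro _ x (ex_intro _ y H))).
by have [x [y H']] := proj2 C H; exists x, y.
Qed.

(** For d' = 1 the affine condition is void, and every array of diameter 1 is of
    type IIC with s' s^{*'} / r' = 1 - phi'_1 / vphi'_1. *)
Lemma one_descent d rho p p' : (rho + 1 <= d)%N ->
  leonard_relations d (iota \o theta p) (iota \o thetas p) (iota \o vphi p) (iota \o phi p) ->
  leonard_relations 1 (iota \o theta p') (iota \o thetas p') (iota \o vphi p') (iota \o phi p') ->
  descent_condition 1 rho (iota \o thetas p) (iota \o vphi p) (iota \o phi p)
    (iota \o thetas p') (iota \o vphi p') (iota \o phi p') <->
  exists (r' s' ss' : L) (th0' ths0' : K), form_IIC iota r' s' ss' th0' ths0' 1 p' /\
     s' * ss' / r' = iota (1 - phi p rho.+1 / vphi p rho.+1).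
Proof.
move=> rd rel rel'.
have v0 : iota (vphi p rho.+1) != 0 by apply: (lr_vph rel); lia.
have v0' : iota (vphi p' 1) != 0 by apply: (lr_vph rel').
have iE : iota (1 - phi p rho.+1 / vphi p rho.+1) =
    1 - iota (phi p rho.+1) / iota (vphi p rho.+1) by rewrite rmorphB rmorph1 fmorph_div.
split=> [[_ ratio]|[r [s [ss [t [ts [H E]]]]]]]; last first.
  have [_ HV] := proj1 (form_IIC_array iota r s ss 1 p')
    (ex_intro _ t (ex_intro _ ts H)).
  have [/= v1 p1] := HV 1%N isT.
  have {}v1 : iota (vphi p' 1) = - r by rewrite v1 /p_vphi; ring.
  have {}p1 : iota (phi p' 1) = - (r - s * ss) by rewrite p1 /p_phi; ring.
  have r0 : r != 0 by rewrite -oppr_eq0 -v1.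
  split=> [i|[|[|//]]] //.
    by case: i => [|[|//]] _; rewrite ?add0n ?add1n; ring.
  move=> _; rewrite add1n /= v1 p1.
  have -> : - (r - s * ss) = - r * (1 - s * ss / r) by field.
  by rewrite E iE; field.
have R : iota (phi p' 1) * iota (vphi p rho.+1) = iota (vphi p' 1) * iota (phi p rho.+1).
  by have := ratio 1%N isT; rewrite add1n.
have := lr_sum rel' (isT : (0 < 1)%N); rewrite big_ord1 subn0 /= => S.
pose s := iota (theta p' 1) - iota (theta p' 0).
pose ss := iota (thetas p' 1) - iota (thetas p' 0).
have p1 : iota (phi p' 1) = iota (vphi p' 1) + s * ss.
  transitivity (iota (vphi p' 1) - (iota (vphi p' 1) - iota (phi p' 1))); first by ring.
  by rewrite S /s /ss; ring.
have [|t [ts H]] := proj2 (form_IIC_array iota (- iota (vphi p' 1)) s ss 1 p').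
  split=> [[|[|//]]|[|[|//]]] //= _; rewrite /p_theta /p_vphi /p_phi.
  - by split; ring.
  - by rewrite /s /ss; split; ring.
  - by rewrite p1; split; ring.
exists (- iota (vphi p' 1)), s, ss, t, ts; split=> //.
rewrite iE; have -> : iota (phi p rho.+1) = iota (phi p' 1) * iota (vphi p rho.+1) / iota (vphi p' 1).
  by rewrite R; field.
by rewrite p1; field; rewrite oppr_eq0 v0 v0'.
Qed.

End FourPointForm.

(** * The cases *)

Section Cases.
Variables (K : fieldType) (L : closedFieldType) (iota : {rmorphism K -> L}).
Variables (d d' rho : nat) (p p' : parray K).
Hypothesis d0' : (0 < d')%N.
Hypothesis rd : (rho + d' <= d)%N.

Let th := iota \o theta p.
Let ths := iota \o thetas p.
Let vph := iota \o vphi p.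
Let ph := iota \o phi p.
Let th' := iota \o theta p'.
Let ths' := iota \o thetas p'.
Let vph' := iota \o vphi p'.
Let ph' := iota \o phi p'.

Hypothesis rel : leonard_relations d th ths vph ph.
Hypothesis rel' : leonard_relations d' th' ths' vph' ph'.

Let descends := descent_condition d' rho ths vph ph ths' vph' ph'.

Let d0 : (0 < d)%N. Proof. lia. Qed.

Let q_array_eq q n (f g v w : nat -> L) b c bs cs k b2 c2 bs2 cs2 k2 :
  b = b2 -> c = c2 -> bs = bs2 -> cs = cs2 -> k = k2 ->
  q_array q b c bs cs k n f g v w -> q_array q b2 c2 bs2 cs2 k2 n f g v w.
Proof. by do 5!move=> ->. Qed.

Let p_array_eq n (f g v w : nat -> L) b c bs cs k b2 c2 bs2 cs2 k2 :
  b = b2 -> c = c2 -> bs = bs2 -> cs = cs2 -> k = k2 ->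
  p_array b c bs cs k n f g v w -> p_array b2 c2 bs2 cs2 k2 n f g v w.
Proof. by do 5!move=> ->. Qed.

Let theta_neq n (t ts v f : nat -> L) : (0 < n)%N -> leonard_relations n t ts v f ->
  t 1%N != t 0%N /\ ts 1%N != ts 0%N.
Proof.
move=> n0 r; split; apply/eqP => E.
  by have := lr_th r n0 (leq0n n) E.
by have := lr_ths r n0 (leq0n n) E.
Qed.

(** The scale factors h' and h^*' of the target are those of the source times the
    eta and xi of [q_descent], up to a power of q; conversely eta and xi are
    recovered as quotients, since distinct eigenvalues make h and h^* nonzero. *)
Lemma case_I q h hs r1 r2 s ss th0 ths0 :
  form_I iota q h hs r1 r2 s ss th0 ths0 d p ->
  descends <-> exists (h' hs' : L) (th0' ths0' : K),
    form_I iota q h' hs' (r1 * q ^+ rho) (r2 * q ^+ rho)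
      (s * q ^+ (d - d')) (ss * q ^+ (2 * rho)) th0' ths0' d' p'.
Proof.
move=> H; have [n1 n1s] := theta_neq d0 rel.
have q0 : q != 0.
  apply: contra_neq n1 => q0; have [_ [HT _]] := H.
  have [E1 _] := HT 1%N d0; have [E0 _] := HT 0%N (leq0n d).
  by rewrite /th /= E1 E0 q0 expr1 expr0 invr0; ring.
have qn0 n : q ^+ n != 0 by rewrite expf_neq0.
have rr := proj1 H.
have arr := proj1 (form_I_array iota h hs p q0 rr) (ex_intro _ th0 (ex_intro _ ths0 H)).
have h0 : h != 0.
  by apply: contra_neq n1 => z; have [/(_ 1%N d0)[T _] _] := arr; apply: etrans T _; rewrite /th /q_theta z; ring.
have hs0 : hs != 0.
  by apply: contra_neq n1s => z; have [/(_ 1%N d0)[_ T] _] := arr; apply: etrans T _; rewrite /ths /q_theta z; ring.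
have rr' : r1 * q ^+ rho * (r2 * q ^+ rho) =
    s * q ^+ (d - d') * (ss * q ^+ (2 * rho)) * q ^+ d'.+1.
  transitivity (r1 * r2 * q ^+ rho ^+ 2); first by ring.
  have -> : q ^+ rho ^+ 2 = q ^+ (2 * rho) by rewrite mulnC exprM.
  have -> : s * q ^+ (d - d') * (ss * q ^+ (2 * rho)) * q ^+ d'.+1 =
    s * ss * (q ^+ (d - d') * q ^+ d'.+1) * q ^+ (2 * rho) by ring.
  have dd : (d' <= d)%N by lia.
  by rewrite -exprD addnS subnK // rr.
have q2 : q ^+ (2 * rho) = q ^+ rho ^+ 2 by rewrite mulnC exprM.
apply: iff_trans (q_descent q0 d0' rd rel rel' arr) _; split=> [[eta [xi A]]|[h' [hs' E]]].
  exists (eta * h), (xi * hs / q ^+ rho); apply/(form_I_array _ _ _ _ q0 rr').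
  move: A; apply: q_array_eq => //; rewrite ?q2; try ring; by field; rewrite qn0.
exists (h' / h), (hs' / hs * q ^+ rho).
have := proj1 (form_I_array iota h' hs' p' q0 rr') E.
by apply: q_array_eq; rewrite ?q2; field; rewrite ?h0 ?hs0 ?qn0.
Qed.

Lemma case_IA q hs r s th0 ths0 :
  form_IA iota q hs r s th0 ths0 d p ->
  descends <-> exists (hs' r' s' : L) (th0' ths0' : K),
    form_IA iota q hs' r' s' th0' ths0' d' p' /\
    s' / r' = q ^+ (d - d' - rho) * (s / r).
Proof.
move=> H; have [n1 n1s] := theta_neq d0 rel; have [n1' n1s'] := theta_neq d0' rel'.
have q0 : q != 0.
  apply: contra_neq n1 => q0; have [HT _] := H.
  have [E1 _] := HT 1%N d0; have [E0 _] := HT 0%N (leq0n d).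
  by rewrite /th /= E1 E0 q0; ring.
have qn0 n : q ^+ n != 0 by rewrite expf_neq0.
have arr := proj1 (form_IA_array iota hs r s d p q0) (ex_intro _ th0 (ex_intro _ ths0 H)).
have s0 : s != 0.
  by apply: contra_neq n1 => z; have [/(_ 1%N d0)[T _] _] := arr; apply: etrans T _; rewrite /th /q_theta z; ring.
have hs0 : hs != 0.
  by apply: contra_neq n1s => z; have [/(_ 1%N d0)[_ T] _] := arr; apply: etrans T _; rewrite /ths /q_theta z; ring.
have r0 : r != 0.
  have := lr_vph rel (ltac:(lia) : (0 < 1 <= d)%N); apply: contra_neq => z.
  by have [_ /(_ 1%N d0)[T _]] := arr; apply: etrans T _; rewrite /vph /q_vphi z; ring.
have qd : q ^+ (d - d' - rho) = q ^+ (d - d') / q ^+ rho by rewrite q_subn //; lia.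
apply: iff_trans (q_descent q0 d0' rd rel rel' arr) _.
split=> [[eta [xi A]]|[hs' [r' [s' [x [y [E R]]]]]]].
  have e0 : eta != 0.
    by apply: contra_neq n1' => z; have [/(_ 1%N d0')[T _] _] := A; apply: etrans T _; rewrite /th' /q_theta z; ring.
  have [|x [y E]] := proj2 (form_IA_array iota (xi * hs / q ^+ rho) (eta * r * q ^+ rho)
    (eta * s * q ^+ (d - d')) d' p' q0).
    by move: A; apply: q_array_eq; try ring; by field; rewrite qn0.
  exists (xi * hs / q ^+ rho), (eta * r * q ^+ rho), (eta * s * q ^+ (d - d')), x, y.
  by split=> //; rewrite qd; field; rewrite ?qn0 ?e0 ?r0.
have A := proj1 (form_IA_array iota hs' r' s' d' p' q0) (ex_intro _ x (ex_intro _ y E)).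
have s0' : s' != 0.
  by apply: contra_neq n1' => z; have [/(_ 1%N d0')[T _] _] := A; apply: etrans T _; rewrite /th' /q_theta z; ring.
have r0' : r' != 0.
  have := lr_vph rel' (ltac:(lia) : (0 < 1 <= d')%N); apply: contra_neq => z.
  by have [_ /(_ 1%N d0')[T _]] := A; apply: etrans T _; rewrite /vph' /q_vphi z; ring.
have rE : r' = s' / s * r / q ^+ (d - d') * q ^+ rho.
  have -> : s' = s' / r' * r' by field.
  by rewrite R qd; field; rewrite ?qn0 ?s0 ?r0.
exists (s' / s / q ^+ (d - d')), (hs' / hs * q ^+ rho); move: A.
apply: q_array_eq; rewrite ?rE; try ring; by field; rewrite ?qn0 ?s0 ?hs0.
Qed.

Lemma case_II h hs r1 r2 s ss th0 ths0 :
  form_II iota h hs r1 r2 s ss th0 ths0 d p ->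
  descends <-> exists (h' hs' : L) (th0' ths0' : K),
    form_II iota h' hs' (r1 + rho%:R) (r2 + rho%:R)
      (s + d%:R - d'%:R) (ss + 2 * rho%:R) th0' ths0' d' p'.
Proof.
move=> H; have [n1 n1s] := theta_neq d0 rel; have rr := proj1 H.
have arr := proj1 (form_II_array iota h hs p rr) (ex_intro _ th0 (ex_intro _ ths0 H)).
have h0 : h != 0.
  by apply: contra_neq n1 => z; have [/(_ 1%N d0)[T _] _] := arr; apply: etrans T _; rewrite /th /p_theta z; ring.
have hs0 : hs != 0.
  by apply: contra_neq n1s => z; have [/(_ 1%N d0)[_ T] _] := arr; apply: etrans T _; rewrite /ths /p_theta z; ring.
have rr' : r1 + rho%:R + (r2 + rho%:R) = s + d%:R - d'%:R + (ss + 2 * rho%:R) + d'%:R + 1.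
  by transitivity (r1 + r2 + 2 * rho%:R); [ring | rewrite rr; ring].
have r2E : r2 = s + ss + d%:R + 1 - r1 by rewrite -rr; ring.
apply: iff_trans (p_descent d0' rd rel rel' arr) _; split=> [[eta [xi A]]|[h' [hs' E]]].
  exists (eta * h), (xi * hs); apply/(form_II_array _ _ _ _ rr').
  by move: A; apply: p_array_eq; rewrite ?r2E; ring.
exists (h' / h), (hs' / hs); have := proj1 (form_II_array iota h' hs' p' rr') E.
by apply: p_array_eq; rewrite ?r2E; field; rewrite ?h0 ?hs0.
Qed.

Lemma case_IIA h r s ss th0 ths0 :
  form_IIA iota h r s ss th0 ths0 d p ->
  descends <-> exists (h' ss' : L) (th0' ths0' : K),
    form_IIA iota h' (r + rho%:R) (s + d%:R - d'%:R) ss' th0' ths0' d' p'.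
Proof.
move=> H; have [n1 n1s] := theta_neq d0 rel.
have arr := proj1 (form_IIA_array iota h r s ss d p) (ex_intro _ th0 (ex_intro _ ths0 H)).
have h0 : h != 0.
  by apply: contra_neq n1 => z; have [/(_ 1%N d0)[T _] _] := arr; apply: etrans T _; rewrite /th /p_theta z; ring.
have ss0 : ss != 0.
  by apply: contra_neq n1s => z; have [/(_ 1%N d0)[_ T] _] := arr; apply: etrans T _; rewrite /ths /p_theta z; ring.
apply: iff_trans (p_descent d0' rd rel rel' arr) _; split=> [[eta [xi A]]|[h' [ss' E]]].
  exists (eta * h), (xi * ss); apply/form_IIA_array.
  by move: A; apply: p_array_eq; ring.
exists (h' / h), (ss' / ss); have := proj1 (form_IIA_array iota _ _ _ _ _ p') E.
by apply: p_array_eq; field; rewrite ?h0 ?ss0.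
Qed.

Lemma case_IIB hs r s ss th0 ths0 :
  form_IIB iota hs r s ss th0 ths0 d p ->
  descends <-> exists (hs' s' : L) (th0' ths0' : K),
    form_IIB iota hs' (r + rho%:R) s' (ss + 2 * rho%:R) th0' ths0' d' p'.
Proof.
move=> H; have [n1 n1s] := theta_neq d0 rel.
have arr := proj1 (form_IIB_array iota hs r s ss d p) (ex_intro _ th0 (ex_intro _ ths0 H)).
have s0 : s != 0.
  by apply: contra_neq n1 => z; have [/(_ 1%N d0)[T _] _] := arr; apply: etrans T _; rewrite /th /p_theta z; ring.
have hs0 : hs != 0.
  by apply: contra_neq n1s => z; have [/(_ 1%N d0)[_ T] _] := arr; apply: etrans T _; rewrite /ths /p_theta z; ring.
apply: iff_trans (p_descent d0' rd rel rel' arr) _; split=> [[eta [xi A]]|[hs' [s' E]]].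
  exists (xi * hs), (eta * s); apply/form_IIB_array.
  by move: A; apply: p_array_eq; ring.
exists (s' / s), (hs' / hs); have := proj1 (form_IIB_array iota _ _ _ _ _ p') E.
by apply: p_array_eq; field; rewrite ?s0 ?hs0.
Qed.

Lemma case_IIC r s ss th0 ths0 :
  form_IIC iota r s ss th0 ths0 d p ->
  descends <-> exists (r' s' ss' : L) (th0' ths0' : K),
    form_IIC iota r' s' ss' th0' ths0' d' p' /\ s' * ss' / r' = s * ss / r.
Proof.
move=> H; have [n1 n1s] := theta_neq d0 rel; have [n1' n1s'] := theta_neq d0' rel'.
have arr := proj1 (form_IIC_array iota r s ss d p) (ex_intro _ th0 (ex_intro _ ths0 H)).
have s0 : s != 0.
  by apply: contra_neq n1 => z; have [/(_ 1%N d0)[T _] _] := arr; apply: etrans T _; rewrite /th /p_theta z; ring.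
have ss0 : ss != 0.
  by apply: contra_neq n1s => z; have [/(_ 1%N d0)[_ T] _] := arr; apply: etrans T _; rewrite /ths /p_theta z; ring.
have r0 : r != 0.
  have := lr_vph rel (ltac:(lia) : (0 < 1 <= d)%N); apply: contra_neq => z.
  by have [_ /(_ 1%N d0)[T _]] := arr; apply: etrans T _; rewrite /vph /p_vphi z; ring.
apply: iff_trans (p_descent d0' rd rel rel' arr) _.
split=> [[eta [xi A]]|[r' [s' [ss' [x [y [E R]]]]]]].
  have e0 : eta != 0.
    by apply: contra_neq n1' => z; have [/(_ 1%N d0')[T _] _] := A; apply: etrans T _; rewrite /th' /p_theta z; ring.
  have x0 : xi != 0.
    by apply: contra_neq n1s' => z; have [/(_ 1%N d0')[_ T] _] := A; apply: etrans T _; rewrite /ths' /p_theta z; ring.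
  have [|x [y E]] := proj2 (form_IIC_array iota (eta * xi * r) (eta * s) (xi * ss) d' p').
    by move: A; apply: p_array_eq; ring.
  exists (eta * xi * r), (eta * s), (xi * ss), x, y; split=> //.
  by field; rewrite ?r0 ?e0 ?x0.
have A := proj1 (form_IIC_array iota r' s' ss' d' p') (ex_intro _ x (ex_intro _ y E)).
have r0' : r' != 0.
  have := lr_vph rel' (ltac:(lia) : (0 < 1 <= d')%N); apply: contra_neq => z.
  by have [_ /(_ 1%N d0')[T _]] := A; apply: etrans T _; rewrite /vph' /p_vphi z; ring.
have rE : r' = s' / s * (ss' / ss) * r.
  transitivity (s' * ss' / r' * r' * r / (s * ss)).
    by rewrite R; field; rewrite ?s0 ?ss0 ?r0.
  by field; rewrite ?s0 ?ss0 ?r0'.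
exists (s' / s), (ss' / ss); move: A.
by apply: p_array_eq; rewrite ?rE; field; rewrite ?s0 ?ss0.
Qed.

Lemma case_III h hs r1 r2 s ss th0 ths0 :
  form_III iota h hs r1 r2 s ss th0 ths0 d p ->
  [/\ (~~ odd d /\ ~~ odd d' /\ ~~ odd rho) \/ (odd d /\ odd d' /\ ~~ odd rho) ->
      descends <-> exists (h' hs' : L) (th0' ths0' : K),
        form_III iota h' hs' (r1 + rho%:R) (r2 + rho%:R)
          (s - d%:R + d'%:R) (ss - 2 * rho%:R) th0' ths0' d' p',
      ~~ odd d /\ ~~ odd d' /\ odd rho ->
      descends <-> exists (h' hs' : L) (th0' ths0' : K),
        form_III iota h' hs' (r2 + rho%:R) (r1 + rho%:R)
          (s - d%:R + d'%:R) (ss - 2 * rho%:R) th0' ths0' d' p' &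
      (~~ odd d /\ odd d' /\ (3 <= d')%N) \/ (odd d /\ (~~ odd d' \/ odd rho)) ->
      ~ descends].
Proof.
move=> H.
have arr := proj1 (form_III_array iota h hs r1 r2 s ss d p) (ex_intro _ th0 (ex_intro _ ths0 H)).
have D := alt_descent d0' rd rel rel' arr.
split.
- move=> par; have [dd [drho orho]] : odd d = odd d' /\ (odd d -> ~~ odd rho) /\ odd rho = false.
    by case: par => -[od [od' orho]]; rewrite ?(negPf od) ?(negPf od') ?(negPf orho) ?od ?od'.
  have := D dd drho; rewrite orho => D'; apply: iff_trans D' _.
  by split=> -[h' [hs' A]]; exists h', hs'; apply/form_III_array.
- move=> [od [od' orho]].
  have := D (etrans (negPf od) (esym (negPf od'))) (fun o => False_ind _ (negP od o)).
  rewrite orho => D'; apply: iff_trans D' _.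
  by split=> -[h' [hs' A]]; exists h', hs'; apply/form_III_array.
- exact: (alt_no_descent d0' rd rel rel' arr).
Qed.

End Cases.

(** In family IV one has vphi_2 = phi_2, which excludes rho = 1; for d' = 2 and
    rho = 0 it contradicts vphi'_2 - phi'_2 being a multiple of
    theta'_0 - theta'_2. *)
Lemma case_IV_none (F : fieldType) d' rho (th ths vph ph th' ths' vph' ph' : nat -> F)
    h hs r s ss :
  leonard_relations 3 th ths vph ph -> leonard_relations d' th' ths' vph' ph' ->
  iv_array h hs r s ss th ths vph ph ->
  (d', rho) = (1%N, 1%N) \/ (d', rho) = (2%N, 0%N) \/ (d', rho) = (2%N, 1%N) ->
  ~ descent_condition d' rho ths vph ph ths' vph' ph'.
Proof.
move=> rel rel' [_ HV] dr H.
have [/= v2 p2] := HV 2%N isT; have E2 : vph 2%N == ph 2%N by rewrite v2 p2.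
have d0' : (0 < d')%N by case: dr => [[-> _]|[[-> _]|[-> _]]].
have rd : (rho + d' <= 3)%N by case: dr => [[-> ->]|[[-> ->]|[-> ->]]].
have first := relations_first rel' d0'.
have deq i (id : (0 < i <= d')%N) := descent_eq rel rel' rd id H.
case: dr => [[d1 r1]|[[d2 r0]|[d2 r1]]]; last 1 first.
- by move: first; rewrite deq ?d2 // r1 E2.
- by move: first; rewrite deq ?d1 // r1 E2.
subst d' rho; have := deq 2%N isT; rewrite addn0 E2.
rewrite -subr_eq0 (lr_sum rel') // mulf_eq0 => /orP[].
  by rewrite subr_eq0 => /eqP E; have := lr_ths rel' (i := 2) (j := 1) isT isT E.
rewrite big_ord_recr big_ord1 /= subrr addr0 => /eqP E.
by have := difference_0d (isT : (0 < 2)%N) rel'; rewrite -E subn0 eqxx.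
Qed.

Theorem mainTheorem2
  (K : fieldType)
  (L : closedFieldType) (iota : {rmorphism K -> L})
  (HL : algebraic_closure iota)
  (d d' rho : nat) (hd' : (1 <= d')%N) (hd : (d' <= d)%N)
  (hrho : (rho <= d - d')%N)
  (AA AA' : algType K) (V : lmodType AA) (V' : lmodType AA')
  (Phi : leonard_data d AA) (Phi' : leonard_data d' AA')
  (HPhi : leonard_system V Phi) (HPhi' : leonard_system V' Phi')
  (p p' : parray K)
  (Hp : parameter_array V Phi p) (Hp' : parameter_array V' Phi' p') :
  (* Case I *)
  (forall (q h hs r1 r2 s ss : L) (th0 ths0 : K),
     form_I iota q h hs r1 r2 s ss th0 ths0 d p ->
     (rho_descendent V V' rho Phi Phi' <->
      exists (h' hs' : L) (th0' ths0' : K),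
        form_I iota q h' hs' (r1 * q ^+ rho) (r2 * q ^+ rho)
          (s * q ^+ (d - d')) (ss * q ^+ (2 * rho)) th0' ths0' d' p'))
  /\
  (* Case IA *)
  (forall (q hs r s : L) (th0 ths0 : K),
     form_IA iota q hs r s th0 ths0 d p ->
     (rho_descendent V V' rho Phi Phi' <->
      exists (hs' r' s' : L) (th0' ths0' : K),
        form_IA iota q hs' r' s' th0' ths0' d' p' /\
        s' / r' = q ^+ (d - d' - rho) * (s / r)))
  /\
  (* Case II *)
  (forall (h hs r1 r2 s ss : L) (th0 ths0 : K),
     form_II iota h hs r1 r2 s ss th0 ths0 d p ->
     (rho_descendent V V' rho Phi Phi' <->
      exists (h' hs' : L) (th0' ths0' : K),
        form_II iota h' hs' (r1 + rho%:R) (r2 + rho%:R)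
          (s + d%:R - d'%:R) (ss + 2 * rho%:R) th0' ths0' d' p'))
  /\
  (* Case IIA *)
  (forall (h r s ss : L) (th0 ths0 : K),
     form_IIA iota h r s ss th0 ths0 d p ->
     (rho_descendent V V' rho Phi Phi' <->
      exists (h' ss' : L) (th0' ths0' : K),
        form_IIA iota h' (r + rho%:R) (s + d%:R - d'%:R) ss'
          th0' ths0' d' p'))
  /\
  (* Case IIB *)
  (forall (hs r s ss : L) (th0 ths0 : K),
     form_IIB iota hs r s ss th0 ths0 d p ->
     (rho_descendent V V' rho Phi Phi' <->
      exists (hs' s' : L) (th0' ths0' : K),
        form_IIB iota hs' (r + rho%:R) s' (ss + 2 * rho%:R)
          th0' ths0' d' p'))
  /\
  (* Case IIC *)
  (forall (r s ss : L) (th0 ths0 : K),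
     form_IIC iota r s ss th0 ths0 d p ->
     (rho_descendent V V' rho Phi Phi' <->
      exists (r' s' ss' : L) (th0' ths0' : K),
        form_IIC iota r' s' ss' th0' ths0' d' p' /\
        s' * ss' / r' = s * ss / r))
  /\
  (* Case III *)
  (forall (h hs r1 r2 s ss : L) (th0 ths0 : K),
     form_III iota h hs r1 r2 s ss th0 ths0 d p ->
     [/\ (~~ odd d /\ ~~ odd d' /\ ~~ odd rho) \/
         (odd d /\ odd d' /\ ~~ odd rho) ->
         (rho_descendent V V' rho Phi Phi' <->
          exists (h' hs' : L) (th0' ths0' : K),
            form_III iota h' hs' (r1 + rho%:R) (r2 + rho%:R)
              (s - d%:R + d'%:R) (ss - 2 * rho%:R) th0' ths0' d' p'),
         ~~ odd d /\ ~~ odd d' /\ odd rho ->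
         (rho_descendent V V' rho Phi Phi' <->
          exists (h' hs' : L) (th0' ths0' : K),
            form_III iota h' hs' (r2 + rho%:R) (r1 + rho%:R)
              (s - d%:R + d'%:R) (ss - 2 * rho%:R) th0' ths0' d' p'),
         ~~ odd d /\ d' = 1%N ->
         (rho_descendent V V' rho Phi Phi' <->
          exists (r' s' ss' : L) (th0' ths0' : K),
            form_IIC iota r' s' ss' th0' ths0' 1 p' /\
            s' * ss' / r' = iota (1 - phi p rho.+1 / vphi p rho.+1)) &
         (~~ odd d /\ odd d' /\ (3 <= d')%N) \/
         (odd d /\ (~~ odd d' \/ odd rho)) ->
         ~ rho_descendent V V' rho Phi Phi'])
  /\
  (* Case IV *)
  (forall (h hs r s ss : L) (th0 ths0 : K),
     form_IV iota h hs r s ss th0 ths0 d p ->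
     [/\ (d', rho) = (1%N, 0%N) \/ (d', rho) = (1%N, 2%N) ->
         (rho_descendent V V' rho Phi Phi' <->
          exists (r' s' ss' : L) (th0' ths0' : K),
            form_IIC iota r' s' ss' th0' ths0' 1 p' /\
            s' * ss' / r' = iota (1 - phi p rho.+1 / vphi p rho.+1)),
         (d', rho) = (3%N, 0%N) ->
         (rho_descendent V V' rho Phi Phi' <->
          exists (h' hs' : L) (th0' ths0' : K),
            form_IV iota h' hs' r s ss th0' ths0' d' p') &
         (d', rho) = (1%N, 1%N) \/ (d', rho) = (2%N, 0%N) \/
         (d', rho) = (2%N, 1%N) ->
         ~ rho_descendent V V' rho Phi Phi']).
Proof.
have rd : (rho + d' <= d)%N by lia.
have [? [? [? [? [? [? [_ _ _ relK]]]]]]] := leonard_modelP HPhi Hp.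
have [? [? [? [? [? [? [_ _ _ relK']]]]]]] := leonard_modelP HPhi' Hp'.
have rel := relations_map iota relK; have rel' := relations_map iota relK'.
have key := iff_trans (descendentP hd' rd HPhi HPhi' Hp Hp')
  (descent_condition_map iota d' rho _ _ _ _ _ _).
do 6?[split; first by move=> *; apply: iff_trans key _;
  first [ exact: (case_I hd' rd rel rel' ltac:(eassumption))
        | exact: (case_IA hd' rd rel rel' ltac:(eassumption))
        | exact: (case_II hd' rd rel rel' ltac:(eassumption))
        | exact: (case_IIA hd' rd rel rel' ltac:(eassumption))
        | exact: (case_IIB hd' rd rel rel' ltac:(eassumption))
        | exact: (case_IIC hd' rd rel rel' ltac:(eassumption)) ]].
split.
  move=> h hs r1 r2 s ss th0 ths0 H.
  have [H1 H2 H3] := case_III hd' rd rel rel' H; split.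
  - by move=> /H1; apply: iff_trans.
  - by move=> /H2; apply: iff_trans.
  - move=> [_ d1]; subst d'; apply: iff_trans key _.
    exact: (one_descent rd rel rel').
  - by move=> /H3 N /key.
move=> h hs r s ss th0 ths0 H; have [c2 d3 _] := H; subst d.
have arr := proj1 (form_IV_array iota h hs r s ss p c2 erefl) (ex_intro _ th0 (ex_intro _ ths0 H)).
split.
- move=> dr; have d1 : d' = 1%N by case: dr => [[-> _]|[-> _]].
  by subst d'; apply: iff_trans key _; apply: (one_descent rd rel rel').
- case=> d3 r0; subst d' rho; apply: iff_trans key _.
  apply: iff_trans (iv_descent rel arr rel') _.
  by split=> -[h' [hs' A]]; exists h', hs'; apply/(form_IV_array _ _ _ _ _ _ _ c2 erefl).
- by move=> dr /key; apply: (case_IV_none rel rel' arr dr).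
Qed.
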